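(* Let $f\in\mathcal{S}(S^m)$ be a symmetric $m$-tensor field on $\mathbb{R}^n$ and let $k$ be a fixed integer with $1\le k\le \min\{n-1,m\}$. Then there exist a uniquely determined smooth symmetric $m$-tensor field $g\in C^\infty(S^m)$ and a uniquely determined smooth symmetric $(m-k)$-tensor field $v\in C^\infty(S^{m-k})$ satisfying $$f=g+\mathrm{d}^k v,\qquad \delta^k g=0,\qquad g(x)\to 0 \text{ and } v(x)\to 0 \text{ as } |x|\to\infty .$$ Additionally, there is a constant $C$ such that for all $x\in\mathbb{R}^n$ $$|g(x)|\le C(1+|x|)^{1-n},\qquad |\mathrm{d}^{\ell}v(x)|\le C(1+|x|)^{k+1-\ell-n}\quad\text{for } 0\le \ell\le k .$$
   Context: $S^m=S^m(\mathbb{R}^n)$ is the space of symmetric $m$-tensors on $\mathbb{R}^n$ (for $m=0$, scalars). $\mathcal{S}(S^m)$ and $C^\infty(S^m)$ denote the symmetric $m$-tensor fields on $\mathbb{R}^n$ whose components (in standard Euclidean coordinates) are Schwartz functions, respectively smooth functions. The symmetrization $\sigma(i_1\dots i_m)$ averages over all permutations of the indices $i_1,\dots,i_m$. The inner differentiation (symmetrized derivative) $\mathrm{d}:C^\infty(S^m)\to C^\infty(S^{m+1})$ is $(\mathrm{d}u)_{i_1\dots i_{m+1}}=\sigma(i_1\dots i_{m+1})\left(\frac{\partial u_{i_1\dots i_m}}{\partial x_{i_{m+1}}}\right)$, and the divergence $\delta:C^\infty(S^m)\to C^\infty(S^{m-1})$ is $(\delta u)_{i_1\dots i_{m-1}}=\sum_{j=1}^n\frac{\partial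 u_{i_1\dots i_{m-1}j}}{\partial x_j}$. $\mathrm{d}^k$ and $\delta^k$ denote $k$-fold iterates, and $\mathrm{d}^0$ is the identity. *)

(* Defs.v *)
From HB Require Import structures.
From mathcomp Require Import all_boot all_order all_algebra all_fingroup.
From mathcomp Require Import all_classical all_reals all_analysis.

Set Implicit Arguments.
Unset Strict Implicit.
Unset Printing Implicit Defensive.

Import Order.TTheory GRing.Theory Num.Theory numFieldNormedType.Exports.
Local Open Scope classical_set_scope.
Local Open Scope ring_scope.

(* The library norm `|x| on 'rV[R]_n is the sup norm. *)
Definition enorm (R : realType) (n : nat) (x : 'rV[R]_n) : R :=
  Num.sqrt (\sum_i x 0 i ^+ 2).

Definition at_infty (R : realType) (n : nat) : set_system 'rV[R]_n :=
  filter_from [set: R] (fun A => [set x | A < enorm x]).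
Arguments at_infty R n : clear implicits.

Global Instance at_infty_filter (R : realType) (n : nat) :
  Filter (at_infty R n).
Proof.
apply: filter_from_filter; first by exists 0.
move=> A B _ _; exists (Num.max A B) => // x /=.
by rewrite gt_max => /andP[].
Qed.

Section ScalarFields.
Context (R : realType) (n : nat).
Implicit Types (h : 'rV[R]_n -> R) (s : seq 'I_n).

Definition partials s h : 'rV[R]_n -> R := foldr (fun i w => 'D_('e_i) w) h s.

Definition smooth h : Prop := forall s,
  continuous (partials s h) /\ forall i x, derivable (partials s h) x 'e_i.

Definition schwartz h : Prop := smooth h /\
  forall (a : {ffun 'I_n -> nat}) s, exists C : R, forall x : 'rV[R]_n,
    `|(\prod_i x 0 i ^+ a i) * partials s h x| <= C.

End ScalarFields.

(* A tensor of rank m is given by its components T_(i_1 ... i_m) in the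
   standard basis; for m = 0 the only index is [tuple]. *)
Notation tensor R n m := {ffun m.-tuple 'I_n -> R}.
Notation tfield R n m := ('rV[R]_n -> tensor R n m).

Section Tensors.
Context (R : realType) (n : nat).

Definition perm_index m (s : 'S_m) (I : m.-tuple 'I_n) : m.-tuple 'I_n :=
  [tuple tnth I (s j) | j < m].

Definition symmetric_tensor m (T : tensor R n m) : Prop :=
  forall (s : 'S_m) I, T (perm_index s I) = T I.

Definition symmetrize m (T : tensor R n m) : tensor R n m :=
  [ffun I => (m`!)%:R^-1 * \sum_(s : 'S_m) T (perm_index s I)].

Definition tnorm m (T : tensor R n m) : R := Num.sqrt (\sum_I T I ^+ 2).

(* C^oo(S^m) *)
Definition smooth_sym m (u : tfield R n m) : Prop :=
  (forall x, symmetric_tensor (u x)) /\ forall I, smooth (fun x => u x I).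

(* The Schwartz space of S^m *)
Definition schwartz_sym m (u : tfield R n m) : Prop :=
  (forall x, symmetric_tensor (u x)) /\ forall I, schwartz (fun x => u x I).

Definition vanishes_at_infty m (u : tfield R n m) : Prop :=
  tnorm (u x) @[x --> at_infty R n] --> (0 : R).

Definition inner_d m (u : tfield R n m) : tfield R n m.+1 := fun x =>
  symmetrize [ffun I : m.+1.-tuple 'I_n =>
    'D_('e_(tnth I ord_max))
      (fun y => u y [tuple tnth I (widen_ord (leqnSn m) j) | j < m]) x].

Definition divergence m (u : tfield R n m.+1) : tfield R n m := fun x =>
  [ffun I : m.-tuple 'I_n =>
    \sum_j 'D_('e_j) (fun y => u y [tuple of rcons I j]) x].

Fixpoint iter_d k p (u : tfield R n p) : tfield R n (k + p) :=
  if k is k'.+1 then inner_d (iter_d k' u) else u.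

Fixpoint iter_div k p : tfield R n (k + p) -> tfield R n p :=
  if k is k'.+1 then fun u => @iter_div k' p (divergence u) else id.

Definition cast_tfield p q (e : p = q) (u : tfield R n p) : tfield R n q :=
  ecast r (tfield R n r) e u.

(* The casts along k + (m - k) = m only identify ranks. *)
Definition decomposition m k (hkm : (k <= m)%N) (f g : tfield R n m)
    (v : tfield R n (m - k)) : Prop :=
  [/\ smooth_sym g /\ smooth_sym v,
      forall x, f x = g x + cast_tfield (subnKC hkm) (iter_d k v) x,
      forall x, iter_div (cast_tfield (esym (subnKC hkm)) g) x = 0,
      vanishes_at_infty g
    & vanishes_at_infty v].

End Tensors.

(* Main.v *)
(* Put a = (p + 1) d and D = delta on symmetric p-tensors and let q be the Laplacian. Then
   D a = a D + q, hence delta^k d^k is a multiple of the product of the operators a D + j q,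
   1 <= j <= k, and the resolvent identity for a D inverts it up to a power of q: there is a
   constant coefficient operator A with A delta^k d^k = delta^k d^k A = c q^M.

   Uniqueness: the difference w of two potentials vanishes at infinity and satisfies q^M w = 0,
   so w = 0 by a Liouville theorem for polyharmonic functions.

   Existence: v is q^(-M) A delta^k f up to a constant, where q^(-M) is a weighted time integral of
   the heat flow. A delta^k f is a sum of derivatives of f of order l = 2 M - k; for such data
   the heat flow at time r^2 / 4 is O((1 + r + |x|)^(- n - l)), which makes the time integral
   converge because k < n and gives v = O(|x|^(k - n)), one order better than claimed. *)
Require Import Defs.
From HB Require Import structures.
From mathcomp Require Import all_boot all_order all_algebra all_fingroup.
From mathcomp Require Import all_classical all_reals all_analysis measurable_realfun.
From mathcomp Require Import ring lra zify.
Set Implicit Arguments.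
Unset Strict Implicit.
Unset Printing Implicit Defensive.
Import Order.TTheory GRing.Theory Num.Theory numFieldNormedType.Exports.
Local Open Scope classical_set_scope.
Local Open Scope ring_scope.

(** * Calculus on row vectors *)

(** Every integral below is one-dimensional: the Gaussian average on R^n is an iteration of averages
    along the coordinate axes, each folded onto a half-line and dominated by a multiple of
    [(1 + t ^ 2)^-1], whose primitive is [atan]. Smoothness is defined by iterated partial
    derivatives, so differentiation under an integral sign is reduced to a quadratic Taylor
    remainder that survives integration. For p = m - k the exponent is M = k (p + 1), because the
    resolvent of one factor at rank p costs p + 1 powers of q. That resolvent has order 2 p, so A
    has order 2 k p and l = 2 k p + k. In the variable r the weight t^(M - 1) dt is a multiple of
    r^(2 M - 1) dr, which leaves an integrand of size r^(k - n - 1) for large r: this is where k < n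
    enters. The Liouville theorem has no bound on the derivatives of w at its disposal, only that w
    vanishes at infinity; this is why derivatives are replaced by finite differences of averages. *)

Section OneVariable.
Context {R : realType}.
Implicit Types (f df : R -> R).

Lemma mvt0 f df t : (forall s : R, is_derive s 1 f (df s)) ->
  exists2 c, `|c| <= `|t| & f t - f 0 = df c * t.
Proof.
move=> fd; have fc : continuous f.
  by move=> s; apply/differentiable_continuous/derivable1_diffP; case: (fd s).
have fw (A : set R) : {within A, continuous f} by exact: continuous_subspaceT.
case: (lerP 0 t) => [t0|t0].
  have [c] := MVT_segment t0 (fun s _ => fd s) (fw _).
  by rewrite in_itv/= subr0 => /andP[c0 ct] ->; exists c => //; rewrite !ger0_norm.
have [c] := MVT_segment (ltW t0) (fun s _ => fd s) (fw _).
rewrite in_itv/= sub0r => /andP[c0 ct] e; exists c.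
  by rewrite !ler0_norm ?lerN2// ltW.
by rewrite -opprB e mulrN opprK.
Qed.

Lemma taylor1_le f df C t : (forall s : R, is_derive s 1 f (df s)) ->
  (forall s, `|s| <= `|t| -> `|df s| <= C) -> `|f t - f 0| <= C * `|t|.
Proof.
move=> fd dfC; have [c ct ->] := mvt0 t fd.
by rewrite normrM ler_wpM2r// dfC.
Qed.

Lemma taylor2_le f df ddf C t : (forall s : R, is_derive s 1 f (df s)) ->
  (forall s : R, is_derive s 1 df (ddf s)) ->
  (forall s, `|s| <= `|t| -> `|ddf s| <= C) ->
  `|f t - f 0 - t * df 0| <= C * t ^+ 2.
Proof.
move=> fd dfd ddfC; have [c ct ->] := mvt0 t fd.
rewrite mulrC -mulrBr normrM -[t ^+ 2]real_normK ?num_real// expr2 mulrA mulrC.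
have C0 : 0 <= C by apply: (le_trans _ (ddfC 0 _)) => //; rewrite normr0.
rewrite ler_wpM2r//; apply: (@le_trans _ _ (C * `|c|)); last by rewrite ler_wpM2l.
by apply: taylor1_le dfd _ => s sc; apply/ddfC/(le_trans sc).
Qed.

End OneVariable.

(** * Derivatives along a line *)

Section Directional.
Context {R : realType} {V : normedModType R}.
Implicit Types (h : V -> R) (x v : V).

Lemma is_derive_line h x v (s : R) : derivable h (x + s *: v) v ->
  is_derive s 1 (fun s => h (x + s *: v)) ('D_v h (x + s *: v)).
Proof.
move=> hd; have e : (fun t => t^-1 *: ((h \o shift (x + s *: v)) (t *: v) - h (x + s *: v)))
   = (fun t => t^-1 *: (((fun s => h (x + s *: v)) \o shift s) (t *: 1) - h (x + s *: v))).
  apply/funext => t /=; rewrite [t *: 1]mulr1 scalerDl.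
  by rewrite [x + (t *: v + _)]addrCA.
by apply: DeriveDef; [move: hd; rewrite /derivable e | rewrite /derive e].
Qed.

Lemma is_derive_of_line h x v (d : R) : is_derive (0 : R) 1 (fun s => h (x + s *: v)) d ->
  is_derive x v h d.
Proof.
have e : (fun t => t^-1 *: ((h \o shift x) (t *: v) - h x))
   = (fun t => t^-1 *: (((fun s => h (x + s *: v)) \o shift 0) (t *: 1) - h (x + 0 *: v))).
  apply/funext => t /=; rewrite [t *: 1]mulr1 addr0 scale0r addr0.
  by rewrite [t *: v + _]addrC.
by move=> [hd <-]; apply: DeriveDef; [move: hd; rewrite /derivable e|rewrite /derive e].
Qed.

(** A quadratic remainder for small increments yields derivability and the value at once. This form
    passes through integrals: a Taylor remainder of the integrand, bounded uniformly by a multiple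
    of [t ^+ 2], stays quadratic after integration. *)
Lemma is_derive_quadratic h x v (G C : R) :
  (forall t, `|t| <= 1 -> `|h (x + t *: v) - h x - t * G| <= C * t ^+ 2) ->
  is_derive x v h G.
Proof.
move=> hC; have C0 : 0 <= C.
  by have := hC 1; rewrite normr1 expr1n mulr1 => /(_ (lexx _)); exact: le_trans.
suff H : t^-1 *: ((h \o shift x) (t *: v) - h x) @[t --> 0^'] --> (G : R^o).
  by apply: DeriveDef; [apply/cvg_ex; exists G | exact: cvg_lim].
apply/cvgrPdist_le => e e0; near=> t.
have t0 : t != 0 by near: t; exact: nbhs_dnbhs_neq.
have t1 : `|t| <= 1 by near: t; apply: dnbhs0_le.
have te : `|t| <= e / (C + 1) by near: t; apply: dnbhs0_le; rewrite divr_gt0// ltr_wpDl.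
rewrite /= [t *: v + x]addrC distrC.
have -> : t^-1 *: (h (x + t *: v) - h x) - G = t^-1 * (h (x + t *: v) - h x - t * G).
  by rewrite mulrBr mulKf.
rewrite normrM normfV ler_pdivrMl ?normr_gt0// (le_trans (hC _ t1))//.
rewrite -[t ^+ 2]real_normK ?num_real// expr2 mulrCA ler_wpM2l//.
rewrite (le_trans (ler_wpM2l C0 te))// mulrCA ger_pMr//.
by rewrite ler_pdivrMr ?mul1r ?lerDl ?ltr_wpDl.
Unshelve. all: by end_near. Qed.

Lemma taylor1_line h x v C t : (forall s : R, derivable h (x + s *: v) v) ->
  (forall s, `|s| <= `|t| -> `|'D_v h (x + s *: v)| <= C) ->
  `|h (x + t *: v) - h x| <= C * `|t|.
Proof.
move=> hd hC; have := taylor1_le (fun s => is_derive_line (hd s)) hC.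
by rewrite scale0r addr0.
Qed.

Lemma taylor2_line h x v C t : (forall s : R, derivable h (x + s *: v) v) ->
  (forall s : R, derivable ('D_v h) (x + s *: v) v) ->
  (forall s, `|s| <= `|t| -> `|'D_v ('D_v h) (x + s *: v)| <= C) ->
  `|h (x + t *: v) - h x - t * 'D_v h x| <= C * t ^+ 2.
Proof.
move=> hd hdd hC.
have := taylor2_le (fun s => is_derive_line (hd s)) (fun s => is_derive_line (hdd s)) hC.
by rewrite scale0r addr0.
Qed.

End Directional.

(** * Functions controlled through their partial derivatives *)

Section SeveralVariables.
Context {R : realType} {n : nat}.
Implicit Types (h : 'rV[R]_n -> R) (x y v d : 'rV[R]_n) (i j : 'I_n).

Lemma coord_le_norm x i : `|x 0 i| <= `|x|.
Proof.
rewrite /Num.norm/= mx_normrE.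
by have := @le_bigmax _ _ _ 0 (fun i : 'I_1 * 'I_n => `|x i.1 i.2|) (0, i).
Qed.

Lemma norm_rV_le x (r : R) : 0 <= r -> (forall i, `|x 0 i| <= r) -> `|x| <= r.
Proof.
move=> r0 xr; rewrite [leLHS]/Num.norm/= mx_normrE.
by apply: bigmax_le => // -[a b] _ /=; rewrite ord1.
Qed.

(** Corners of an axis-parallel path from 0 to d. *)
Let trunc d k : 'rV[R]_n := \row_j (if (j < k)%N then d 0 j else 0).

Lemma box_lipschitz h x (C rho : R) d :
  (forall y i, derivable h y 'e_i) ->
  (forall y i, `|y - x| <= rho -> `|'D_('e_i) h y| <= C) -> `|d| <= rho ->
  `|h (x + d) - h x| <= C * \sum_i `|d 0 i|.
Proof.
move=> hd hC drho.
have rho0 : 0 <= rho by exact: le_trans drho.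
have -> : h (x + d) - h x = \sum_(i < n) (h (x + trunc d i.+1) - h (x + trunc d i)).
  rewrite -(big_mkord xpredT (fun k : nat => h (x + trunc d k.+1) - h (x + trunc d k))).
  rewrite telescope_sumr//; congr (h (_ + _) - h _).
    by apply/rowP => j; rewrite mxE ltn_ord.
  by rewrite [trunc d 0](_ : _ = 0) ?addr0//; apply/rowP => j; rewrite !mxE ltn0.
rewrite mulr_sumr (le_trans (ler_norm_sum _ _ _))// ler_sum// => i _.
have -> : trunc d i.+1 = trunc d i + d 0 i *: 'e_i.
  apply/rowP => j; rewrite !mxE eqxx/= ltnS leq_eqVlt -val_eqE/=.
  have [e|ne] := eqVneq (nat_of_ord j) i.
    move: e => /ord_inj ->. by rewrite ltnn/= add0r mulr1.
  by rewrite /= mulr0 addr0.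
rewrite addrA; apply: taylor1_line => [s|s sd]; first exact: hd.
apply: hC; rewrite addrAC [x + _]addrC addrK.
apply: norm_rV_le => // j; rewrite !mxE eqxx/=.
have dj k : `|d 0 k| <= rho by apply: le_trans drho; exact: coord_le_norm.
case: ifPn => [ji|_]; last first.
  by case: eqP => [_|_] /=; rewrite ?mulr1 ?mulr0 ?add0r ?normr0// (le_trans sd).
have -> : j == i = false by apply/negbTE; rewrite neq_ltn ji.
by rewrite mulr0 addr0.
Qed.

Lemma sum_coord_le d : \sum_i `|d 0 i| <= n%:R * `|d|.
Proof.
apply: (@le_trans _ _ (\sum_(i < n) `|d|)).
  by apply: ler_sum => i _; exact: coord_le_norm.
by rewrite sumr_const card_ord mulr_natl.
Qed.

Lemma near_dist_le x (r : R) : 0 < r -> \forall y \near x, `|y - x| <= r.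
Proof.
move=> r0; apply/nbhs_ballP; exists r => //= y.
by rewrite -ball_normE/= distrC => /ltW.
Qed.

(** Continuity of the parametric integrals below is obtained from bounds on their partial
    derivatives. *)
Lemma bounded_partials_continuous h x (C rho : R) : 0 < rho ->
  (forall y i, derivable h y 'e_i) ->
  (forall y i, `|y - x| <= rho -> `|'D_('e_i) h y| <= C) ->
  {for x, continuous h}.
Proof.
move=> rho0 hd hC; apply/(@cvgrPdist_le _ _ _ _ (nbhs_filter x)) => e e0.
have C0 : 0 <= `|C| by [].
pose K := `|C| * n%:R + 1.
have K0 : 0 < K by rewrite ltr_wpDl// mulr_ge0.
apply: filterS (@near_dist_le x (Num.min rho (e / K)) _); last first.
  by rewrite lt_min rho0 divr_gt0.
move=> y; rewrite le_min => /andP[yrho ye].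
rewrite distrC -[y](subrK x) [y - x + x]addrC (le_trans (box_lipschitz hd hC yrho))//.
apply: (@le_trans _ _ (`|C| * (n%:R * `|y - x|))).
  apply: (@le_trans _ _ (`|C| * \sum_i `|(y - x) 0 i|)).
    by rewrite ler_wpM2r ?ler_norm// sumr_ge0.
  by rewrite ler_wpM2l// sum_coord_le.
rewrite mulrA (@le_trans _ _ (K * `|y - x|)) ?ler_wpM2r ?lerDl//.
by rewrite -ler_pdivlMl// mulrC.
Qed.

Lemma is_derive_coord x v i : is_derive x v (fun y => y 0 i) (v 0 i).
Proof.
apply: (is_derive_quadratic (C := 0)) => t _; rewrite !mxE mul0r.
by rewrite [x 0 i + _]addrC addrK subrr normr0.
Qed.

Lemma is_derive_lincomb (c : 'I_n -> R) x v :
  is_derive x v (fun y => \sum_j y 0 j * c j) (\sum_j v 0 j * c j).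
Proof.
apply: (is_derive_quadratic (C := 0)) => t _; rewrite mul0r mulr_sumr -!sumrB big1 ?normr0//.
by move=> j _; rewrite !mxE; ring.
Qed.

(** After subtraction of the linearization at x, the partial derivatives are small near x, and
    [box_lipschitz] makes the increment of the difference [o(t)]. *)
Lemma is_derive_dir h x v :
  (forall y i, derivable h y 'e_i) -> (forall i, {for x, continuous ('D_('e_i) h)}) ->
  is_derive x v h (\sum_i v 0 i * 'D_('e_i) h x).
Proof.
move=> hd hc; set G := \sum_i _.
suff H : t^-1 *: ((h \o shift x) (t *: v) - h x) @[t --> 0^'] --> (G : R^o).
  by apply: DeriveDef; [apply/cvg_ex; exists G | exact: cvg_lim].
pose k y := h y - \sum_i y 0 i * 'D_('e_i) h x.
have kd y i : is_derive y 'e_i k ('D_('e_i) h y - 'D_('e_i) h x).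
  rewrite /k; have D1 := derivableP (hd y i).
  have -> : 'D_('e_i) h x = \sum_j ('e_i : 'rV[R]_n) 0 j * 'D_('e_j) h x.
    rewrite (bigD1 i)//= big1 ?addr0 => [|j ji]; first by rewrite mxE !eqxx mul1r.
    by rewrite mxE (negbTE ji) andbF mul0r.
  have D2 := is_derive_lincomb (fun j => 'D_('e_j) h x) y 'e_i.
  exact: is_deriveB.
apply/cvgrPdist_le => e e0.
(* K dominates both [|v|], which keeps [t *: v] within rho, and [n |v|], which bounds the sum of the
   coordinates of v. *)
pose K := n.+1%:R * `|v| + 1.
have K0 : 0 < K by rewrite ltr_wpDl// mulr_ge0.
have eK0 : 0 < e / K by rewrite divr_gt0.
have [rho /= rho0 hrho] : exists2 rho : R, 0 < rho &
    forall y i, `|y - x| <= rho -> `|'D_('e_i) h y - 'D_('e_i) h x| <= e / K.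
  have : \forall y \near x, forall i, `|'D_('e_i) h y - 'D_('e_i) h x| <= e / K.
    apply: (@filter_forall _ _ _ _ (nbhs_filter x)) => i.
    have /(@cvgrPdist_le _ _ _ _ (nbhs_filter x)) /(_ _ eK0) := hc i.
    by under eq_near do rewrite distrC.
  move=> /nbhs_ballP[r /= r0 hr]; exists (r / 2); first by rewrite divr_gt0.
  move=> y i yr; apply: (hr y); rewrite -ball_normE/= distrC (le_lt_trans yr)//.
  by rewrite ltr_pdivrMr// ltr_pMr// ltr1n.
near=> t.
have t0 : t != 0 by near: t; exact: nbhs_dnbhs_neq.
have t1 : `|t| <= rho / K by near: t; apply: dnbhs0_le; rewrite divr_gt0.
have tv : `|t *: v| <= rho.
  rewrite normrZ (le_trans (ler_wpM2r _ t1))// -mulrA ger_pMr// mulrC ler_pdivrMr// mul1r.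
  by rewrite /K -natr1 mulrDl mul1r -addrA addrCA lerDl addr_ge0// mulr_ge0.
rewrite /= [t *: v + x]addrC distrC.
have -> : t^-1 *: (h (x + t *: v) - h x) - G = t^-1 * (k (x + t *: v) - k x).
  have E : \sum_i (x + t *: v) 0 i * 'D_('e_i) h x = \sum_i x 0 i * 'D_('e_i) h x + t * G.
    by rewrite mulr_sumr -big_split; apply: eq_bigr => i _; rewrite !mxE /=; ring.
  by rewrite /k E -[LHS]/(t^-1 * _ - _); field.
rewrite normrM normfV ler_pdivrMl ?normr_gt0//.
have kd1 y i : derivable k y 'e_i by case: (kd y i).
have kd2 y i : `|y - x| <= rho -> `|'D_('e_i) k y| <= e / K.
  by have [_ ->] := kd y i; exact: hrho.
rewrite (le_trans (box_lipschitz kd1 kd2 tv))//.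
rewrite (le_trans (ler_wpM2l (ltW eK0) (sum_coord_le _)))// normrZ.
have -> : e / K * (n%:R * (`|t| * `|v|)) = `|t| * (e / K * (n%:R * `|v|)) by ring.
rewrite ler_wpM2l// -mulrA mulrC ger_pMl// ler_pdivrMl// mulr1.
by rewrite /K -natr1 mulrDl mul1r -addrA lerDl addr_ge0.
Unshelve. all: by end_near. Qed.

Lemma continuous_norm_le h x (e : R) : {for x, continuous h} -> 0 < e ->
  exists2 rho : R, 0 < rho & forall y, `|y - x| <= rho -> `|h y - h x| <= e.
Proof.
move=> hc e0; have /(@cvgrPdist_le _ _ _ _ (nbhs_filter x)) /(_ _ e0) := hc.
move=> /nbhs_ballP[r /= r0 hr]; exists (r / 2); first by rewrite divr_gt0.
move=> y yr; rewrite distrC; apply: (hr y); rewrite -ball_normE/= distrC (le_lt_trans yr)//.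
by rewrite ltr_pdivrMr// ltr_pMr// ltr1n.
Qed.

Lemma norm_delta_le i : `|'e_i : 'rV[R]_n| <= 1.
Proof. by apply: norm_rV_le => // j; rewrite mxE; case: (_ && _); rewrite ?normr1 ?normr0. Qed.

End SeveralVariables.

(** * Smooth functions and their partial derivatives *)

Definition pd (R : realType) (n : nat) (i : 'I_n) (h : 'rV[R]_n -> R) :
  'rV[R]_n -> R := 'D_('e_i) h.

Section Smooth.
Context {R : realType} {n : nat}.
Implicit Types (h f g : 'rV[R]_n -> R) (x y v d : 'rV[R]_n) (i j : 'I_n) (s : seq 'I_n).

Lemma pdP h x i : derivable h x 'e_i -> is_derive x 'e_i h (pd i h x).
Proof. exact: derivableP. Qed.

Lemma pd_val h x i (c : R) : is_derive x 'e_i h c -> pd i h x = c.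
Proof. by case. Qed.

(** Two applications of the mean value theorem write the second difference of h over a square of
    side t as [t * t] times a mixed derivative at a nearby point. The second difference is symmetric
    in the two directions, so both mixed derivatives occur. *)
Lemma schwarz h i j x : (forall y, derivable h y 'e_i) -> (forall y, derivable h y 'e_j) ->
  (forall y, derivable (pd i h) y 'e_j) -> (forall y, derivable (pd j h) y 'e_i) ->
  {for x, continuous (pd j (pd i h))} -> {for x, continuous (pd i (pd j h))} ->
  pd j (pd i h) x = pd i (pd j h) x.
Proof.
have step (a b : 'I_n) (t : R) : (forall y, derivable h y 'e_a) ->
    (forall y, derivable (pd a h) y 'e_b) -> exists2 y, `|y - x| <= `|t| + `|t| &
    h (x + t *: 'e_b + t *: 'e_a) - h (x + t *: 'e_a) - (h (x + t *: 'e_b) - h x)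
      = t * t * pd b (pd a h) y.
  move=> ha hb.
  have ha' (z : 'rV[R]_n) (u : R) := is_derive_line (ha (z + u *: 'e_a)).
  pose f (u : R) := h (x + t *: 'e_b + u *: 'e_a) - h (x + u *: 'e_a).
  have [c ct] := mvt0 (f := f) t (fun u => is_deriveB (ha' (x + t *: 'e_b) u) (ha' x u)).
  rewrite /f !scale0r !addr0 => e.
  have [c' c't e'] := mvt0 t (fun u => is_derive_line (hb (x + c *: 'e_a + u *: 'e_b))).
  exists (x + c *: 'e_a + c' *: 'e_b).
    rewrite -[x + _ + _]addrA [x + _]addrC addrK (le_trans (ler_normD _ _))// !normrZ.
    apply: lerD; first by apply: (le_trans _ ct); rewrite ler_piMr ?norm_delta_le.
    by apply: (le_trans _ c't); rewrite ler_piMr ?norm_delta_le.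
  move: e'; rewrite scale0r addr0 => e'.
  rewrite e mulrC -mulrA; congr (_ * _).
  by rewrite mulrC -[RHS]e' addrAC.
move=> hi hj hij hji cij cji; apply/eqP; rewrite eq_le; apply/andP.
have H (e : R) : 0 < e -> `|pd j (pd i h) x - pd i (pd j h) x| <= e + e.
  move=> e0; have [r1 r10 h1] := continuous_norm_le cij e0.
  have [r2 r20 h2] := continuous_norm_le cji e0.
  pose t : R := Num.min r1 r2 / 2.
  have t0 : 0 < t by rewrite divr_gt0// lt_min r10.
  have tt : `|t| + `|t| = Num.min r1 r2 by rewrite gtr0_norm// -splitr.
  have [y1 + e1] := step _ _ t hi hij; have [y2 + e2] := step _ _ t hj hji.
  rewrite tt !le_min => /andP[_ /h2 y2h] /andP[/h1 y1h _].
  have e3 : pd j (pd i h) y1 = pd i (pd j h) y2.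
    apply: (@mulfI _ (t * t)); first by rewrite mulf_neq0// gt_eqF.
    have q (p1 p2 p3 p4 : R) : p1 - p2 - (p3 - p4) = p1 - p3 - (p2 - p4) by ring.
    apply: etrans (esym e1) (etrans _ e2).
    by rewrite [x + t *: 'e_j + _]addrAC q.
  apply: (le_trans (ler_distD (pd j (pd i h) y1) _ _)); apply: lerD; first by rewrite distrC; exact: y1h.
  by rewrite e3; exact: y2h.
have H' : `|pd j (pd i h) x - pd i (pd j h) x| <= 0.
  apply/ler_addgt0Pr => e e0; rewrite add0r [leRHS]splitr; apply: H; exact: divr_gt0.
by move: H'; rewrite normr_le0 subr_eq0 => /eqP ->.
Qed.

Lemma smooth_derivable h x i : smooth h -> derivable h x 'e_i.
Proof. by move=> /(_ [::])[]. Qed.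

Lemma smooth_continuous h : smooth h -> continuous h.
Proof. by move=> /(_ [::])[]. Qed.

Lemma partials_rcons s i h : partials (rcons s i) h = partials s (pd i h).
Proof. by rewrite /partials foldr_rcons. Qed.

Lemma smooth_pd h i : smooth h -> smooth (pd i h).
Proof. by move=> hs s; rewrite -partials_rcons; exact: hs. Qed.

Lemma smooth_partials h s : smooth h -> smooth (partials s h).
Proof. by move=> hs; elim: s => [|i s IH]; [exact: hs|exact: smooth_pd IH]. Qed.

Lemma pdC h i j : smooth h -> pd i (pd j h) = pd j (pd i h).
Proof.
move=> hs; apply/funext => x; apply: schwarz => [y|y|y|y||].
- exact: smooth_derivable.
- exact: smooth_derivable.
- exact/smooth_derivable/smooth_pd.
- exact/smooth_derivable/smooth_pd.
- exact: (smooth_continuous (smooth_pd _ (smooth_pd _ hs))).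
- exact: (smooth_continuous (smooth_pd _ (smooth_pd _ hs))).
Qed.

Lemma pdD f g i : (forall x, derivable f x 'e_i) -> (forall x, derivable g x 'e_i) ->
  pd i (f + g) = pd i f + pd i g.
Proof. by move=> fd gd; apply/funext => x; rewrite /pd deriveD. Qed.

Lemma pdZ (c : R) f i : (forall x, derivable f x 'e_i) -> pd i (c *: f) = c *: pd i f.
Proof. by move=> fd; apply/funext => x; rewrite /pd deriveZ. Qed.

Lemma partialsD f g s : smooth f -> smooth g -> partials s (f + g) = partials s f + partials s g.
Proof.
move=> fs gs; elim: s => //= i s ->; rewrite -[LHS]/(pd i _) pdD// => x; exact/smooth_derivable/smooth_partials.
Qed.

Lemma partialsZ (c : R) f s : smooth f -> partials s (c *: f) = c *: partials s f.
Proof.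
move=> fs; elim: s => //= i s ->; rewrite -[LHS]/(pd i _) pdZ// => x.
exact/smooth_derivable/smooth_partials.
Qed.

Lemma smoothD f g : smooth f -> smooth g -> smooth (f + g).
Proof.
move=> fs gs s; rewrite partialsD//; split=> [x|i x].
  by apply: continuousD; [apply: (proj1 (fs s))|apply: (proj1 (gs s))].
by apply: derivableD; [apply: (proj2 (fs s))|apply: (proj2 (gs s))].
Qed.

Lemma smoothZ (c : R) f : smooth f -> smooth (c *: f).
Proof.
move=> fs s; rewrite partialsZ//; split=> [x|i x].
  by apply: (@continuousM _ _ (cst c) (partials s f)); [exact: cst_continuous|apply: (proj1 (fs s))].
by apply: derivableZ; apply: (proj2 (fs s)).
Qed.

Lemma pd_cst (c : R) i : pd i (cst c) = cst 0.
Proof. by apply/funext => x; rewrite /pd derive_cst. Qed.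

Lemma smooth_cst (c : R) : smooth (cst c : 'rV[R]_n -> R).
Proof.
move=> s; have [c' ->] : exists c', partials s (cst c) = cst c'.
  by elim: s => [|i s [c' /= ->]]; [exists c|exists 0; exact: pd_cst].
by split=> [x|i x]; [exact: cst_continuous|exact: derivable_cst].
Qed.

Definition xmul j h : 'rV[R]_n -> R := fun x => x 0 j * h x.

Lemma is_derive_xmul j h x i : derivable h x 'e_i ->
  is_derive x 'e_i (xmul j h) ((i == j)%:R * h x + x 0 j * pd i h x).
Proof.
move=> hd; have := is_deriveM (is_derive_coord x 'e_i j) (pdP hd).
by move/is_derive_eq; apply; rewrite addrC mxE eqxx/= eq_sym; congr (_ + _); exact: mulrC.
Qed.

Lemma pd_xmul j h i : smooth h ->
  pd i (xmul j h) = (i == j)%:R *: h + xmul j (pd i h).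
Proof.
move=> hs; apply/funext => x.
by rewrite -[LHS]/('D_('e_i) (xmul j h) x); have [_ ->] := is_derive_xmul j (@smooth_derivable h x i hs).
Qed.

Lemma continuous_coord j : continuous (fun x : 'rV[R]_n => x 0 j).
Proof. by move=> x; exact: coord_continuous. Qed.

Lemma continuous_xmul j h : continuous h -> continuous (xmul j h).
Proof. by move=> hc x; apply: continuousM; [exact: continuous_coord|exact: hc]. Qed.

Lemma smooth_xmul j h : smooth h -> smooth (xmul j h).
Proof.
move=> hs s.
have sd g' y k : smooth g' -> derivable g' y 'e_k by exact: smooth_derivable.
have xd g' y k : smooth g' -> derivable (xmul j g') y 'e_k.
  by move=> gs'; have [] := @is_derive_xmul j g' y k (@smooth_derivable g' y k gs').
(* Leibniz rule with the lower-order terms left implicit: only their smoothness matters. *)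
have [g [gs ->]] : exists g, smooth g /\ partials s (xmul j h) = g + xmul j (partials s h).
  elim: s => [|i s [g [gs /= ->]]]; first by exists (cst 0); rewrite add0r; split; [exact: smooth_cst|].
  have ps := smooth_partials s hs.
  exists (pd i g + (i == j)%:R *: partials s h); split.
    by apply: smoothD; [exact: smooth_pd|exact: smoothZ].
  rewrite -[LHS]/(pd i _) pdD; [|by move=> x; exact: sd|by move=> x; exact: xd].
  by rewrite pd_xmul// addrA.
have ps := smooth_partials s hs; split=> [x|i x].
  by apply: continuousD; [exact: smooth_continuous|apply: continuous_xmul; exact: smooth_continuous].
by apply: derivableD; [exact: sd|exact: xd].
Qed.

Lemma smooth_taylor h x i (C : R) t : smooth h ->
  (forall u, `|u| <= `|t| -> `|pd i (pd i h) (x + u *: 'e_i)| <= C) ->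
  `|h (x + t *: 'e_i) - h x - t * pd i h x| <= C * t ^+ 2.
Proof.
move=> hs; apply: taylor2_line => u; first exact: smooth_derivable.
exact/smooth_derivable/smooth_pd.
Qed.

Lemma smooth_dir h x v : smooth h -> is_derive x v h (\sum_i v 0 i * pd i h x).
Proof.
move=> hs; apply: is_derive_dir => [y i|i]; first exact: smooth_derivable.
exact: (smooth_continuous (smooth_pd _ hs)).
Qed.

End Smooth.

(** * Gaussian expectations *)

Section HalfLine.
Context {R : realType}.
Implicit Types (f g F : R -> R).
Local Notation mu := (@lebesgue_measure R).

(** Common majorant of the half-line integrands; its primitive [atan] makes its integral
    explicit. *)
Definition cauchy_fun (t : R) : R := (1 + t ^+ 2)^-1.

Lemma cauchy_den_gt0 (t : R) : 0 < 1 + t ^+ 2.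
Proof. by rewrite ltr_wpDr// sqr_ge0. Qed.

Lemma cauchy_fun_gt0 t : 0 < cauchy_fun t.
Proof. by rewrite invr_gt0 cauchy_den_gt0. Qed.

Lemma continuous_cauchy_fun : continuous cauchy_fun.
Proof.
move=> t; apply: cvgV; first by rewrite gt_eqF//; exact: cauchy_den_gt0.
by apply: cvgD; [exact: cvg_cst|exact: exprn_continuous].
Qed.

Lemma ge0_halfline_FTC f F (l : R) : (forall t, 0 <= t -> 0 <= f t) -> continuous f ->
  (forall t : R, is_derive t 1 F (f t)) -> F t @[t --> +oo] --> l ->
  (\int[mu]_(t in `[0%R, +oo[) (f t)%:E = (l - F 0)%:E)%E.
Proof.
move=> f0 fc Fd Fl; rewrite EFinB.
have Fd' (t : R) : derivable F t 1 by case: (Fd t).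
have F0 : F t @[t --> 0^'+] --> F 0.
  by apply: cvg_at_right_filter; exact/differentiable_continuous/derivable1_diffP/Fd'.
apply: (ge0_continuous_FTC2y f0 _ Fl (fun t _ => Fd' t) F0).
  exact: continuous_subspaceT.
by move=> t _; rewrite derive1E; case: (Fd t).
Qed.

Lemma integrable_cauchy_fun : mu.-integrable `[0, +oo[ (EFin \o cauchy_fun).
Proof.
apply/integrableP; split.
  by apply/measurable_EFinP; apply: measurable_funTS; apply: continuous_measurable_fun; exact: continuous_cauchy_fun.
under eq_integral => t _ do rewrite /= ger0_norm ?ltW ?cauchy_fun_gt0//.
rewrite (@ge0_halfline_FTC _ atan (pi / 2)) ?ltry//.
- by move=> t _; rewrite ltW// cauchy_fun_gt0.
- exact: continuous_cauchy_fun.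
- exact: cvgy_atan.
Qed.

Definition decaying f := continuous f /\
  exists C : R, forall t, 0 <= t -> `|f t| <= C * cauchy_fun t.

Lemma decaying_integrable f : decaying f -> mu.-integrable `[0, +oo[ (EFin \o f).
Proof.
move=> [fc [C fC]].
have iC : mu.-integrable `[0, +oo[ (fun t => C%:E * (EFin \o cauchy_fun) t)%E.
  by apply: integrableZl => //; exact: integrable_cauchy_fun.
apply: le_integrable iC => //.
  by apply/measurable_EFinP; apply: measurable_funTS; exact: continuous_measurable_fun.
move=> t; rewrite /= in_itv/= andbT => t0.
by rewrite lee_fin (le_trans (fC _ t0)) ?ler_norm.
Qed.

Definition halfint f : R := \int[mu]_(t in `[0, +oo[) f t.

Lemma decayingD f g : decaying f -> decaying g -> decaying (f + g).
Proof.
move=> [fc [C fC]] [gc [D gD]]; split; first by move=> t; apply: continuousD; [exact: fc|exact: gc].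
exists (C + D) => t t0; rewrite mulrDl (le_trans (ler_normD _ _))// lerD//; [exact: fC|exact: gD].
Qed.

Lemma decayingZ (c : R) f : decaying f -> decaying (c *: f).
Proof.
move=> [fc [C fC]]; split.
  by move=> t; apply: (@continuousM _ _ (cst c) f); [exact: cst_continuous|exact: fc].
by exists (`|c| * C) => t t0; rewrite -[(c *: f) t]/(c * f t) normrM -mulrA ler_wpM2l// fC.
Qed.

Lemma decaying_cauchy (C : R) : decaying (C *: cauchy_fun).
Proof.
apply: decayingZ; split; first exact: continuous_cauchy_fun.
by exists 1 => t _; rewrite mul1r ger0_norm// ltW// cauchy_fun_gt0.
Qed.

Lemma halfintD f g : decaying f -> decaying g -> halfint (f + g) = halfint f + halfint g.
Proof. by move=> fd gd; apply: RintegralD => //; exact: decaying_integrable. Qed.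

Lemma halfintZ (c : R) f : decaying f -> halfint (c *: f) = c * halfint f.
Proof. by move=> fd; apply: RintegralZl => //; exact: decaying_integrable. Qed.

Lemma halfintN f : decaying f -> halfint (- f) = - halfint f.
Proof. by move=> fd; rewrite -scaleN1r halfintZ// mulN1r. Qed.

Lemma halfintB f g : decaying f -> decaying g -> halfint (f - g) = halfint f - halfint g.
Proof.
move=> fd gd; rewrite halfintD//; first by rewrite halfintN.
by rewrite -scaleN1r; exact: decayingZ.
Qed.

Lemma le_halfint f g : decaying f -> decaying g -> (forall t, 0 <= t -> f t <= g t) ->
  halfint f <= halfint g.
Proof.
move=> fd gd fg; apply: le_Rintegral => //; [exact: decaying_integrable..|].
by move=> t; rewrite /= in_itv/= andbT; exact: fg.
Qed.

Lemma halfint_norm_le f g : decaying f -> decaying g -> (forall t, 0 <= t -> `|f t| <= g t) ->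
  `|halfint f| <= halfint g.
Proof.
move=> fd gd fg; rewrite ler_norml -halfintN// !le_halfint//.
- by move=> t t0; apply: (le_trans (ler_norm _)); exact: fg.
- by rewrite -scaleN1r; exact: decayingZ.
- by move=> t t0; rewrite -[(- g) t]/(- g t) lerNl (le_trans (ler_norm _))// normrN; exact: fg.
Qed.

(** The nonnegative case applies to [f + C *: cauchy_fun] and to [C *: cauchy_fun], where C is the
    decay constant of f; the claim is the difference. *)
Lemma halfint_FTC f F (l : R) : decaying f -> (forall t : R, is_derive t 1 F (f t)) ->
  F t @[t --> +oo] --> l -> halfint f = l - F 0.
Proof.
move=> fd Fd Fl; have [fc [C fC]] := fd.
have cd := decaying_cauchy C.
have ad (t : R) : is_derive t 1 (C *: atan : R -> R) (C * cauchy_fun t).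
  by have := is_deriveZ C (is_derive1_atan t).
have H g G (k : R) : continuous g -> (forall t, 0 <= t -> 0 <= g t) ->
    (forall t : R, is_derive t 1 G (g t)) -> G t @[t --> +oo] --> k -> halfint g = k - G 0.
  by move=> gc g0 Gd Gk; rewrite /halfint /Rintegral (ge0_halfline_FTC g0 gc Gd Gk).
have al : (C *: atan : R -> R) t @[t --> +oo] --> C * (pi / 2).
  by apply: cvgM; [exact: cvg_cst|exact: cvgy_atan].
have C0 : 0 <= C.
  by have := fC 0 (lexx _); rewrite /cauchy_fun expr0n addr0 invr1 mulr1; exact: le_trans.
have e1 : halfint (f + C *: cauchy_fun) = l + C * (pi / 2) - (F + C *: atan) 0.
  have gd (t : R) := is_deriveD (Fd t) (ad t).
  apply: (H _ _ _ _ _ gd).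
  - by move=> t; apply: cvgD; [exact: fc|case: cd => c _; exact: c].
  - move=> t t0; rewrite -lerBlDr sub0r lerNl.
    by apply: (le_trans (ler_norm _)); rewrite normrN; exact: fC.
  - exact: cvgD.
have e2 : halfint (C *: cauchy_fun) = C * (pi / 2) - (C *: atan) 0.
  by apply: H => // [|t t0]; [case: cd|rewrite mulr_ge0// ltW// cauchy_fun_gt0].
move: e1; rewrite halfintD// e2 -[(F + _) 0]/(F 0 + (C *: atan) 0).
by move=> e1; lra.
Qed.

Lemma cvg0_cauchy F (C : R) : (forall t, 0 <= t -> `|F t| <= C * cauchy_fun t) ->
  F t @[t --> +oo] --> (0 : R).
Proof.
move=> FC; apply/cvgrPdist_le => e e0; near=> t.
have t1 : 1 <= t by near: t; apply: nbhs_pinfty_ge; exact: num_real.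
have t0 : 0 <= t by exact: le_trans t1.
rewrite sub0r normrN (le_trans (FC _ t0))// ler_pdivrMr ?cauchy_den_gt0//.
have Ct : C / e <= t by near: t; apply: nbhs_pinfty_ge; exact: num_real.
rewrite -ler_pdivrMl// mulrC (le_trans Ct)// (@le_trans _ _ (t ^+ 2)) ?lerDr//.
by rewrite expr2 ler_peMr.
Unshelve. all: by end_near. Qed.

End HalfLine.

Lemma is_derive_continuous (R : realType) (f df : R -> R) :
  (forall t : R, is_derive t 1 f (df t)) -> continuous f.
Proof.
by move=> fd t; apply/differentiable_continuous/derivable1_diffP; case: (fd t).
Qed.

(** * Integration against the Gaussian on the line *)

Section GaussianIntegral.
Context {R : realType}.
Implicit Types (f g : R -> R) (N : nat).

(** With [N' = N + 1], [exp (t ^ 2)] is the [N']-th power of [exp (t ^ 2 / N')], which is at least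
    [1 + t ^ 2 / N']; hence the constant [N' ^ N']. *)
Lemma gauss_dominated N : exists2 C : R, 0 <= C &
  forall t, gauss_fun t * (1 + t ^+ 2) ^+ N <= C * cauchy_fun t.
Proof.
exists (N.+1%:R ^+ N.+1) => [|t]; first by rewrite exprn_ge0.
have p := cauchy_den_gt0 t.
rewrite ler_pdivlMr// -mulrA -exprSr /gauss_fun expRN ler_pdivrMl ?expR_gt0//.
have k0 : 0 < N.+1%:R :> R by rewrite ltr0n.
have e : expR (t ^+ 2) = expR (t ^+ 2 / N.+1%:R) ^+ N.+1.
  by rewrite -expRM_natl mulrC divfK// gt_eqF.
rewrite e -exprMn; apply: lerXn2r; rewrite ?nnegrE ?mulr_ge0 ?expR_ge0 ?(ltW p)//.
apply: (@le_trans _ _ ((1 + t ^+ 2 / N.+1%:R) * N.+1%:R)); last first.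
  by rewrite ler_pM2r// expR_ge1Dx.
by rewrite mulrDl divfK ?gt_eqF// mul1r lerD2r ler1n.
Qed.

Definition pbounded f := continuous f /\
  exists (C : R) N, forall t, `|f t| <= C * (1 + t ^+ 2) ^+ N.

(* Folding the line onto [[0, +oo)], so that all integrals live on a half-line. *)
Definition evenize f : R -> R := fun t => gauss_fun t * (f t + f (- t)).

Definition gaussint f : R := halfint (evenize f).

Lemma evenize_decaying f : pbounded f -> decaying (evenize f).
Proof.
move=> [fc [C [N fC]]]; have [K K0 hK] := gauss_dominated N.
have C0 : 0 <= C.
  by have := fC 0; rewrite expr0n addr0 expr1n mulr1; exact: le_trans.
split.
  move=> t; apply: cvgM; first exact: continuous_gauss_fun.
  apply: cvgD; first exact: fc.
  by apply: (continuous_comp (f := fun t => - t)); [exact: opp_continuous|exact: fc].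
exists ((C + C) * K) => t _; rewrite /evenize normrM ger0_norm ?gauss_fun_ge0//.
rewrite -mulrA (le_trans _ (ler_wpM2l (addr_ge0 C0 C0) (hK t)))//.
rewrite mulrCA ler_wpM2l ?gauss_fun_ge0// mulrDl (le_trans (ler_normD _ _))// lerD//.
by rewrite -[in leRHS](sqrrN t).
Qed.

Lemma pbounded_weaken (C a : R) (N M : nat) (w : R) : 1 <= w -> a <= C * w ^+ N -> (N <= M)%N ->
  a <= `|C| * w ^+ M.
Proof.
move=> w1 aC NM; apply: (le_trans aC).
have w0 : 0 <= w by exact: le_trans w1.
apply: (@le_trans _ _ (`|C| * w ^+ N)); first by rewrite ler_wpM2r ?ler_norm ?exprn_ge0.
by rewrite ler_wpM2l// ler_weXn2l.
Qed.

Lemma pboundedD f g : pbounded f -> pbounded g -> pbounded (f + g).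
Proof.
move=> [fc [C [N fC]]] [gc [D [M gD]]]; split.
  by move=> t; apply: cvgD; [exact: fc|exact: gc].
have p (t : R) : 1 <= 1 + t ^+ 2 by rewrite lerDl sqr_ge0.
exists (`|C| + `|D|), (N + M)%N => t; rewrite mulrDl (le_trans (ler_normD _ _))// lerD//.
  by apply: pbounded_weaken (fC t) _; rewrite ?leq_addr.
by apply: pbounded_weaken (gD t) _; rewrite ?leq_addl.
Qed.

Lemma pboundedZ (c : R) f : pbounded f -> pbounded (c *: f).
Proof.
move=> [fc [C [N fC]]]; split.
  by move=> t; apply: cvgM; [exact: cvg_cst|exact: fc].
by exists (`|c| * C), N => t; rewrite normrM -mulrA ler_wpM2l// fC.
Qed.

Lemma evenizeD f g : evenize (f + g) = evenize f + evenize g.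
Proof. by apply/funext => t; rewrite /evenize !fctE; ring. Qed.

Lemma evenizeZ (c : R) f : evenize (c *: f) = c *: evenize f.
Proof.
by apply/funext => t; rewrite /evenize !fctE -[c *: f t]/(c * f t) -[c *: f (- t)]/(c * f (- t)) -[_ *: _]/(_ * _); ring.
Qed.

Lemma gaussintD f g : pbounded f -> pbounded g -> gaussint (f + g) = gaussint f + gaussint g.
Proof. by move=> fp gp; rewrite /gaussint evenizeD halfintD//; exact: evenize_decaying. Qed.

Lemma gaussintZ (c : R) f : pbounded f -> gaussint (c *: f) = c * gaussint f.
Proof. by move=> fp; rewrite /gaussint evenizeZ halfintZ//; exact: evenize_decaying. Qed.

Lemma pboundedB f g : pbounded f -> pbounded g -> pbounded (f - g).
Proof. by move=> fp gp; apply: pboundedD => //; rewrite -scaleN1r; exact: pboundedZ. Qed.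

Lemma gaussintB f g : pbounded f -> pbounded g -> gaussint (f - g) = gaussint f - gaussint g.
Proof.
move=> fp gp; rewrite -scaleN1r gaussintD//; last exact: pboundedZ.
by rewrite gaussintZ// mulN1r.
Qed.

Lemma gaussint_norm_le f g : pbounded f -> pbounded g -> (forall t, `|f t| <= g t) ->
  `|gaussint f| <= gaussint g.
Proof.
move=> fp gp fg; apply: halfint_norm_le; [exact: evenize_decaying..|].
move=> t _; rewrite /evenize normrM ger0_norm ?gauss_fun_ge0//.
by rewrite ler_wpM2l ?gauss_fun_ge0// (le_trans (ler_normD _ _))// lerD.
Qed.

Lemma pbounded_cst (c : R) : pbounded (cst c).
Proof.
by split; [move=> t; exact: cvg_cst|exists `|c|, 0%N => t; rewrite expr0 mulr1].
Qed.

Lemma gaussint1_gt0 : 0 < gaussint (cst 1).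
Proof.
have ce : continuous (@gauss_fun R) by exact: continuous_gauss_fun.
rewrite /gaussint; have -> : evenize (cst 1) = 2 *: gauss_fun.
  by apply/funext => t; rewrite /evenize -[RHS]/(2 * gauss_fun t) mulrC.
have gd : decaying (@gauss_fun R).
  split=> //; have [C _ hC] := gauss_dominated 0; exists C => t _.
  by rewrite ger0_norm ?gauss_fun_ge0//; have := hC t; rewrite expr0 mulr1.
rewrite halfintZ// mulr_gt0// /halfint /Rintegral.
have -> : (\int[lebesgue_measure]_(x in `[0%R, +oo[) (gauss_fun x)%:E)%E = (Num.sqrt pi / 2)%:E :> \bar R.
  exact: integral0y_gauss.
by rewrite /= divr_gt0// sqrtr_gt0 pi_gt0.
Qed.

Lemma is_derive_comp_opp f (df : R) (t : R) : is_derive (- t) 1 f df ->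
  is_derive t 1 (fun t => f (- t)) (- df).
Proof.
by move=> fd; have := is_derive1_comp fd (is_deriveNid t 1); rewrite mulrN1.
Qed.

Lemma is_derive_gauss (t : R) : is_derive t 1 gauss_fun (- (2 * t * gauss_fun t)).
Proof.
have d2 : is_derive t 1 (fun t : R => - t ^+ 2) (- (2 * t)).
  apply: (is_derive_quadratic (C := 1)) => u _; rewrite [u *: 1]mulr1 mul1r.
  rewrite [X in `|X|](_ : _ = - u ^+ 2) ?normrN; last by ring.
  by rewrite ger0_norm// sqr_ge0.
have := @is_derive1_comp _ expR (fun t => - t ^+ 2) t _ _ (is_derive_expR _) d2.
by move=> /is_derive_eq; apply; rewrite mulrN mulrC.
Qed.

Lemma pbounded_mulid f : pbounded f -> pbounded (fun t => t * f t).
Proof.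
move=> [fc [C [N fC]]]; split.
  by move=> t; apply: cvgM; [exact: cvg_id|exact: fc].
exists C, N.+1 => t; rewrite normrM exprS mulrCA ler_pM//.
have [t1|t1] := lerP `|t| 1; first by rewrite (le_trans t1)// lerDl sqr_ge0.
rewrite -[t ^+ 2]real_normK ?num_real// expr2 ler_wpDl// ler_peMr//.
exact: ltW.
Qed.

(* The integrand [exp (- t ^ 2)] gives variance 1/2, whence the factor 2. *)
Lemma gaussint_stein f df : pbounded f -> pbounded df ->
  (forall t : R, is_derive t 1 f (df t)) ->
  gaussint df = 2 * gaussint (fun t => t * f t).
Proof.
move=> fp dfp fd.
(* Folded boundary term: it vanishes at 0 by antisymmetry and at infinity by Gaussian decay. *)
pose F (t : R) := gauss_fun t * (f t - f (- t)).
have tfp := pbounded_mulid fp.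
have Fd (t : R) : is_derive t 1 F ((evenize df - 2 *: evenize (fun t => t * f t)) t).
  have d1 : is_derive t 1 (fun t => f t - f (- t)) (df t - - df (- t)).
    exact: (is_deriveB (fd t) (is_derive_comp_opp (fd (- t)))).
  have := is_deriveM (is_derive_gauss t) d1; move=> /is_derive_eq; apply.
  rewrite !fctE -[_ *: (df t + _)]/(_ * (df t + _)) -[_ *: - _]/(_ * - _) -[2 *: _]/(2 * _) /evenize.
  by ring.
have F0 : F t @[t --> +oo] --> (0 : R).
  have [fc [C [N fC]]] := fp; have [L L0 hL] := gauss_dominated N.
  apply: (@cvg0_cauchy _ _ ((`|C| + `|C|) * L)) => t _.
  rewrite /F normrM ger0_norm ?gauss_fun_ge0// -mulrA.
  rewrite (le_trans _ (ler_wpM2l _ (hL t))) ?addr_ge0// mulrCA ler_wpM2l ?gauss_fun_ge0//.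
  rewrite mulrDl (le_trans (ler_normB _ _))// lerD//.
    by rewrite (le_trans (fC t))// ler_wpM2r ?ler_norm// exprn_ge0// ltW// cauchy_den_gt0.
  rewrite (le_trans (fC _))// sqrrN ler_wpM2r ?ler_norm// exprn_ge0// ltW//; exact: cauchy_den_gt0.
have e1 := evenize_decaying dfp; have e2 := decayingZ 2 (evenize_decaying tfp).
have e3 : decaying (evenize df - 2 *: evenize (fun t => t * f t)).
  by apply: decayingD => //; rewrite -scaleN1r; exact: decayingZ.
have := halfint_FTC e3 Fd F0.
rewrite halfintB// halfintZ; last exact: evenize_decaying.
by rewrite /F oppr0 subrr mulr0 subrr => /eqP; rewrite subr_eq0 => /eqP.
Qed.

Lemma is_derive_affine (x r : R) (t : R) : is_derive t 1 (fun t => x + r * t) r.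
Proof.
have := is_deriveD (is_derive_cst x t 1) (is_deriveZ r (is_derive_id t (1 : R))).
by move=> /is_derive_eq; apply; rewrite add0r; exact: mulr1.
Qed.

Lemma continuous_affine (x r : R) : continuous (fun t => x + r * t).
Proof. exact: is_derive_continuous (is_derive_affine x r). Qed.

Lemma decaying_cauchy_affine (x r : R) : 0 < r -> decaying (fun t => cauchy_fun (x + r * t)).
Proof.
move=> r0; split.
  move=> t; apply: (@continuous_comp _ _ _ (fun t => x + r * t) cauchy_fun).
    exact: continuous_affine.
  exact: continuous_cauchy_fun.
(* For [w = x + r t] one has [r ^ 2 t ^ 2 = (w - x) ^ 2 <= 2 (x ^ 2 + w ^ 2)], at most
   [2 (x ^ 2 + 1) (1 + w ^ 2)]. *)
exists (1 + 2 * (x ^+ 2 + 1) / r ^+ 2) => t _.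
rewrite ger0_norm; last by rewrite ltW// cauchy_fun_gt0.
set K := 1 + _; set w := x + r * t.
suff H : 1 + t ^+ 2 <= K * (1 + w ^+ 2).
  rewrite /cauchy_fun ler_pdivlMr ?cauchy_den_gt0// mulrC ler_pdivrMr//.
  exact: cauchy_den_gt0.
have r2 : 0 < r ^+ 2 by rewrite exprn_gt0.
rewrite /K mulrDl mul1r lerD//; first by rewrite lerDl sqr_ge0.
rewrite mulrAC ler_pdivlMr//.
have := sqr_ge0 (2 * x + r * t); have := sqr_ge0 (x * w); have := sqr_ge0 w; rewrite /w; nra.
Qed.

(** The primitive is [atan (x + r t) / r], and [atan] has total variation pi; so the bound is
    uniform in x. The factor [1 / r], once per direction, becomes the time decay [r ^ (- n)] of the
    heat flow. *)
Lemma halfint_cauchy_affine (x r : R) : 0 < r -> halfint (fun t => cauchy_fun (x + r * t)) <= pi / r.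
Proof.
move=> r0; pose F t := r^-1 * atan (x + r * t).
have Fd (t : R) : is_derive t 1 F (cauchy_fun (x + r * t)).
  have d1 := @is_derive1_comp _ atan (fun t => x + r * t) t _ _ (is_derive1_atan _) (is_derive_affine x r t).
  have := is_deriveZ r^-1 d1; move=> /is_derive_eq; apply.
  by rewrite -[_ *: _]/(_ * _) mulrCA mulVf ?mulr1// gt_eqF.
have Fl : F t @[t --> +oo] --> r^-1 * (pi / 2).
  apply: cvgM; first exact: cvg_cst.
  apply: (cvg_comp (fun t => x + r * t) atan); last exact: cvgy_atan.
  apply/cvgryPge => A; apply: filterS (nbhs_pinfty_ge (num_real ((A - x) / r))) => t At.
  by rewrite -lerBlDl mulrC -ler_pdivrMr.
rewrite (halfint_FTC (decaying_cauchy_affine x r0) Fd Fl) /F mulr0 addr0 -mulrBr mulrC ler_pM2r ?invr_gt0//.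
have := atan_gtNpi2 x; lra.
Qed.

(** The Gaussian absorbs the polynomial weight and the Cauchy factor supplies [1 / r]. The two
    summands pi belong to the two halves of the folded line, the reflected one with -x in place of
    x. *)
Lemma gaussint_cauchy_le N : exists2 C : R, 0 <= C & forall (A x r : R) f,
  0 <= A -> 0 < r -> pbounded f ->
  (forall t, `|f t| <= A * ((1 + t ^+ 2) ^+ N * cauchy_fun (x + r * t))) ->
  `|gaussint f| <= A * (C / r).
Proof.
have [K K0 hK] := gauss_dominated N; exists (K * (pi + pi)) => [|A x r f A0 r0 fp fN].
  by rewrite mulr_ge0// addr_ge0// pi_ge0.
have d1 := decaying_cauchy_affine x r0; have d2 := decaying_cauchy_affine (- x) r0.
pose g := (A * K) *: ((fun t => cauchy_fun (x + r * t)) + (fun t => cauchy_fun (- x + r * t))).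
have gd : decaying g by apply: decayingZ; exact: decayingD.
apply: (le_trans (halfint_norm_le (evenize_decaying fp) gd _)).
  move=> t _; rewrite /evenize normrM ger0_norm ?gauss_fun_ge0//.
  have -> : g t = A * K * cauchy_fun (x + r * t) + A * K * cauchy_fun (- x + r * t).
    by rewrite -mulrDr.
  apply: (le_trans (ler_wpM2l (gauss_fun_ge0 _) (ler_normD _ _))); rewrite mulrDr.
  have h y : gauss_fun t * (A * ((1 + t ^+ 2) ^+ N * cauchy_fun y)) <= A * K * cauchy_fun y.
    rewrite mulrCA -mulrA ler_wpM2l// mulrA ler_pM2r ?cauchy_fun_gt0// (le_trans (hK t))// ler_piMr// invf_le1 ?cauchy_den_gt0//.
    by rewrite lerDl sqr_ge0.
  apply: lerD.
    by apply: (le_trans _ (h _)); rewrite ler_wpM2l ?gauss_fun_ge0.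
  apply: (le_trans _ (h _)); rewrite ler_wpM2l ?gauss_fun_ge0// (le_trans (fN _))// sqrrN.
  by rewrite /cauchy_fun -[X in _ * (_ * (1 + X)^-1) <= _]sqrrN opprD mulrN opprK.
rewrite /g halfintZ; last exact: decayingD.
by rewrite halfintD// -!mulrA !ler_wpM2l// mulrDl lerD// halfint_cauchy_affine.
Qed.

End GaussianIntegral.

(** * Iterated Gaussian integrals in several variables *)

Section GaussianExpectation.
Context {R : realType} {n : nat}.
Implicit Types (h f g phi : 'rV[R]_n -> R) (x y v d : 'rV[R]_n) (i j : 'I_n) (s : seq 'I_n).

(** A product over the coordinates, so that a move along one axis changes a single factor; this
    suits integration one direction at a time. *)
Definition weight y : R := \prod_i (1 + y 0 i ^+ 2).

Lemma one_le_sqr (a : R) : 1 <= 1 + a ^+ 2.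
Proof. by rewrite lerDl sqr_ge0. Qed.

Lemma prod_one_le_sqr (P : pred 'I_n) y : 1 <= \prod_(i | P i) (1 + y 0 i ^+ 2).
Proof.
elim/big_rec : _ => // i p _ p1; rewrite -[leLHS]mulr1 ler_pM//.
exact: one_le_sqr.
Qed.

Lemma weight_ge1 y : 1 <= weight y.
Proof. exact: prod_one_le_sqr. Qed.

Lemma weight_ge0 y : 0 <= weight y.
Proof. exact: le_trans (weight_ge1 y). Qed.

Lemma weight_line y i t : weight (y + t *: 'e_i) <= 2 * weight y * (1 + t ^+ 2).
Proof.
rewrite /weight (bigD1 i)//= [\prod_j (1 + y 0 j ^+ 2)](bigD1 i)//=.
under eq_bigr => j ji do rewrite !mxE (negbTE ji) andbF mulr0 addr0.
set P := \prod_(_ | _) _; have P0 : 0 <= P.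
  by apply: prodr_ge0 => j _; apply: le_trans (one_le_sqr _).
rewrite !mxE !eqxx mulr1 mulrA mulrAC ler_wpM2r//.
have := sqr_ge0 (y 0 i - t); have := sqr_ge0 (y 0 i * t); nra.
Qed.

Lemma coord_le_weight y i : `|y 0 i| <= weight y.
Proof.
have h : `|y 0 i| <= 1 + y 0 i ^+ 2.
  have [t1|t1] := lerP `|y 0 i| 1; first by rewrite (le_trans t1)// lerDl sqr_ge0.
  rewrite -[y 0 i ^+ 2]real_normK ?num_real// expr2 ler_wpDl// ler_peMr//.
  exact: ltW.
rewrite /weight (bigD1 i)//= (le_trans h)// ler_peMr ?prod_one_le_sqr//.
by apply: le_trans (one_le_sqr _).
Qed.

Definition pgrowth phi := exists (C : R) N, forall y, `|phi y| <= C * weight y ^+ N.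

(** Stable under derivatives, multiplication by coordinates and Gaussian averages, so that averages
    can be iterated and differentiated freely. *)
Definition tempered phi := smooth phi /\ forall s, pgrowth (partials s phi).

Lemma pgrowth_uniform (phi : 'I_n -> 'rV[R]_n -> R) : (forall i, pgrowth (phi i)) ->
  exists (C : R) N, forall i y, `|phi i y| <= C * weight y ^+ N.
Proof.
move=> /choice[C] /choice[N] H; exists (\sum_i `|C i|), (\sum_i N i)%N => i y.
have Ni : (N i <= \sum_i N i)%N by rewrite (bigD1 i)//= leq_addr.
apply: (le_trans (pbounded_weaken (weight_ge1 y) (H i y) Ni)).
rewrite ler_wpM2r ?exprn_ge0 ?weight_ge0// (bigD1 i)//= lerDl; exact: sumr_ge0.
Qed.

Lemma pgrowthD f g : pgrowth f -> pgrowth g -> pgrowth (f + g).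
Proof.
move=> [C [N fC]] [D [M gD]]; exists (`|C| + `|D|), (N + M)%N => t.
rewrite mulrDl (le_trans (ler_normD _ _))// lerD//.
  by apply: pbounded_weaken (fC t) _; rewrite ?leq_addr ?weight_ge1.
by apply: pbounded_weaken (gD t) _; rewrite ?leq_addl ?weight_ge1.
Qed.

Lemma pgrowthZ (c : R) f : pgrowth f -> pgrowth (c *: f).
Proof. by move=> [C [N fC]]; exists (`|c| * C), N => t; rewrite normrM -mulrA ler_wpM2l// fC. Qed.

Lemma temperedD f g : tempered f -> tempered g -> tempered (f + g).
Proof.
move=> [fs fp] [gs gp]; split; first exact: smoothD.
by move=> s; rewrite partialsD//; exact: pgrowthD.
Qed.

Lemma temperedZ (c : R) f : tempered f -> tempered (c *: f).
Proof.
move=> [fs fp]; split; first exact: smoothZ.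
by move=> s; rewrite partialsZ//; exact: pgrowthZ.
Qed.

Lemma tempered_pd i f : tempered f -> tempered (pd i f).
Proof.
move=> [fs fp]; split; first exact: smooth_pd.
by move=> s; rewrite -partials_rcons.
Qed.

Lemma tempered_xmul j f : tempered f -> tempered (xmul j f).
Proof.
move=> ft; split; first by apply: smooth_xmul; case: ft.
move=> s; elim/last_ind: s f ft => [|s i IH] f ft.
  have [C [N fC]] := ft.2 [::]; exists C, N.+1 => y.
  by rewrite normrM exprS mulrCA ler_pM// coord_le_weight.
have pt := tempered_pd i ft.
have s1 : smooth f by exact: ft.1.
have s2 : smooth (xmul j (pd i f)) by apply: smooth_xmul; exact: pt.1.
have s3 : smooth ((i == j)%:R *: f) by exact: smoothZ.
rewrite partials_rcons (pd_xmul _ _ s1) (partialsD _ s3 s2) (partialsZ _ _ s1).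
by apply: pgrowthD; [apply: pgrowthZ; exact: ft.2|exact: IH].
Qed.

Definition gaussavg i phi : 'rV[R]_n -> R := fun y => gaussint (fun t => phi (y + t *: 'e_i)).

Lemma is_derive_tempered_line phi y i (t : R) : smooth phi ->
  is_derive t 1 (fun t => phi (y + t *: 'e_i)) (pd i phi (y + t *: 'e_i)).
Proof. by move=> ps; apply: is_derive_line; exact: smooth_derivable. Qed.

Lemma tempered_line phi y i : tempered phi -> pbounded (fun t => phi (y + t *: 'e_i)).
Proof.
move=> [ps pp]; split.
  by apply: is_derive_continuous => t; exact: is_derive_tempered_line.
have [C [N pC]] := pp [::]; exists (`|C| * (2 * weight y) ^+ N), N => t.
apply: (le_trans (pC _)); rewrite -mulrA -exprMn.
apply: (@le_trans _ _ (`|C| * weight (y + t *: 'e_i) ^+ N)).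
  by rewrite ler_wpM2r ?ler_norm ?exprn_ge0 ?weight_ge0.
by rewrite ler_wpM2l// lerXn2r ?nnegrE ?weight_ge0 ?weight_line// !mulr_ge0 ?weight_ge0// (le_trans _ (one_le_sqr _)).
Qed.

Lemma pbounded_pow N : pbounded (fun t : R => (1 + t ^+ 2) ^+ N).
Proof.
split.
  move=> t; apply: (@continuous_comp _ _ _ (fun t : R => 1 + t ^+ 2) (fun u => u ^+ N)).
    by apply: cvgD; [exact: cvg_cst|exact: exprn_continuous].
  exact: exprn_continuous.
by exists 1, N => t; rewrite mul1r ger0_norm// exprn_ge0// (le_trans _ (one_le_sqr _)).
Qed.

(** K depends on the growth exponent alone; the uniformity of the heat bounds in time and space
    rests on this. *)
Lemma gaussavg_bound N : exists2 K : R, 0 <= K & forall phi (C : R) i y, tempered phi -> 0 <= C ->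
  (forall z, `|phi z| <= C * weight z ^+ N) -> `|gaussavg i phi y| <= C * K * weight y ^+ N.
Proof.
pose G := gaussint (fun t : R => (1 + t ^+ 2) ^+ N).
have G0 : 0 <= G.
  apply: le_trans (gaussint_norm_le (pbounded_cst 0) (pbounded_pow N) _) => // t.
  by rewrite /= normr0 exprn_ge0// (le_trans _ (one_le_sqr _)).
exists (2 ^+ N * G) => [|phi C i y pt C0 pC]; first by rewrite mulr_ge0// exprn_ge0.
have -> : C * (2 ^+ N * G) * weight y ^+ N = C * (2 * weight y) ^+ N * G by rewrite exprMn; ring.
rewrite -gaussintZ; last exact: pbounded_pow.
apply: gaussint_norm_le; [exact: tempered_line|apply: pboundedZ; exact: pbounded_pow|].
move=> t; apply: (le_trans (pC _)); rewrite -[leRHS]/(_ * _) -mulrA -exprMn ler_wpM2l//.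
by rewrite lerXn2r ?nnegrE ?weight_ge0 ?weight_line// !mulr_ge0 ?weight_ge0// (le_trans _ (one_le_sqr _)).
Qed.

Lemma gaussavgD i f g : tempered f -> tempered g -> gaussavg i (f + g) = gaussavg i f + gaussavg i g.
Proof.
move=> ft gt; apply/funext => y; rewrite /gaussavg.
by rewrite -[RHS]gaussintD//; exact: tempered_line.
Qed.

Lemma gaussavgZ (c : R) i f : tempered f -> gaussavg i (c *: f) = c *: gaussavg i f.
Proof.
move=> ft; apply/funext => y; rewrite /gaussavg.
by rewrite -[RHS]gaussintZ//; exact: tempered_line.
Qed.

Lemma is_derive_gaussavg i j phi y : tempered phi ->
  is_derive y 'e_j (gaussavg i phi) (gaussavg i (pd j phi) y).
Proof.
move=> pt; have [C0 [N]] := (tempered_pd j (tempered_pd j pt)).2 [::]; move=> hC.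
pose C := `|C0|; have hC' z : `|pd j (pd j phi) z| <= C * weight z ^+ N.
  by apply: pbounded_weaken (hC z) _ => //; exact: weight_ge1.
(* The 8 collects a factor 2 from each of the two uses of [weight_line] and one from
   [1 + u ^+ 2 <= 2]. *)
pose B := C * (8 * weight y) ^+ N.
apply: (is_derive_quadratic (C := gaussint (B *: (fun t : R => (1 + t ^+ 2) ^+ N)))) => e e1.
have p1 := tempered_line (y + e *: 'e_j) i pt; have p2 := tempered_line y i pt.
have p3 := tempered_line y i (tempered_pd j pt).
have pB := pboundedZ B (pbounded_pow N).
have p3' := pboundedZ e p3; have p12 := pboundedB p1 p2.
have -> : gaussavg i phi (y + e *: 'e_j) - gaussavg i phi y - e * gaussavg i (pd j phi) y =
    gaussint ((fun t => phi (y + e *: 'e_j + t *: 'e_i)) - (fun t => phi (y + t *: 'e_i))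
      - e *: (fun t => pd j phi (y + t *: 'e_i))).
  by rewrite (gaussintB p12 p3') (gaussintB p1 p2) (gaussintZ _ p3).
rewrite [leRHS]mulrC -gaussintZ//.
apply: gaussint_norm_le; [exact: pboundedB|exact: pboundedZ|].
move=> t; rewrite !fctE -[e *: pd _ _ _]/(e * _) -[e ^+ 2 *: _]/(_ * _) -[B *: _]/(_ * _).
rewrite [y + e *: _ + _]addrAC [leRHS]mulrC.
apply: smooth_taylor; first exact: pt.1.
move=> u ue; apply: (le_trans (hC' _)); rewrite /B -[leRHS]mulrA -exprMn ler_wpM2l ?normr_ge0//.
have w0 z := weight_ge0 z; have t0 (a : R) : 0 <= 1 + a ^+ 2 by apply: le_trans (one_le_sqr _).
rewrite lerXn2r ?nnegrE// ?mulr_ge0//.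
apply: (le_trans (weight_line _ _ _)).
have u1 : 1 + u ^+ 2 <= 2.
  rewrite -[2]/(1 + 1) lerD2l -real_normK ?num_real// expr_le1//; exact: le_trans e1.
have h1 := weight_line y i t.
apply: (@le_trans _ _ (2 * weight (y + t *: 'e_i) * 2)); first by rewrite ler_wpM2l// mulr_ge0.
lra.
Qed.

Lemma pd_gaussavg i j phi : tempered phi -> pd j (gaussavg i phi) = gaussavg i (pd j phi).
Proof. by move=> pt; apply/funext => y; exact: pd_val (is_derive_gaussavg i j y pt). Qed.

Lemma gaussavg_growth i phi : tempered phi -> pgrowth (gaussavg i phi).
Proof.
move=> pt; have [C [N hC]] := pt.2 [::]; have [K K0 hK] := gaussavg_bound N.
exists (`|C| * K), N => y; apply: hK => // z.
by apply: pbounded_weaken (hC z) _ => //; exact: weight_ge1.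
Qed.

Lemma weight_le_norm y : weight y <= (1 + `|y| ^+ 2) ^+ n.
Proof.
have -> : (1 + `|y| ^+ 2) ^+ n = \prod_(i < n) (1 + `|y| ^+ 2) by rewrite prodr_const card_ord.
apply: ler_prod => i _.
rewrite (le_trans _ (one_le_sqr _))//= lerD2l -[leLHS]real_normK ?num_real//.
by rewrite lerXn2r ?nnegrE// coord_le_norm.
Qed.

Lemma pgrowth_partials_continuous phi : (forall y i, derivable phi y 'e_i) ->
  (forall i, pgrowth (pd i phi)) -> continuous phi.
Proof.
move=> pdv /pgrowth_uniform[C [N hC]] x.
apply: (@bounded_partials_continuous _ _ _ _ (`|C| * ((1 + (`|x| + 1) ^+ 2) ^+ n) ^+ N) 1) => //.
move=> y i yx; apply: (le_trans (pbounded_weaken (weight_ge1 y) (hC i y) (leqnn N))).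
rewrite ler_wpM2l// lerXn2r ?nnegrE ?weight_ge0 ?exprn_ge0 ?addr_ge0 ?sqr_ge0//.
apply: (le_trans (weight_le_norm y)); rewrite lerXn2r ?nnegrE ?addr_ge0 ?sqr_ge0//.
rewrite lerD2l lerXn2r ?nnegrE ?addr_ge0//.
by rewrite -[y](subrK x) addrC (le_trans (ler_normD _ _))// lerD2l.
Qed.

Lemma tempered_gaussavg i phi : tempered phi -> tempered (gaussavg i phi).
Proof.
have cd f : tempered f -> (forall y j, derivable (gaussavg i f) y 'e_j) /\ continuous (gaussavg i f).
  move=> ft; have d y j : derivable (gaussavg i f) y 'e_j by case: (is_derive_gaussavg i j y ft).
  split=> //; apply: pgrowth_partials_continuous => // j.
  by rewrite pd_gaussavg//; apply/gaussavg_growth/tempered_pd.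
have pE s f : tempered f -> tempered (partials s f) /\ partials s (gaussavg i f) = gaussavg i (partials s f).
  move=> ft; elim: s => //= j s [ts ->]; split; first exact: tempered_pd.
  by rewrite -[LHS]/(pd j _) pd_gaussavg.
move=> pt; split=> s; have [ts ->] := pE s _ pt; last exact: gaussavg_growth.
by have [d c] := cd _ ts; split.
Qed.

(** Along the averaged direction the coordinate is [y_i + t]: the part [y_i] leaves the integral,
    and Gaussian integration by parts turns t into half a derivative. *)
Lemma gaussavg_xmul i j phi : tempered phi ->
  gaussavg j (xmul i phi) = xmul i (gaussavg j phi) + ((i == j)%:R / 2) *: pd i (gaussavg j phi).
Proof.
move=> pt; apply/funext => y; rewrite pd_gaussavg// !fctE -[_ *: gaussavg _ _ y]/(_ * _).
have pl := tempered_line y j pt.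
rewrite /xmul /gaussavg; case: eqVneq => [<-|ij].
  have pl' := tempered_line y i pt; have pm := pbounded_mulid pl'.
  have dl (t : R) := is_derive_tempered_line y i t pt.1.
  rewrite (gaussint_stein pl' (tempered_line y i (tempered_pd i pt)) dl).
  rewrite mulrA mulfVK// mul1r -gaussintZ// -gaussintD//; last exact: pboundedZ.
  by congr gaussint; apply/funext => t; rewrite !fctE !mxE !eqxx mulr1 mulrDl.
rewrite mul0r mul0r addr0 -gaussintZ//; congr gaussint; apply/funext => t.
by rewrite !mxE (negbTE ij) andbF mulr0 addr0.
Qed.

Definition gaussavgs s phi := foldr gaussavg phi s.

Lemma tempered_gaussavgs s phi : tempered phi -> tempered (gaussavgs s phi).
Proof. by move=> pt; elim: s => //= i s; exact: tempered_gaussavg. Qed.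

Lemma pd_gaussavgs s j phi : tempered phi -> pd j (gaussavgs s phi) = gaussavgs s (pd j phi).
Proof.
by move=> pt; elim: s => //= i s IH; rewrite pd_gaussavg ?IH//; exact: tempered_gaussavgs.
Qed.

Lemma gaussavgsD s f g : tempered f -> tempered g ->
  gaussavgs s (f + g) = gaussavgs s f + gaussavgs s g.
Proof.
by move=> ft gt; elim: s => //= i s ->; rewrite gaussavgD//; exact: tempered_gaussavgs.
Qed.

Lemma gaussavgsZ s (c : R) f : tempered f -> gaussavgs s (c *: f) = c *: gaussavgs s f.
Proof. by move=> ft; elim: s => //= i s ->; rewrite gaussavgZ//; exact: tempered_gaussavgs. Qed.

Lemma gaussavgs_xmul s i phi : tempered phi ->
  gaussavgs s (xmul i phi) =
  xmul i (gaussavgs s phi) + ((count_mem i s)%:R / 2) *: pd i (gaussavgs s phi).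
Proof.
move=> pt; elim: s => [|j s IH] /=; first by rewrite mul0r scale0r addr0.
have ts := tempered_gaussavgs s pt.
rewrite IH gaussavgD ?gaussavgZ ?gaussavg_xmul//; [|exact: tempered_pd|exact: tempered_xmul|apply: temperedZ; exact: tempered_pd].
rewrite -addrA -pd_gaussavg// -scalerDl -mulrDl natrD eq_sym; congr (_ + (_ / _) *: _).
Qed.

(** The integral of [phi y * exp (- |y| ^ 2)] over all of R^n, for the Euclidean norm, written as an
    iterated integral. *)
Definition gaussE phi : R := gaussavgs (enum 'I_n) phi 0.

Lemma gaussED f g : tempered f -> tempered g -> gaussE (f + g) = gaussE f + gaussE g.
Proof. by move=> ft gt; rewrite /gaussE gaussavgsD. Qed.

Lemma gaussEZ (c : R) f : tempered f -> gaussE (c *: f) = c * gaussE f.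
Proof. by move=> ft; rewrite /gaussE gaussavgsZ. Qed.

Lemma gaussE_xmul i phi : tempered phi -> gaussE (xmul i phi) = gaussE (pd i phi) / 2.
Proof.
move=> pt; rewrite /gaussE gaussavgs_xmul// -[(_ + _) 0]/(_ + _) pd_gaussavgs//.
rewrite count_uniq_mem ?enum_uniq// mem_enum /= {1}/xmul mxE mul0r add0r.
by rewrite -[((_ / _) *: _) 0]/(1 / 2 * _) mul1r mulrC.
Qed.

Lemma gaussE_bound N : exists2 K : R, 0 <= K & forall phi (C : R), tempered phi -> 0 <= C ->
  (forall z, `|phi z| <= C * weight z ^+ N) -> `|gaussE phi| <= C * K.
Proof.
have [K K0 hK] := gaussavg_bound N.
exists (K ^+ n) => [|phi C pt C0 hC]; first exact: exprn_ge0.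
have H s y : `|gaussavgs s phi y| <= C * K ^+ size s * weight y ^+ N.
  elim: s y => [|i s IH] y /=; first by rewrite expr0 mulr1.
  rewrite exprSr mulrA; apply: hK => //; first exact: tempered_gaussavgs.
  by rewrite mulr_ge0// exprn_ge0.
have := H (enum 'I_n) 0; rewrite size_enum_ord.
have -> : weight 0 = 1 by rewrite /weight big1// => i _; rewrite mxE expr0n addr0.
by rewrite expr1n mulr1.
Qed.

(** The total mass [pi ^ (n / 2)] of the unnormalized Gaussian. *)
Definition gauss_mass : R := gaussint (cst 1) ^+ n.

Lemma gauss_mass_gt0 : 0 < gauss_mass.
Proof. by rewrite exprn_gt0// gaussint1_gt0. Qed.

Lemma gaussE_cst (c : R) : gaussE (cst c) = c * gauss_mass.
Proof.
rewrite /gaussE; have H s y : gaussavgs s (cst c) y = c * gaussint (cst 1) ^+ size s.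
  elim: s y => [|i s IH] y /=; first by rewrite expr0 mulr1.
  rewrite /gaussavg (_ : (fun _ => _) = (c * gaussint (cst 1) ^+ size s) *: cst (1 : R)).
    by rewrite gaussintZ; [rewrite exprSr mulrA|exact: pbounded_cst].
  by apply/funext => t; rewrite IH -[RHS]/(_ * 1) mulr1.
by rewrite H size_enum_ord.
Qed.

Lemma gaussE_cauchy_le N : exists2 C : R, 0 <= C & forall (A r : R) x phi, 0 <= A -> 0 < r -> tempered phi ->
  (forall y, `|phi y| <= A * \prod_i ((1 + y 0 i ^+ 2) ^+ N * cauchy_fun (x 0 i + r * y 0 i))) ->
  `|gaussE phi| <= A * (C / r) ^+ n.
Proof.
have [C C0 hC] := gaussint_cauchy_le (R := R) N; exists C => // A r x phi A0 r0 pt hphi.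
pose psi (i : 'I_n) (t : R) : R := (1 + t ^+ 2) ^+ N * cauchy_fun (x 0 i + r * t).
have psi0 i t : 0 <= psi i t.
  by rewrite mulr_ge0 ?(ltW (cauchy_fun_gt0 _))// exprn_ge0// (le_trans _ (one_le_sqr _)).
have Cr0 : 0 <= C / r by rewrite divr_ge0// ltW.
(* The directions in s are already integrated out, hence y vanishes there and the product runs over
   the others; each direction contributes one factor [C / r]. *)
have H s : uniq s -> forall y, (forall i, i \in s -> y 0 i = 0) ->
    `|gaussavgs s phi y| <= A * (C / r) ^+ size s * \prod_(i | i \notin s) psi i (y 0 i).
  elim: s => [_ y _|i s IH /= /andP[nis us] y y0]; first by rewrite expr0 mulr1; exact: hphi.
  pose D := \prod_(j | j \notin i :: s) psi j (y 0 j).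
  have D0 : 0 <= D by apply: prodr_ge0.
  have -> : A * (C / r) ^+ (size s).+1 * D = (A * (C / r) ^+ size s * D) * (C / r).
    by rewrite exprS; ring.
  apply: (hC _ (x 0 i)) => //; [by rewrite !mulr_ge0// exprn_ge0| |].
    exact/tempered_line/tempered_gaussavgs.
  move=> t; apply: (le_trans (IH us _ _)).
    move=> j js; rewrite !mxE y0 ?inE ?js ?orbT// add0r.
    have ji : j != i by apply: contraNneq nis => <-.
    by rewrite (negbTE ji) andbF mulr0.
  rewrite -[leRHS]mulrA ler_wpM2l ?mulr_ge0 ?exprn_ge0//.
  rewrite (bigD1 i)//= mulrC !mxE y0 ?inE ?eqxx// add0r mulr1 -/(psi i t) ler_wpM2r//.
  rewrite le_eqVlt; apply/orP; left; apply/eqP; apply: eq_big => [j|j /andP[_ ji]].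
    by rewrite inE negb_or andbC.
  by rewrite !mxE (negbTE ji) andbF mulr0 addr0.
have := H (enum 'I_n) (enum_uniq _) 0; rewrite size_enum_ord big1 ?mulr1 => [|i]; last by rewrite mem_enum.
by apply=> i _; rewrite mxE.
Qed.

End GaussianExpectation.
Arguments gauss_mass : clear implicits.

(** * The heat flow of Schwartz functions *)

Section SchwartzClass.
Context {R : realType} {n : nat}.
Implicit Types (h f g : 'rV[R]_n -> R) (x y v d : 'rV[R]_n) (i j : 'I_n) (s : seq 'I_n).

Lemma schwartzD f g : schwartz f -> schwartz g -> schwartz (f + g).
Proof.
move=> [fs fb] [gs gb]; split=> [|a s]; first exact: smoothD.
have [C fC] := fb a s; have [D gD] := gb a s; exists (C + D) => x.
rewrite partialsD// -[(_ + _) x]/(_ + _) mulrDr (le_trans (ler_normD _ _))// lerD//.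
Qed.

Lemma schwartzZ (c : R) f : schwartz f -> schwartz (c *: f).
Proof.
move=> [fs fb]; split=> [|a s]; first exact: smoothZ.
have [C fC] := fb a s; exists (`|c| * C) => x.
by rewrite partialsZ// -[(_ *: _) x]/(_ * _) mulrCA normrM ler_wpM2l.
Qed.

Lemma schwartz0 : schwartz (0 : 'rV[R]_n -> R).
Proof.
split=> [|a s]; first exact: smooth_cst.
exists 0 => x; have -> : partials s 0 = (0 : 'rV[R]_n -> R).
  by elim: s => //= i s ->; exact: pd_cst.
by rewrite mulr0 normr0.
Qed.

Lemma schwartz_sum (I : Type) (r : seq I) (P : pred I) (F : I -> 'rV[R]_n -> R) :
  (forall k, P k -> schwartz (F k)) -> schwartz (\sum_(k <- r | P k) F k).
Proof. by move=> FS; apply: big_ind => //; [exact: schwartz0|exact: schwartzD]. Qed.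

Lemma schwartz_pd i f : schwartz f -> schwartz (pd i f).
Proof.
move=> [fs fb]; split=> [|a s]; first exact: smooth_pd.
by rewrite -partials_rcons; exact: fb.
Qed.

Lemma schwartz_xmul j f : schwartz f -> schwartz (xmul j f).
Proof.
move=> fS; split=> [|a s]; first by apply: smooth_xmul; case: fS.
elim/last_ind: s f fS => [|s i IH] f fS.
  have [C fC] := fS.2 [ffun i => (a i + (i == j))%N] [::]; exists C => x.
  have := fC x; rewrite /= /xmul mulrA; congr (`|_ * _| <= _).
  under eq_bigr => i _ do rewrite ffunE exprD.
  rewrite big_split/=; congr (_ * _).
  rewrite (bigD1 j)//= eqxx expr1 big1 ?mulr1// => i /negbTE->.
  by rewrite expr0.
have pS := schwartz_pd i fS.
have [C hC] := IH _ pS; have [D hD] := fS.2 a s; exists (`|(i == j)%:R| * D + C) => x.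
have s2 : smooth (xmul j (pd i f)) by apply: smooth_xmul; exact: pS.1.
have s3 : smooth ((i == j)%:R *: f) by apply: smoothZ; exact: fS.1.
rewrite partials_rcons (pd_xmul _ _ fS.1) (partialsD _ s3 s2) (partialsZ _ _ fS.1).
rewrite -[(_ + _) x]/((i == j)%:R * partials s f x + partials s (xmul j (pd i f)) x) mulrDr.
rewrite (le_trans (ler_normD _ _))// lerD// mulrCA normrM ler_wpM2l//.
Qed.

Lemma schwartz_bounded f : schwartz f -> exists2 C : R, 0 <= C & forall x, `|f x| <= C.
Proof.
move=> [_ /(_ [ffun=> 0%N] [::])[C hC]]; exists `|C| => // x.
have := hC x; rewrite big1 ?mul1r => [|i _]; last by rewrite ffunE expr0.
by move/le_trans; apply; exact: ler_norm.
Qed.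

(** Multiplication by all the factors [1 + x_i ^ 2] stays in the Schwartz class, hence gives a
    bounded function. A product majorant is what iterated integrals can use. *)
Lemma schwartz_cauchy f : schwartz f ->
  exists2 C : R, 0 <= C & forall x, `|f x| <= C * \prod_i cauchy_fun (x 0 i).
Proof.
move=> fS; pose wm s := foldr (fun i g => g + xmul i (xmul i g)) f s.
have wS s : schwartz (wm s).
  by elim: s => //= i s IH; apply: schwartzD => //; do 2 apply: schwartz_xmul.
have wE s x : wm s x = \prod_(i <- s) (1 + x 0 i ^+ 2) * f x.
  elim: s => [|i s IH] /=; first by rewrite big_nil mul1r.
  by rewrite fctE /xmul IH big_cons; ring.
have [C C0 hC] := schwartz_bounded (wS (enum 'I_n)); exists C => // x.
have p : 0 < weight x by exact: lt_le_trans (weight_ge1 x).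
have e : \prod_(i <- enum 'I_n) (1 + x 0 i ^+ 2) = weight x by rewrite big_enum; exact: eq_bigl.
have := hC x; rewrite wE normrM e prodfV -/(weight x).
by rewrite ler_pdivlMr// mulrC (gtr0_norm p).
Qed.

Definition lap h : 'rV[R]_n -> R := \sum_i pd i (pd i h).

Definition zoom (r : R) x h : 'rV[R]_n -> R := fun y => h (x + r *: y).

Lemma is_derive_zoom r x h y i : derivable h (x + r *: y) 'e_i ->
  is_derive y 'e_i (zoom r x h) (r * pd i h (x + r *: y)).
Proof.
move=> hd; apply: is_derive_of_line.
have e : x + r *: y + (r * 0) *: 'e_i = x + r *: y by rewrite mulr0 scale0r addr0.
have hd' : derivable h (x + r *: y + (r * 0) *: 'e_i) 'e_i by rewrite e.
have d1 := is_derive_line hd'.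
have d2 : is_derive (0 : R) 1 (fun t => r * t) r.
  apply: (is_derive_quadratic (C := 0)) => t _; rewrite [t *: 1]mulr1 mul0r.
  by rewrite (_ : _ - _ = 0) ?normr0//; ring.
have := is_derive1_comp (g := fun t => r * t) d1 d2.
rewrite e -[_ * r]/(pd i h _ * r) mulrC.
rewrite [X in is_derive _ _ X](_ : _ = fun t => zoom r x h (y + t *: 'e_i))//.
by apply/funext => t; rewrite /= /zoom scalerDr addrA scalerA.
Qed.

Lemma pd_zoom r x h i : smooth h -> pd i (zoom r x h) = r *: zoom r x (pd i h).
Proof.
move=> hs; apply/funext => y; apply: pd_val; apply: is_derive_zoom; exact: smooth_derivable.
Qed.

Lemma tempered_zoom r x h : schwartz h -> tempered (zoom r x h).
Proof.
move=> hS; have zd g y i : smooth g -> derivable (zoom r x g) y 'e_i.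
  by move=> gs; have [] := @is_derive_zoom r x g y i (smooth_derivable gs).
have pE s : partials s (zoom r x h) = r ^+ size s *: zoom r x (partials s h).
  elim: s => [|i s /= ->]; first by rewrite expr0 scale1r.
  have ps := smooth_partials s hS.1.
  rewrite -[LHS]/(pd i _) pdZ => [|y]; last exact: zd.
  by rewrite pd_zoom// scalerA -exprSr.
have gr s : pgrowth (partials s (zoom r x h)).
  have pS : schwartz (partials s h) by elim: s => //= i s; exact: schwartz_pd.
  have [C C0 hC] := schwartz_bounded pS; rewrite pE; apply: pgrowthZ; exists C, 0%N => y.
  by rewrite expr0 mulr1 hC.
split=> // s; split=> [|i y].
  apply: pgrowth_partials_continuous => [y i|i].
    rewrite pE; apply: derivableZ; apply: zd; apply: smooth_partials; exact: hS.1.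
  by rewrite -[pd i _]/(partials (i :: s) (zoom r x h)); exact: gr.
by rewrite pE; apply: derivableZ; apply: zd; apply: smooth_partials; exact: hS.1.
Qed.

Lemma zoomD r x f g : zoom r x (f + g) = zoom r x f + zoom r x g.
Proof. by []. Qed.

Lemma zoom_xmul r x j h : zoom r x (xmul j h) = x 0 j *: zoom r x h + r *: xmul j (zoom r x h).
Proof.
apply/funext => y; rewrite /zoom /xmul !mxE mulrDl.
by rewrite -mulrA.
Qed.

(* Up to the factor [gauss_mass], the value at time [r ^ 2 / 4] of the solution of the heat
   equation with initial value [h]. *)
Definition heat h (r : R) x : R := gaussE (zoom r x h).

Lemma heatD f g r x : schwartz f -> schwartz g -> heat (f + g) r x = heat f r x + heat g r x.
Proof. by move=> fS gS; rewrite /heat zoomD gaussED//; exact: tempered_zoom. Qed.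

Lemma heatZ (c : R) f r x : schwartz f -> heat (c *: f) r x = c * heat f r x.
Proof. by move=> fS; rewrite -gaussEZ//; exact: tempered_zoom. Qed.

Lemma heat_sum (F : 'I_n -> 'rV[R]_n -> R) r x : (forall i, schwartz (F i)) ->
  heat (\sum_i F i) r x = \sum_i heat (F i) r x.
Proof.
move=> FS; pose P (g : 'rV[R]_n -> R) (a : R) := schwartz g /\ heat g r x = a.
suff [] : P (\sum_i F i) (\sum_i heat (F i) r x) by [].
apply: big_ind2 => [|f a g b [fS <-] [gS <-]|i _] //; last by split; [exact: schwartzD|exact: heatD].
split; first exact: schwartz0.
by rewrite -(scale0r 0) heatZ ?mul0r//; exact: schwartz0.
Qed.

Lemma heat0 f x : heat f 0 x = f x * gauss_mass R n.
Proof.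
rewrite /heat -gaussE_cst; congr gaussE; apply/funext => y.
by rewrite /zoom scale0r addr0.
Qed.

Lemma heat_bounded f : schwartz f -> exists2 C : R, 0 <= C & forall r x, `|heat f r x| <= C.
Proof.
move=> fS; have [C C0 hC] := schwartz_bounded fS; have [K K0 hK] := @gaussE_bound R n 0.
exists (C * K) => [|r x]; first exact: mulr_ge0.
by apply: hK => //; [exact: tempered_zoom|move=> z; rewrite expr0 mulr1 hC].
Qed.

Lemma is_derive_heat_x h r x j : schwartz h ->
  is_derive x 'e_j (fun x => heat h r x) (heat (pd j h) r x).
Proof.
move=> hS; have pS := schwartz_pd j hS.
have [C C0 hC] := schwartz_bounded (schwartz_pd j pS); have [K K0 hK] := @gaussE_bound R n 0.
apply: (is_derive_quadratic (C := C * K)) => e e1.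
have t1 := tempered_zoom r (x + e *: 'e_j) hS; have t2 := tempered_zoom r x hS.
have t3 := temperedZ (- e) (tempered_zoom r x pS).
have t2' := temperedZ (-1) t2.
have -> : heat h r (x + e *: 'e_j) - heat h r x - e * heat (pd j h) r x =
    gaussE (zoom r (x + e *: 'e_j) h + -1 *: zoom r x h + - e *: zoom r x (pd j h)).
  rewrite gaussED//; last exact: temperedD.
  by rewrite gaussED// !gaussEZ//; [rewrite mulN1r mulNr|exact: tempered_zoom].
rewrite mulrAC; apply: hK => [|| y]; first by do ?apply: temperedD.
  by rewrite mulr_ge0// sqr_ge0.
rewrite expr0 mulr1.
have -> : (zoom r (x + e *: 'e_j) h + -1 *: zoom r x h + - e *: zoom r x (pd j h)) y =
   h (x + r *: y + e *: 'e_j) - h (x + r *: y) - e * pd j h (x + r *: y).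
  rewrite !fctE -[-1 *: _]/(-1 * _) -[- e *: _]/(- e * _) mulN1r mulNr /zoom.
  by rewrite [x + _ + _]addrAC.
apply: smooth_taylor => [|u _]; [exact: hS.1|exact: hC].
Qed.

(** Heat equation in the variable r. The derivative of [h (x + r y)] in r is the sum of the
    [y_i * pd i h], and Gaussian integration by parts turns [y_i] into [r / 2] times a further
    derivative. *)
Lemma is_derive_heat_r h x (r : R) : schwartz h ->
  is_derive r 1 (fun r => heat h r x) (r / 2 * heat (lap h) r x).
Proof.
move=> hS; have pS i := schwartz_pd i hS.
have [C C0 hC] : exists2 C : R, 0 <= C & forall i j z, `|pd j (pd i h) z| <= C.
  have /choice[c hc] : forall ij : 'I_n * 'I_n, exists C : R, 0 <= C /\ forall z, `|pd ij.2 (pd ij.1 h) z| <= C.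
    by move=> [i j]; have [C C0 hC] := schwartz_bounded (schwartz_pd j (pS i)); exists C.
  exists (\sum_ij c ij) => [|i j z]; first by apply: sumr_ge0 => ij _; exact: (hc ij).1.
  apply: (le_trans ((hc (i, j)).2 z)); rewrite (bigD1 (i, j))//= lerDl.
  by apply: sumr_ge0 => ij _; exact: (hc ij).1.
(* The second derivative along y is a double sum of terms [y_i y_j], each at most [weight y ^+ 2]:
   hence the exponent 2 here and the factor [n%:R * n%:R] below. *)
have [K K0 hK] := @gaussE_bound R n 2.
apply: (is_derive_quadratic (C := C * n%:R * n%:R * K)) => e e1.
have t1 := tempered_zoom (r + e) x hS; have t2 := temperedZ (-1) (tempered_zoom r x hS).
pose T := \sum_i xmul i (zoom r x (pd i h)).
have t3 : tempered T /\ gaussE T = r / 2 * heat (lap h) r x.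
  rewrite /lap heat_sum => [|i]; last exact: schwartz_pd.
  pose P (g : 'rV[R]_n -> R) (a : R) := tempered g /\ gaussE g = r / 2 * a.
  rewrite -/(P T _); apply: big_ind2 => [|f a g b [fS fa] [gS gb]|i _].
  - have t0 : tempered (0 *: zoom r x h) by apply: temperedZ; exact: tempered_zoom.
    by move: t0; rewrite /P -{2}(scale0r (zoom r x h)) gaussEZ ?mul0r ?mulr0 ?scale0r//; exact: tempered_zoom.
  - by split; [exact: temperedD|rewrite gaussED// fa gb mulrDr].
  - have tz := tempered_zoom r x (pS i); split; first exact: tempered_xmul.
    rewrite gaussE_xmul// (pd_zoom _ _ _ (pS i).1) gaussEZ; first by rewrite mulrAC.
    by apply: tempered_zoom; exact: schwartz_pd.
have [T1 T2] := t3.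
have -> : heat h (r + e *: 1) x - heat h r x - e * (r / 2 * heat (lap h) r x) =
    gaussE (zoom (r + e) x h + -1 *: zoom r x h + - e *: T).
  have tT := temperedZ (- e) T1.
  rewrite gaussED//; last exact: temperedD.
  rewrite gaussED// !gaussEZ//; last exact: tempered_zoom.
  by rewrite mulN1r mulNr T2 [e *: 1]mulr1.
rewrite mulrAC; apply: hK => [|| y]; first by do ?apply: temperedD => //; exact: temperedZ.
  by apply: mulr_ge0; rewrite ?sqr_ge0// !mulr_ge0.
pose f (s : R) := h (x + r *: y + s *: y).
pose df (s : R) := \sum_i y 0 i * pd i h (x + r *: y + s *: y).
pose ddf (s : R) := \sum_i y 0 i * (\sum_j y 0 j * pd j (pd i h) (x + r *: y + s *: y)).
have fd (s : R) : is_derive s 1 f (df s).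
  have D := smooth_dir (x + r *: y + s *: y) y hS.1.
  have D' : derivable h (x + r *: y + s *: y) y by case: D.
  apply: (is_derive_eq (is_derive_line D')).
  by case: D.
have dfd (s : R) : is_derive s 1 df (ddf s).
  have := @is_derive_sum R _ _ n (fun i (s : R) => y 0 i * pd i h (x + r *: y + s *: y)) s 1
      (fun i => y 0 i * (\sum_j y 0 j * pd j (pd i h) (x + r *: y + s *: y))) _.
  rewrite fct_sumE; apply => i.
  have D := smooth_dir (x + r *: y + s *: y) y (pS i).1.
  have D' : derivable (pd i h) (x + r *: y + s *: y) y by case: D.
  apply: (is_deriveZ (y 0 i)).
  apply: (is_derive_eq (is_derive_line D')).
  by case: D.
have B (s : R) : `|s| <= `|e| -> `|ddf s| <= C * n%:R * n%:R * weight y ^+ 2.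
  move=> _; apply: (le_trans (ler_norm_sum _ _ _)).
  have -> : C * n%:R * n%:R * weight y ^+ 2 = \sum_(i < n) \sum_(j < n) weight y * (weight y * C).
    rewrite sumr_const card_ord -mulr_natl sumr_const card_ord -[_ *+ n]mulr_natl; ring.
  apply: ler_sum => i _; rewrite mulr_sumr (le_trans (ler_norm_sum _ _ _))//.
  apply: ler_sum => j _; rewrite !normrM.
  by do 2 (apply: ler_pM; rewrite ?mulr_ge0 ?normr_ge0 ?coord_le_weight//).
have := taylor2_le fd dfd B.
rewrite mulrAC; congr (`|_| <= _).
rewrite /f /df !scale0r !addr0 !fctE -[-1 *: _]/(-1 * _) -[- e *: _]/(- e * _) mulN1r mulNr.
by rewrite /zoom scalerDl addrA /T fct_sumE.
Qed.

Lemma heat_xmul h r x j : schwartz h ->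
  heat (xmul j h) r x = x 0 j * heat h r x + r ^+ 2 / 2 * heat (pd j h) r x.
Proof.
move=> hS; have tz := tempered_zoom r x hS; have tp := tempered_zoom r x (schwartz_pd j hS).
rewrite /heat zoom_xmul gaussED; [|exact: temperedZ|by apply: temperedZ; exact: tempered_xmul].
rewrite !gaussEZ//; last exact: tempered_xmul.
by rewrite gaussE_xmul// (pd_zoom _ _ _ hS.1) gaussEZ//; congr (_ + _); ring.
Qed.

End SchwartzClass.

(** * Decay of the heat flow in time and space *)

Section MomentOrder.
Context {R : realType} {n : nat}.
Implicit Types (h f g : 'rV[R]_n -> R) (x y : 'rV[R]_n) (i j : 'I_n) (s : seq 'I_n) (l : nat).

(* Sums of [l]-th order derivatives of Schwartz functions: the moments of order less than [l]
   vanish, which is what improves the decay of the heat flow. *)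
Fixpoint sorder l h : Prop := if l is l'.+1 then
  exists2 hs : 'I_n -> 'rV[R]_n -> R, forall i, sorder l' (hs i) & h = \sum_i pd i (hs i)
  else schwartz h.

Lemma sorder_schwartz l h : sorder l h -> schwartz h.
Proof.
elim: l h => //= l IH h [hs /= hss ->].
by apply: schwartz_sum => i _; apply/schwartz_pd/IH.
Qed.

Lemma sorder_smooth l h : sorder l h -> smooth h.
Proof. by move=> /sorder_schwartz[]. Qed.

Lemma sorderD l f g : sorder l f -> sorder l g -> sorder l (f + g).
Proof.
elim: l f g => [|l IH] f g /=; first exact: schwartzD.
move=> [fs fss ->] [gs gss ->]; exists (fun i => fs i + gs i) => [i|]; first exact: IH.
rewrite -big_split; apply: eq_bigr => i _; rewrite pdD// => x.
  exact/smooth_derivable/sorder_smooth.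
exact/smooth_derivable/sorder_smooth.
Qed.

Lemma sorderZ l (c : R) f : sorder l f -> sorder l (c *: f).
Proof.
elim: l f => [|l IH] f /=; first exact: schwartzZ.
move=> [fs fss ->]; exists (fun i => c *: fs i) => [i|]; first exact: IH.
rewrite scaler_sumr; apply: eq_bigr => i _; rewrite pdZ// => x.
exact/smooth_derivable/sorder_smooth.
Qed.

Lemma sorder0 l : sorder l 0.
Proof.
elim: l => [|l IH] /=; first exact: schwartz0.
by exists (fun=> 0) => //; rewrite big1// => i _; exact: pd_cst.
Qed.

Lemma sorder_sum l (I : Type) (r : seq I) (P : pred I) (F : I -> 'rV[R]_n -> R) :
  (forall k, P k -> sorder l (F k)) -> sorder l (\sum_(k <- r | P k) F k).
Proof. by move=> FS; apply: big_ind => //; [exact: sorder0|exact: sorderD]. Qed.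

Lemma sorder_pd l j f : sorder l f -> sorder l.+1 (pd j f).
Proof.
move=> fl; exists (fun i => if i == j then f else 0) => [i|].
  by case: ifP => // _; exact: sorder0.
rewrite (bigD1 j)//= eqxx big1 ?addr0// => i /negbTE ->; exact: pd_cst.
Qed.

Lemma sorderW l f : sorder l.+1 f -> sorder l f.
Proof.
elim: l f => [|l IH] f; first exact: (@sorder_schwartz 1).
by move=> [fs fss ->]; exists fs => // i; exact: IH.
Qed.

Lemma sorder_lap l f : sorder l f -> sorder l.+2 (lap f).
Proof. by move=> fl; apply: sorder_sum => i _; do 2 apply: sorder_pd. Qed.

(** Since [x_j * pd i h = pd i (x_j * h) - (i == j) * h], multiplication by a coordinate loses
    exactly one order. *)
Lemma sorder_xmul l j f : sorder l.+1 f -> sorder l (xmul j f).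
Proof.
have xE (fs : 'I_n -> 'rV[R]_n -> R) : (forall i, schwartz (fs i)) ->
    xmul j (\sum_i pd i (fs i)) = \sum_i (pd i (xmul j (fs i)) + (- (i == j)%:R) *: fs i).
  move=> fsS; apply/funext => x; rewrite /xmul !fct_sumE mulr_sumr; apply: eq_bigr => i _.
  rewrite -/(xmul j (fs i)) pd_xmul; last exact: (fsS i).1.
  rewrite !fctE /xmul; set a := (i == j)%:R; rewrite -[a *: _]/(a * _) -[- a *: _]/(- a * _).
  by ring.
elim: l f => [|l IH] f [fs fss ->].
  by apply/schwartz_xmul/schwartz_sum => i _; apply/schwartz_pd.
have fsS i : schwartz (fs i) := @sorder_schwartz l.+1 _ (fss i).
rewrite (xE _ fsS).
apply: sorder_sum => i _; apply: sorderD; last exact/sorderZ/fss.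
exact/sorder_pd/IH/fss.
Qed.

Definition xmuls s h := foldr xmul h s.

Lemma tempered_xmuls s f : tempered f -> tempered (xmuls s f).
Proof. by move=> ft; elim: s => //= i s; exact: tempered_xmul. Qed.

Lemma xmuls_rcons s j f : xmuls (rcons s j) f = xmuls s (xmul j f).
Proof. by rewrite /xmuls foldr_rcons. Qed.

Lemma xmuls_cat s s' f : xmuls (s ++ s') f = xmuls s (xmuls s' f).
Proof. by rewrite /xmuls foldr_cat. Qed.

Lemma xmulsD s f g : xmuls s (f + g) = xmuls s f + xmuls s g.
Proof. by elim: s => //= i s ->; apply/funext => x; rewrite /xmul !fctE mulrDr. Qed.

Lemma xmulsZ s (c : R) f : xmuls s (c *: f) = c *: xmuls s f.
Proof. by elim: s => //= i s ->; apply/funext => x; rewrite /xmul !fctE; exact: mulrCA. Qed.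

Lemma xmuls_sum s (F : 'I_n -> 'rV[R]_n -> R) : xmuls s (\sum_i F i) = \sum_i xmuls s (F i).
Proof.
elim: s => //= i s ->; apply/funext => x; rewrite /xmul !fct_sumE mulr_sumr.
by apply: eq_bigr.
Qed.

Lemma gaussE_sum (F : 'I_n -> 'rV[R]_n -> R) : (forall i, tempered (F i)) ->
  gaussE (\sum_i F i) = \sum_i gaussE (F i).
Proof.
have t0 : tempered (0 : 'rV[R]_n -> R).
  exact: (@tempered_zoom R n 0 0 0 schwartz0).
move=> Ft; pose P (g : 'rV[R]_n -> R) (a : R) := tempered g /\ gaussE g = a.
suff [] : P (\sum_i F i) (\sum_i gaussE (F i)) by [].
apply: big_ind2 => [|f a g b [fS <-] [gS <-]|i _] //; last by split; [exact: temperedD|exact: gaussED].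
by split=> //; rewrite -(scale0r 0) gaussEZ ?mul0r.
Qed.

(* Each derivative of the data is traded for a factor [1 / r] by Gaussian integration by parts,
   at the cost of a monomial weight; hence the induction over all weights [xmuls s]. *)
Lemma heat_moment_decay l h s : sorder l h ->
  exists C : R, forall (r : R) x, 0 < r -> `|gaussE (xmuls s (zoom r x h))| * r ^+ (n + l) <= C.
Proof.
elim: l h s => [|l IH] h s hl.
  have [A A0 hA] := schwartz_cauchy hl.
  have [C C0 hC] := @gaussE_cauchy_le R n (size s).
  exists (A * C ^+ n) => r x r0; rewrite addn0 -ler_pdivlMr ?exprn_gt0//.
  rewrite -mulrA -expr_div_n; apply: (hC _ _ x) => //.
    by apply/tempered_xmuls/tempered_zoom.
  move=> y; rewrite big_split/= mulrCA.
  have -> : xmuls s (zoom r x h) y = (\prod_(i <- s) y 0 i) * h (x + r *: y).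
    by elim: (s) => [|i t IHt] /=; rewrite ?big_nil ?mul1r// big_cons /xmul IHt mulrA.
  rewrite normrM ler_pM//; last first.
    apply: (le_trans (hA _)); rewrite ler_wpM2l//.
    by apply: ler_prod => i _; rewrite !mxE lexx ltW// cauchy_fun_gt0.
  rewrite prodrXl.
  elim: (s) => [|i t IHt] /=; first by rewrite big_nil normr1 expr0.
  rewrite big_cons normrM exprS ler_pM//; exact: coord_le_weight.
(* Induction on b moves the weights outside the derivative to its inside, one by one. The
   commutators carry no derivative and fall under the induction on l; once b is empty, [gaussE_xmul]
   exchanges the derivative for one more weight. *)
have sub i (g : 'rV[R]_n -> R) (b a : seq 'I_n) : sorder l g -> exists C : R, forall (r : R) x, 0 < r ->
    `|gaussE (xmuls b (pd i (xmuls a (zoom r x g))))| * r ^+ (n + l) <= C.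
  move=> gl; have gS := sorder_schwartz gl.
  elim/last_ind: b a => [|b j IHb] a.
    have [C hC] := IH g (i :: a) gl; exists (2 * C) => r x r0.
    have := hC r x r0; rewrite /= gaussE_xmul; last exact/tempered_xmuls/tempered_zoom.
    rewrite normrM [`|2^-1|]ger0_norm//; lra.
  have [C hC] := IHb (j :: a); have [D hD] := IH g (b ++ a) gl.
  exists (C + D) => r x r0; have tz := tempered_xmuls a (tempered_zoom r x gS).
  have -> : xmuls (rcons b j) (pd i (xmuls a (zoom r x g))) =
      xmuls b (pd i (xmuls (j :: a) (zoom r x g))) + - (i == j)%:R *: xmuls (b ++ a) (zoom r x g).
    rewrite xmuls_rcons xmuls_cat -xmulsZ -xmulsD /= pd_xmul; last exact: tz.1.
    by congr xmuls; apply/funext => y; rewrite scaleNr addrAC subrr add0r.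
  have t1 : tempered (xmuls b (pd i (xmuls (j :: a) (zoom r x g)))).
    by apply/tempered_xmuls/tempered_pd/tempered_xmul.
  have t2 := tempered_xmuls (b ++ a) (tempered_zoom r x gS).
  rewrite gaussED//; last exact: temperedZ.
  rewrite gaussEZ//; apply: (@le_trans _ _ ((`|gaussE (xmuls b (pd i (xmuls (j :: a) (zoom r x g))))|
     + `|gaussE (xmuls (b ++ a) (zoom r x g))|) * r ^+ (n + l))).
    rewrite ler_wpM2r ?exprn_ge0 ?(ltW r0)// (le_trans (ler_normD _ _))// lerD2l normrM normrN.
    by case: (i == j); rewrite ?normr1 ?mul1r// normr0 mul0r.
  by rewrite mulrDl lerD ?hC ?hD.
have [hs hsl ->] := hl.
have /choice[C hC] i : exists C : R, forall (r : R) x, 0 < r ->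
    `|gaussE (xmuls s (pd i (zoom r x (hs i))))| * r ^+ (n + l) <= C.
  exact: (sub i (hs i) s [::] (hsl i)).
exists (\sum_i C i) => r x r0.
have hS i := sorder_schwartz (hsl i).
(* A derivative of the zoomed function carries a factor r by the chain rule: this is the gain of
   [1 / r]. *)
have -> : zoom r x (\sum_i pd i (hs i)) = \sum_i r^-1 *: pd i (zoom r x (hs i)).
  apply/funext => y; rewrite /zoom !fct_sumE; apply: eq_bigr => i _.
  by rewrite -/(zoom r x (hs i)) (pd_zoom _ _ _ (hS i).1) scalerA mulVf ?scale1r ?gt_eqF.
have tp i : tempered (pd i (zoom r x (hs i))) by apply/tempered_pd/tempered_zoom.
rewrite xmuls_sum gaussE_sum => [|i]; last exact/tempered_xmuls/temperedZ.
rewrite (le_trans (ler_wpM2r _ (ler_norm_sum _ _ _))) ?exprn_ge0 ?(ltW r0)// mulr_suml.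
apply: ler_sum => i _; rewrite xmulsZ gaussEZ; last exact/tempered_xmuls.
rewrite normrM addnS exprS ger0_norm ?invr_ge0 ?(ltW r0)//.
rewrite [r^-1 * _]mulrC mulrA mulfVK ?gt_eqF//; exact: hC.
Qed.

Lemma heat_decay_time l h : sorder l h -> exists2 C : R, 0 <= C &
  forall (r : R) x, 0 <= r -> (1 + r) ^+ (n + l) * `|heat h r x| <= C.
Proof.
move=> hl; have [C hC] := heat_moment_decay [::] hl.
have [D D0 hD] := heat_bounded (sorder_schwartz hl).
have E0 : 0 <= 2 ^+ (n + l) :> R by exact: exprn_ge0.
(* [1 + r <= 2] for [r <= 1], where the flow is merely bounded by D, and [1 + r <= 2 r] beyond. *)
exists (2 ^+ (n + l) * (`|C| + D)) => [|r x r0]; first by rewrite mulr_ge0// addr_ge0.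
have [r1|r1] := lerP r 1.
  apply: ler_pM; rewrite ?exprn_ge0 ?addr_ge0//.
    by rewrite lerXn2r ?nnegrE ?addr_ge0// -[2]/(1 + 1) lerD2l.
  by rewrite (le_trans (hD _ _))// lerDr.
apply: (@le_trans _ _ (2 ^+ (n + l) * (r ^+ (n + l) * `|heat h r x|))).
  rewrite mulrA -exprMn ler_wpM2r// lerXn2r ?nnegrE ?addr_ge0 ?mulr_ge0//.
  by rewrite mulr2n mulrDl mul1r lerD2r ltW.
rewrite ler_wpM2l// mulrC (le_trans (hC _ _ _)) ?(lt_trans _ r1)//.
by rewrite (le_trans (ler_norm _))// lerDl.
Qed.

(* Multiplication by [x_j] commutes with the heat flow up to [r ^ 2 / 2 * pd j], so spatial decay
   follows from decay in time. *)
Lemma heat_decay_coord b l h j : sorder l h -> exists2 C : R, 0 <= C &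
  forall (r : R) x, 0 <= r -> `|x 0 j| ^+ b * ((1 + r) ^+ (n + l) * `|heat h r x|) <= C * (1 + r) ^+ b.
Proof.
elim: b l h => [|b IH] l h hl.
  have [C C0 hC] := heat_decay_time hl; exists C => // r x r0.
  by rewrite !expr0 mul1r mulr1 hC.
have hS := sorder_schwartz hl.
have [C C0 hC] := IH _ _ (sorder_pd j hl).
have [D D0 hD] : exists2 C : R, 0 <= C & forall (r : R) x, 0 <= r ->
    `|x 0 j| ^+ b * ((1 + r) ^+ (n + l) * `|heat (xmul j h) r x|) <= C * (1 + r) ^+ b.+1.
  (* For order 0 the product with [x_j] is still of order 0, and the extra factor [1 + r] is given
     away. For positive order one order is lost, and that factor pays for it. *)
  case: l hl {C C0 hC hS} => [|l] hl.
    have [D D0 hD] := IH _ _ (schwartz_xmul j hl : sorder 0 _); exists D => // r x r0.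
    apply: (le_trans (hD _ _ r0)); rewrite ler_wpM2l// ler_weXn2l// lerDl//.
  have [D D0 hD] := IH _ _ (sorder_xmul j hl); exists D => // r x r0.
  rewrite addnS exprS [_ ^+ b.+1]exprS -mulrA mulrCA [leRHS]mulrCA.
  by rewrite ler_wpM2l ?addr_ge0// hD.
exists (D + C) => [|r x r0]; first exact: addr_ge0.
have r10 : 0 <= 1 + r by rewrite addr_ge0.
have r11 : 1 <= 1 + r by rewrite lerDl.
have e : x 0 j * heat h r x = heat (xmul j h) r x - r ^+ 2 / 2 * heat (pd j h) r x.
  by rewrite heat_xmul//; ring.
have -> : `|x 0 j| ^+ b.+1 * ((1 + r) ^+ (n + l) * `|heat h r x|) =
   `|x 0 j| ^+ b * ((1 + r) ^+ (n + l) * `|x 0 j * heat h r x|) by rewrite exprSr normrM; ring.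
rewrite e mulrDl.
apply: (@le_trans _ _ (`|x 0 j| ^+ b * ((1 + r) ^+ (n + l) * `|heat (xmul j h) r x|)
   + `|x 0 j| ^+ b * ((1 + r) ^+ (n + l) * (r ^+ 2 / 2 * `|heat (pd j h) r x|)))).
  rewrite -mulrDr -mulrDr !ler_wpM2l ?exprn_ge0// (le_trans (ler_normB _ _))// lerD2l normrM.
  by rewrite ger0_norm// divr_ge0// sqr_ge0.
apply: lerD; first exact: hD.
(* [r ^ 2 / 2 <= (1 + r) ^ 2]: one factor matches the higher order of [pd j h], the other goes into
   the exponent [b.+1]. *)
apply: (@le_trans _ _ ((1 + r) * (`|x 0 j| ^+ b * ((1 + r) ^+ (n + l.+1) * `|heat (pd j h) r x|)))).
  have -> : (1 + r) * (`|x 0 j| ^+ b * ((1 + r) ^+ (n + l.+1) * `|heat (pd j h) r x|)) =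
    `|x 0 j| ^+ b * ((1 + r) ^+ (n + l) * ((1 + r) ^+ 2 * `|heat (pd j h) r x|)).
    by rewrite addnS exprS; ring.
  rewrite !ler_wpM2l ?exprn_ge0// ler_wpM2r// ler_pdivrMr//; nra.
rewrite [_ ^+ b.+1]exprS [leRHS]mulrCA ler_wpM2l//; exact: hC.
Qed.

Lemma heat_decay l h : sorder l h -> exists2 C : R, 0 <= C &
  forall (r : R) x, 0 <= r -> (1 + r + `|x|) ^+ (n + l) * `|heat h r x| <= C.
Proof.
move=> hl; have [D D0 hD] := heat_decay_time hl.
have /choice[c hc] j : exists C : R, 0 <= C /\ forall (r : R) x, 0 <= r ->
    `|x 0 j| ^+ (n + l) * `|heat h r x| <= C.
  (* The choice [b = n + l] makes the powers of [1 + r] on both sides cancel. *)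
  have [C C0 hC] := heat_decay_coord (n + l) j hl; exists C; split=> // r x r0.
  have p : 0 < (1 + r) ^+ (n + l) by rewrite exprn_gt0// ltr_wpDr.
  by have := hC r x r0; rewrite mulrCA [leRHS]mulrC ler_pM2l.
have S0 : 0 <= \sum_j c j by apply: sumr_ge0 => j _; exact: (hc j).1.
exists (2 ^+ (n + l) * (D + \sum_j c j)) => [|r x r0]; first by rewrite mulr_ge0 ?exprn_ge0 ?addr_ge0.
have r10 : 0 <= 1 + r by rewrite addr_ge0.
pose m := Num.max (1 + r) `|x|.
have m0 : 0 <= m by rewrite le_max r10.
apply: (@le_trans _ _ (2 ^+ (n + l) * (m ^+ (n + l) * `|heat h r x|))).
  rewrite mulrA -exprMn ler_wpM2r// lerXn2r ?nnegrE ?addr_ge0 ?mulr_ge0//.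
  by rewrite mulr2n mulrDl mul1r lerD// le_max lexx ?orbT.
rewrite ler_wpM2l ?exprn_ge0// /m; case: (lerP (1 + r) `|x|) => [xr|_]; last first.
  by rewrite (le_trans (hD _ _ r0))// lerDl.
have x0 : mx_norm x != 0 by rewrite -[mx_norm x]/(`|x|) gt_eqF// (lt_le_trans _ xr)// ltr_wpDr.
have [[a j] /= ej] := mx_norm_neq0 x0; rewrite ord1 in ej.
rewrite [`|x|]ej (le_trans ((hc j).2 r x r0))// (bigD1 j)//= ler_wpDl// lerDl.
by apply: sumr_ge0 => k _; exact: (hc k).1.
Qed.

End MomentOrder.

(** * Negative powers of the Laplacian *)

Section Potential.
Context {R : realType} {n : nat}.
Implicit Types (h f g : 'rV[R]_n -> R) (x y : 'rV[R]_n) (i j : 'I_n) (s : seq 'I_n) (l e q : nat).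

Lemma is_derive_pow m (r : R) : is_derive r 1 (fun r => r ^+ m) (m%:R * r ^+ m.-1).
Proof.
have d : derivable (fun r : R => r ^+ m) r 1 by exact: exprn_derivable.
apply: (is_derive_eq (derivableP d)); rewrite exp_derive.
by rewrite [_ *: 1]mulr1.
Qed.

Lemma continuous_heat h x : schwartz h -> continuous (fun r => heat h r x).
Proof. by move=> hS; apply: is_derive_continuous => r; exact: is_derive_heat_r. Qed.

Definition pot_integrand e h x : R -> R := fun r => r ^+ e * heat h r x.

(* For [e = 2 s - 1] this is a multiple of the inverse of the [s]-th power of the Laplacian,
   see [pot_iter_lap]. *)
Definition pot e h x : R := halfint (pot_integrand e h x).

Lemma continuous_pot_integrand e h x : schwartz h -> continuous (pot_integrand e h x).
Proof. by move=> hS r; apply: cvgM; [exact: exprn_continuous|exact: continuous_heat]. Qed.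

Lemma sqr_add_ge (a r : R) : 0 <= a -> 0 <= r -> a ^+ 2 + r ^+ 2 <= (a + r) ^+ 2.
Proof. by move=> a0 r0; rewrite sqrrD addrAC lerDl mulrn_wge0// mulr_ge0. Qed.

(** Of the [n + l] powers of [1 + r + |x|], e absorb [r ^+ e], q pay for the weight in x, and the
    last two leave a Cauchy function of width [1 + |x|]. *)
Lemma pot_integrand_bound l e q h : sorder l h -> (n + l = e + q.+2)%N ->
  exists2 C : R, 0 <= C & forall (r : R) x, 0 <= r ->
    (1 + `|x|) ^+ q * `|pot_integrand e h x r| <= C * ((1 + `|x|) ^+ 2 + r ^+ 2)^-1.
Proof.
move=> hl nl; have [C C0 hC] := heat_decay hl; exists C => // r x r0.
set a := 1 + `|x|.
have a0 : 0 < a by rewrite ltr_wpDr.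
have ar0 : 0 < a + r by rewrite ltr_wpDr.
have p : 0 < a ^+ 2 + r ^+ 2 by rewrite ltr_wpDr ?sqr_ge0// exprn_gt0.
rewrite ler_pdivlMr// normrM normrX (ger0_norm r0).
have := hC r x r0; rewrite addrAC -/a nl; apply: le_trans.
have -> : (a + r) ^+ (e + q.+2) = (a + r) ^+ q * (a + r) ^+ e * (a + r) ^+ 2.
  by rewrite -!exprD; congr (_ ^+ _); lia.
rewrite mulrA mulrAC ler_wpM2r//.
apply: ler_pM; rewrite ?mulr_ge0 ?exprn_ge0 ?(ltW a0) ?(ltW p)//; last first.
  by apply: sqr_add_ge => //; exact: ltW.
apply: ler_pM; rewrite ?exprn_ge0 ?(ltW a0)//.
  by rewrite lerXn2r ?nnegrE ?(ltW a0) ?(ltW ar0)// lerDl.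
by rewrite lerXn2r ?nnegrE ?(ltW ar0)// lerDr ltW.
Qed.

Lemma decaying_pot_integrand l e h x : sorder l h -> (e.+2 <= n + l)%N ->
  decaying (pot_integrand e h x).
Proof.
move=> hl nl; have [] := @pot_integrand_bound l e (n + l - e.+2) h hl.
  by lia.
set q := (_ - _)%N => C C0 hC; split; first by apply: continuous_pot_integrand; exact: sorder_schwartz hl.
exists C => r r0.
have a1 : 1 <= 1 + `|x| by rewrite lerDl.
apply: (@le_trans _ _ ((1 + `|x|) ^+ q * `|pot_integrand e h x r|)).
  by rewrite ler_peMl// exprn_ege1.
apply: (le_trans (hC _ _ r0)); rewrite ler_wpM2l// lef_pV2 ?posrE ?cauchy_den_gt0//.
  by rewrite lerD2r exprn_ege1.
by rewrite ltr_wpDr ?sqr_ge0// exprn_gt0// (lt_le_trans _ a1).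
Qed.

(** With [a = 1 + |x|] the majorant [C / (a ^ 2 + r ^ 2)] integrates to at most [C pi / a], one more
    power of decay than the weight q. *)
Lemma pot_bound l e q h : sorder l h -> (n + l = e + q.+2)%N ->
  exists2 C : R, 0 <= C & forall x, (1 + `|x|) ^+ q.+1 * `|pot e h x| <= C.
Proof.
move=> hl nl; have [C C0 hC] := pot_integrand_bound hl nl.
exists (C * pi) => [|x]; first by rewrite mulr_ge0// pi_ge0.
set a := 1 + `|x|; have a0 : 0 < a by rewrite ltr_wpDr.
have d1 : decaying (pot_integrand e h x).
  by apply: decaying_pot_integrand hl _; lia.
have ia : 0 < a^-1 by rewrite invr_gt0.
have d2 := decaying_cauchy_affine 0 ia.
have d3 := decayingZ (C / a ^+ 2) d2.
have d4 := decayingZ (a ^+ q) d1.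
have E (r : R) : (a ^+ 2 + r ^+ 2)^-1 = cauchy_fun (0 + a^-1 * r) / a ^+ 2.
  rewrite /cauchy_fun add0r -invfM; congr (_^-1).
  by rewrite mulrDl mul1r exprMn exprVn mulrAC mulVf ?mul1r// expf_neq0// gt_eqF.
have H : `|a ^+ q * pot e h x| <= C / a ^+ 2 * (pi / a^-1).
  rewrite -halfintZ//; apply: (le_trans (halfint_norm_le d4 d3 _)).
    move=> r r0; rewrite -[X in `|X|]/(a ^+ q * pot_integrand e h x r) normrM.
    rewrite ger0_norm ?exprn_ge0 ?(ltW a0)//; apply: (le_trans (hC _ _ r0)).
    by rewrite E mulrA mulrAC.
  rewrite halfintZ//; apply: ler_wpM2l; first by rewrite divr_ge0 ?sqr_ge0.
  exact: halfint_cauchy_affine.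
rewrite exprS -mulrA; have := ler_wpM2l (ltW a0) H.
rewrite normrM ger0_norm ?exprn_ge0 ?(ltW a0)// => /le_trans; apply.
by have -> : a * (C / a ^+ 2 * (pi / a^-1)) = C * pi by field; rewrite gt_eqF.
Qed.

Lemma potD l e f g x : sorder l f -> sorder l g -> (e.+2 <= n + l)%N ->
  pot e (f + g) x = pot e f x + pot e g x.
Proof.
move=> fl gl nl; rewrite -halfintD; [|exact: decaying_pot_integrand fl nl|exact: decaying_pot_integrand gl nl].
congr halfint; apply/funext => r; rewrite /pot_integrand heatD ?mulrDr//.
  exact: sorder_schwartz fl.
exact: sorder_schwartz gl.
Qed.

Lemma potZ l e (c : R) f x : sorder l f -> (e.+2 <= n + l)%N -> pot e (c *: f) x = c * pot e f x.
Proof.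
move=> fl nl; rewrite -halfintZ; last exact: decaying_pot_integrand fl nl.
congr halfint; apply/funext => r; rewrite /pot_integrand heatZ; first exact: mulrCA.
exact: sorder_schwartz fl.
Qed.

(** The Taylor remainder involves the second derivative of h, which has order [l.+2]; its decay in
    time is uniform in x and dominates the remainder by a Cauchy function. *)
Lemma is_derive_pot l e h x j : sorder l h -> (e.+2 <= n + l)%N ->
  is_derive x 'e_j (pot e h) (pot e (pd j h) x).
Proof.
move=> hl nl; have hl1 := sorder_pd j hl; have hl2 := sorder_pd j hl1.
have nl1 : (e.+2 <= n + l.+1)%N by rewrite addnS (leq_trans nl).
have nl2 : (e.+2 <= n + l.+2)%N by rewrite addnS (leq_trans nl1).
have hS := sorder_schwartz hl; have hS1 := sorder_schwartz hl1.
have [C C0 hC] := heat_decay_time hl2.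
apply: (is_derive_quadratic (C := halfint (C *: cauchy_fun))) => t t1.
have dp := decaying_pot_integrand (x + t *: 'e_j) hl nl.
have dx := decaying_pot_integrand x hl nl; have dd := decaying_pot_integrand x hl1 nl1.
have dd' := decayingZ t dd; have dc : decaying (C *: cauchy_fun : R -> R) by exact: decaying_cauchy.
have dN (k : R -> R) : decaying k -> decaying (- k) by rewrite -scaleN1r; exact: decayingZ.
have dpx : decaying (pot_integrand e h (x + t *: 'e_j) - pot_integrand e h x).
  by apply: decayingD => //; exact: dN.
have -> : pot e h (x + t *: 'e_j) - pot e h x - t * pot e (pd j h) x =
  halfint (pot_integrand e h (x + t *: 'e_j) - pot_integrand e h x - t *: pot_integrand e (pd j h) x).
  by rewrite (halfintB dpx dd') (halfintB dp dx) (halfintZ _ dd).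
rewrite [leRHS]mulrC -halfintZ//; apply: halfint_norm_le.
- by apply: decayingD => //; exact: dN.
- exact: decayingZ.
move=> r r0; rewrite !fctE /pot_integrand -[t *: (r ^+ e * _)]/(t * _) -[t ^+ 2 *: _]/(_ * _) -[C *: _]/(C * _).
have -> : r ^+ e * heat h r (x + t *: 'e_j) - r ^+ e * heat h r x - t * (r ^+ e * heat (pd j h) r x) =
  r ^+ e * (heat h r (x + t *: 'e_j) - heat h r x - t * heat (pd j h) r x) by ring.
pose D := C / (1 + r) ^+ (n + l.+2).
have p m : 0 < (1 + r) ^+ m by rewrite exprn_gt0// ltr_wpDr.
have T : `|heat h r (x + t *: 'e_j) - heat h r x - t * heat (pd j h) r x| <= D * t ^+ 2.
  have d1 g y : schwartz g -> 'D_('e_j) (fun x => heat g r x) y = heat (pd j g) r y.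
    by move=> gS; have [_ ->] := is_derive_heat_x r y j gS.
  have e1 : 'D_('e_j) (fun x => heat h r x) = (fun x => heat (pd j h) r x).
    by apply/funext => y; exact: d1.
  have := @taylor2_line _ _ (fun x => heat h r x) x 'e_j D t.
  rewrite e1 (d1 h x hS); apply=> [s|s|s _].
  - by have [] := is_derive_heat_x r (x + s *: 'e_j) j hS.
  - by have [] := is_derive_heat_x r (x + s *: 'e_j) j hS1.
  - by rewrite d1// /D ler_pdivlMr// mulrC hC.
rewrite normrM normrX (ger0_norm r0) mulrC (le_trans (ler_wpM2r _ T)) ?exprn_ge0//.
rewrite mulrAC [leRHS]mulrC ler_wpM2r ?sqr_ge0// /D -mulrA ler_wpM2l//.
rewrite mulrC ler_pdivrMr// mulrC ler_pdivlMr ?cauchy_den_gt0//.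
have [m em] : exists m, (n + l.+2 = e + m + 2)%N.
  by exists (n + l.+2 - e.+2)%N; lia.
rewrite em !exprD; apply: ler_pM; rewrite ?exprn_ge0 ?(ltW (cauchy_den_gt0 _))//.
  rewrite -[leLHS]mulr1 ler_pM ?exprn_ge0//; last by rewrite exprn_ege1// lerDl.
  by rewrite lerXn2r ?nnegrE ?addr_ge0// lerDr.
by rewrite -[X in X + _](expr1n R 2) sqr_add_ge.
Qed.

Lemma pd_pot l e h j : sorder l h -> (e.+2 <= n + l)%N -> pd j (pot e h) = pot e (pd j h).
Proof. by move=> hl nl; apply/funext => x; exact: pd_val (is_derive_pot x j hl nl). Qed.

Lemma sorder_partials l s h : sorder l h -> sorder l (partials s h).
Proof. by move=> hl; elim: s => //= i s IH; apply/sorderW/sorder_pd. Qed.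

Lemma smooth_pot l e h : sorder l h -> (e.+2 <= n + l)%N -> smooth (pot e h).
Proof.
move=> hl nl.
have dv l' g y i : sorder l' g -> (e.+2 <= n + l')%N -> derivable (pot e g) y 'e_i.
  by move=> gl nl'; have [] := is_derive_pot y i gl nl'.
have pE s : partials s (pot e h) = pot e (partials s h).
  elim: s => //= i s ->; rewrite -[LHS]/(pd i _); exact: pd_pot (sorder_partials s hl) nl.
move=> s; rewrite pE; have sl := sorder_partials s hl; split=> [|i y]; last exact: dv sl nl.
have e1 : (n + l = e + (n + l - e.+2).+2)%N by lia.
apply: pgrowth_partials_continuous => [y i|i]; first exact: dv sl nl.
rewrite (pd_pot _ sl nl); have [C C0 hC] := pot_bound (sorderW (sorder_pd i sl)) e1.
exists C, 0%N => y; rewrite expr0 mulr1 (le_trans _ (hC y))// ler_peMl// exprn_ege1//.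
by rewrite lerDl.
Qed.

Lemma heat_pow_cvg0 l e h x : sorder l h -> (e.+2 <= n + l)%N ->
  (fun r => 2 * r ^+ e * heat h r x) r @[r --> +oo] --> (0 : R).
Proof.
move=> hl nl; have [_ [C hC]] := decaying_pot_integrand x hl nl.
apply: (@cvg0_cauchy _ _ (2 * C)) => r r0; rewrite -mulrA normrM ger0_norm// -mulrA.
by rewrite ler_wpM2l// hC.
Qed.

(** Integration by parts in r: the derivative of [2 r ^ (2 k + 2) heat h] is [4 (k + 1) r ^ (2 k +
    1) heat h + r ^ (2 k + 3) heat (lap h)], and both boundary values are 0. *)
Lemma pot_lap l k h x : sorder l h -> (k.*2.+4 <= n + l)%N ->
  pot k.*2.+3 (lap h) x = - (4 * k.+1%:R) * pot k.*2.+1 h x.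
Proof.
move=> hl nl; have hS := sorder_schwartz hl.
have d1 : decaying (pot_integrand k.*2.+1 h x).
  by apply: decaying_pot_integrand hl _; lia.
have d2 : decaying (pot_integrand k.*2.+3 (lap h) x).
  by apply: decaying_pot_integrand (sorder_lap hl) _; lia.
pose F (r : R) := 2 * r ^+ k.*2.+2 * heat h r x.
have d3 := decayingZ (4 * k.+1%:R) d1; have d4 := decayingD d3 d2.
have Fd (r : R) : is_derive r 1 F (((4 * k.+1%:R) *: pot_integrand k.*2.+1 h x + pot_integrand k.*2.+3 (lap h) x) r).
  have D := is_deriveM (is_deriveZ 2 (is_derive_pow k.*2.+2 r)) (is_derive_heat_r x r hS).
  apply: (is_derive_eq D); rewrite !fctE /pot_integrand /=.
  rewrite -!/(_ * _) -[(_ * _) *: (r / 2 * _)]/(_ * _) -[heat h r x *: _]/(_ * _) -[_ *: (r ^+ _ * _)]/(_ * _).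
  rewrite -[2 *: _]/(2 * _) [r ^+ k.*2.+2]exprS [r ^+ k.*2.+3]exprS [r ^+ k.*2.+2]exprS.
  have -> : k.*2.+2%:R = 2 * k.+1%:R :> R by rewrite -doubleS -mul2n natrM.
  by field.
have := halfint_FTC d4 Fd (heat_pow_cvg0 x hl nl).
rewrite halfintD// halfintZ// /F expr0n mulr0 mul0r subrr => /eqP.
by rewrite addrC addr_eq0 => /eqP; rewrite mulNr.
Qed.

(** The integrand is the r-derivative of [2 heat h]; here the boundary value at r = 0 survives and
    returns the initial value h. *)
Lemma pot_lap1 l h x : sorder l h -> (2 <= n + l)%N ->
  pot 1 (lap h) x = - (2 * gauss_mass R n) * h x.
Proof.
move=> hl nl; have hS := sorder_schwartz hl.
have d2 : decaying (pot_integrand 1 (lap h) x).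
  by apply: decaying_pot_integrand (sorder_lap hl) _; lia.
pose F (r : R) := 2 * r ^+ 0 * heat h r x.
have Fd (r : R) : is_derive r 1 F (pot_integrand 1 (lap h) x r).
  have D := is_deriveZ 2 (is_derive_heat_r x r hS).
  have -> : F = 2 \*: (fun r => heat h r x) by apply/funext => t; rewrite /F expr0 mulr1.
  apply: (is_derive_eq D); rewrite /pot_integrand expr1 -[_ *: _]/(_ * _) mulrA.
  by rewrite [2 * _]mulrC mulfVK.
have := halfint_FTC d2 Fd (heat_pow_cvg0 x hl nl).
by rewrite -/(pot 1 (lap h) x) /F expr0 mulr1 heat0 => ->; ring.
Qed.

(** The recursion gives [c = (-1)^(k + 1) 2 4^k k!] times the Gaussian mass. Since [iter m lap h]
    has order 2 m, the exponent conditions of all steps reduce to [2 <= n]. *)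
Lemma pot_iter_lap k : exists2 c : R, c != 0 & forall h x, schwartz h -> (2 <= n)%N ->
  pot k.*2.+1 (iter k.+1 lap h) x = c * h x.
Proof.
elim: k => [|k [c c0 hc]].
  exists (- (2 * gauss_mass R n)); first by rewrite oppr_eq0 mulf_neq0// gt_eqF// gauss_mass_gt0.
  by move=> h x hS n2; apply: (@pot_lap1 0) => //; rewrite addn0.
exists (- (4 * k.+1%:R) * c).
  by rewrite mulf_neq0// oppr_eq0 mulf_neq0// pnatr_eq0.
move=> h x hS n2.
have hl m : sorder m.*2 (iter m lap h) by elim: m => //= m; exact: sorder_lap.
rewrite doubleS -mulrA -hc// iterS; apply: pot_lap (hl _) _.
by lia.
Qed.

End Potential.

(** * Polyharmonic functions vanishing at infinity *)

(** Adding the second-order expansions at t and - t cancels the first derivative, and both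
    increments are at most 0. *)
Lemma second_derivative_max (R : realType) (f df ddf : R -> R) (rho : R) :
  (forall s : R, is_derive s 1 f (df s)) -> (forall s : R, is_derive s 1 df (ddf s)) ->
  {for 0, continuous ddf} -> 0 < rho -> (forall t, `|t| <= rho -> f t <= f 0) -> ddf 0 <= 0.
Proof.
move=> fd dfd ddfc rho0 fmax; apply/ler_addgt0Pr => e e0; rewrite add0r.
have e20 : 0 < e / 2 by rewrite divr_gt0.
have [eta /= eta0 heta] : exists2 eta : R, 0 < eta & forall s, `|s| <= eta -> `|ddf s - ddf 0| <= e / 2.
  have /(@cvgrPdist_le _ _ _ _ (nbhs_filter _)) /(_ _ e20) := ddfc.
  move=> /nbhs_ballP[r /= r0 hr]; exists (r / 2); first by rewrite divr_gt0.
  move=> s sr; rewrite distrC; apply: (hr s); rewrite -ball_normE/= sub0r normrN (le_lt_trans sr)//.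
  by rewrite ltr_pdivrMr// ltr_pMr// ltr1n.
pose t := Num.min rho eta.
have t0 : 0 < t by rewrite lt_min rho0.
pose b := ddf 0.
have H u : `|u| = t -> `|f u - f 0 - u * df 0 - b / 2 * u ^+ 2| <= e / 2 * u ^+ 2.
  move=> ut.
  have d1 (s : R) : is_derive s 1 (fun s => f s - b / 2 * s ^+ 2) (df s - b * s).
    apply: (is_derive_eq (is_deriveB (fd s) (is_deriveZ (b / 2) (is_derive_pow 2 s)))).
    by rewrite -[_ *: _]/(_ * _) expr1 mulrA mulfVK.
  have d2 (s : R) : is_derive s 1 (fun s => df s - b * s) (ddf s - b).
    have D : is_derive s 1 (b \*: id) (b *: (1 : R)) by apply: is_deriveZ; exact: is_derive_id.
    by apply: (is_derive_eq (is_deriveB (dfd s) D)); rewrite [_ *: 1]mulr1.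
  have := taylor2_le d1 d2 (C := e / 2) (t := u); rewrite /= expr0n/= !mulr0 !subr0.
  have -> : f u - b / 2 * u ^+ 2 - f 0 - u * df 0 = f u - f 0 - u * df 0 - b / 2 * u ^+ 2 by ring.
  by apply=> s su; apply: heta; rewrite (le_trans su)// ut ge_min lexx orbT.
have tt : `|t| = t by rewrite gtr0_norm.
have tt' : `|- t| = t by rewrite normrN.
have tr : t <= rho by rewrite ge_min lexx.
have := fmax t; have := fmax (- t); rewrite tt tt' => /(_ tr) m1 /(_ tr) m2.
have := H _ tt; have := H _ tt'; rewrite !ler_norml sqrrN => /andP[h1 _] /andP[h2 _].
have : b * t ^+ 2 <= e * t ^+ 2 by lra.
by rewrite ler_pM2r ?exprn_gt0.
Qed.

(** * Maximum principle for harmonic functions *)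

Section Harmonic.
Context {R : realType} {n : nat}.
Implicit Types (w f g : 'rV[R]_n -> R) (x y : 'rV[R]_n) (i j : 'I_n) (s : seq 'I_n).

Lemma compact_ball_norm (rho : R) : compact [set y : 'rV[R]_n | `|y| <= rho].
Proof.
have -> : [set y : 'rV[R]_n | `|y| <= rho] = closed_ball_ Num.norm (0 : 'rV[R]_n) rho.
  by apply/seteqP; split => y; rewrite /closed_ball_/= sub0r normrN.
apply: bounded_closed_compact; last exact: closed_closed_ball_.
exists rho; split; first exact: num_real.
by move=> M rM y; rewrite /closed_ball_/= sub0r normrN => /le_trans; apply; exact: ltW.
Qed.

Definition vanishing w := forall e : R, 0 < e -> exists A : R, forall x, A < `|x| -> `|w x| <= e.

Definition sqnorm : 'rV[R]_n -> R := \sum_i xmul i (xmul i (cst 1)).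

Lemma sqnormE x : sqnorm x = \sum_i x 0 i ^+ 2.
Proof. by rewrite /sqnorm fct_sumE; apply: eq_bigr => i _; rewrite /xmul mulr1. Qed.

Lemma smooth0 : smooth (0 : 'rV[R]_n -> R).
Proof. exact: smooth_cst. Qed.

Lemma smooth_sum (I : Type) (r : seq I) (P : pred I) (F : I -> 'rV[R]_n -> R) :
  (forall k, P k -> smooth (F k)) -> smooth (\sum_(k <- r | P k) F k).
Proof. by move=> FS; apply: big_ind; [exact: smooth0|exact: smoothD|exact: FS]. Qed.

Lemma smooth_lap w : smooth w -> smooth (lap w).
Proof. by move=> ws; apply: smooth_sum => i _; do 2 apply: smooth_pd. Qed.

Lemma smooth_sqnorm : smooth sqnorm.
Proof. by apply: smooth_sum => i _; do 2 apply: smooth_xmul; exact: smooth_cst. Qed.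

Lemma pd_pd_sqnorm i : pd i (pd i sqnorm) = cst 2.
Proof.
have -> : pd i sqnorm = (fun x => 2 * x 0 i).
  apply/funext => x; apply: pd_val; apply: (is_derive_quadratic (C := 1)) => t _.
  rewrite !sqnormE (bigD1 i)//= [\sum_j x 0 j ^+ 2](bigD1 i)//=.
  under eq_bigr => j ji do rewrite !mxE (negbTE ji) andbF mulr0 addr0.
  rewrite !mxE !eqxx mul1r mulr1 [X in `|X|](_ : _ = t ^+ 2); last by ring.
  by rewrite ger0_norm// sqr_ge0.
apply/funext => x; apply: pd_val; apply: (is_derive_quadratic (C := 0)) => t _.
rewrite !mxE !eqxx mulr1 mul0r [X in `|X|](_ : _ = 0) ?normr0//; ring.
Qed.

(** If w were positive somewhere, then w plus a small multiple e of [|x| ^ 2] would have an interior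
    maximum on a large ball; its second derivatives there are at most 0, although its Laplacian is
    [2 n e > 0]. *)
Lemma harmonic_vanishing_le0 w x : (0 < n)%N -> smooth w -> lap w = 0 -> vanishing w -> w x <= 0.
Proof.
move=> n0 ws hw wv; rewrite leNgt; apply/negP => a0.
set a := w x in a0; have a20 : 0 < a / 2 by rewrite divr_gt0.
have [A hA] := wv _ a20.
pose rho := Num.max A `|x| + 1.
have Ar : A < rho by rewrite ltr_pwDr// le_max lexx.
have xr : `|x| < rho by rewrite ltr_pwDr// le_max lexx orbT.
have rho0 : 0 < rho by exact: le_lt_trans xr.
(* N exceeds [sqnorm] on the ball, so the perturbation stays below a / 2 there. On the boundary w is
   at most a / 2 as well, which excludes a maximum with value at least a. *)
pose N : R := n%:R * rho ^+ 2 + 1.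
have N0 : 0 < N by rewrite ltr_wpDl// mulr_ge0// sqr_ge0.
pose e := a / 2 / N.
have e0 : 0 < e by rewrite divr_gt0.
pose phi := w + e *: sqnorm.
have phis : smooth phi by apply: smoothD ws _; apply: smoothZ; exact: smooth_sqnorm.
have ne : [set y : 'rV[R]_n | `|y| <= rho] !=set0 by exists x; exact: ltW.
have cw : {within [set y : 'rV[R]_n | `|y| <= rho], continuous phi}.
  by apply: continuous_subspaceT => y; exact: smooth_continuous.
have [c + cmax] := EVT_max_rV ne (@compact_ball_norm rho) cw.
rewrite inE/= => cr.
have sq_ge0 y : 0 <= sqnorm y by rewrite sqnormE; apply: sumr_ge0 => i _; exact: sqr_ge0.
have sq_le y : `|y| <= rho -> e * sqnorm y < a / 2.
  move=> yr; rewrite mulrC -ltr_pdivlMr// /e invf_div mulrCA mulfV ?gt_eqF// mulr1.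
  rewrite sqnormE (@le_lt_trans _ _ (\sum_(i < n) rho ^+ 2))//.
    apply: ler_sum => i _; rewrite -[leLHS]real_normK ?num_real// lerXn2r ?nnegrE ?(ltW rho0)//.
    by apply: le_trans yr; exact: coord_le_norm.
  by rewrite sumr_const card_ord -mulr_natl ltrDl.
have phiE y : phi y = w y + e * sqnorm y by [].
have ac : a <= phi c.
  have := cmax x; rewrite inE/= => /(_ (ltW xr)); apply: le_trans.
  by rewrite phiE lerDl mulr_ge0// ltW.
have cr' : `|c| < rho.
  rewrite lt_neqAle cr andbT; apply/eqP => ce.
  have : `|w c| <= a / 2 by apply: hA; rewrite ce.
  by move=> /(le_trans (ler_norm _)); have := sq_le _ cr; rewrite phiE in ac; lra.
have H i : pd i (pd i phi) c <= 0.
  have ps := smooth_pd i phis.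
  have dphi (s : R) : derivable phi (c + s *: 'e_i) 'e_i by exact: smooth_derivable.
  have ddphi (s : R) : derivable (pd i phi) (c + s *: 'e_i) 'e_i by exact: smooth_derivable.
  have := @second_derivative_max R (fun s : R => phi (c + s *: 'e_i)) (fun s : R => pd i phi (c + s *: 'e_i))
    (fun s : R => pd i (pd i phi) (c + s *: 'e_i)) (rho - `|c|)
    (fun s : R => is_derive_line (dphi s)) (fun s : R => is_derive_line (ddphi s)).
  rewrite scale0r addr0; apply; rewrite ?subr_gt0//.
    have pps := smooth_pd i (smooth_pd i ps).
    apply: (@is_derive_continuous _ _ (fun s : R => pd i (pd i (pd i phi)) (c + s *: 'e_i))) => s.
    by apply: is_derive_line; apply: smooth_derivable; exact: smooth_pd.
  move=> t tr; apply: cmax; rewrite inE/= (le_trans (ler_normD _ _))// -lerBrDl.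
  by rewrite (le_trans _ tr)// normrZ ler_piMr// norm_delta_le.
have ss := smooth_sqnorm.
have E i : pd i (pd i phi) c = pd i (pd i w) c + e * 2.
  rewrite /phi pdD; [|by move=> y; exact: smooth_derivable|move=> y; apply: smooth_derivable; exact: smoothZ].
  rewrite pdZ; last by move=> y; exact: smooth_derivable.
  have s1 := smooth_pd i ws; have s2 := smooth_pd i ss.
  rewrite pdD; [|by move=> y; exact: smooth_derivable|move=> y; apply: smooth_derivable; exact: smoothZ].
  rewrite pdZ; last by move=> y; exact: smooth_derivable.
  by rewrite pd_pd_sqnorm.
have : \sum_i pd i (pd i phi) c <= 0 by apply: sumr_le0.
under eq_bigr => i _ do rewrite E.
rewrite big_split/= sumr_const card_ord.
have -> : \sum_i pd i (pd i w) c = 0 by have : lap w c = 0 by [rewrite hw]; rewrite /lap fct_sumE.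
by rewrite add0r; apply/negP; rewrite -ltNge pmulrn_lgt0// mulr_gt0.
Qed.

Lemma vanishingD f g : vanishing f -> vanishing g -> vanishing (f + g).
Proof.
move=> fv gv e e0; have e20 : 0 < e / 2 by rewrite divr_gt0.
have [A hA] := fv _ e20; have [B hB] := gv _ e20; exists (Num.max A B) => x.
rewrite gt_max => /andP[xA xB]; rewrite [e]splitr (le_trans (ler_normD _ _))//.
by rewrite lerD ?hA ?hB.
Qed.

Lemma vanishingN f : vanishing f -> vanishing (- f).
Proof. by move=> fv e /fv[A hA]; exists A => x; rewrite normrN; exact: hA. Qed.

Lemma vanishing0 : vanishing (0 : 'rV[R]_n -> R).
Proof. by move=> e e0; exists 0 => x _; rewrite normr0 ltW. Qed.

Lemma vanishing_sum (F : 'I_n -> 'rV[R]_n -> R) :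
  (forall i, vanishing (F i)) -> vanishing (\sum_i F i).
Proof. by move=> Fv; apply: big_ind => //; [exact: vanishing0|exact: vanishingD]. Qed.

Lemma harmonic_vanishing w : (0 < n)%N -> smooth w -> lap w = 0 -> vanishing w -> w = 0.
Proof.
move=> n0 ws hw wv; apply/funext => x; apply/eqP; rewrite eq_le harmonic_vanishing_le0//=.
have ns : smooth (- w) by rewrite -scaleN1r; exact: smoothZ.
have hn : lap (- w) = 0.
  have <- : - lap w = 0 by rewrite hw oppr0.
  rewrite /lap -sumrN; apply: eq_bigr => i _.
  have wd (y : 'rV[R]_n) : derivable w y 'e_i by exact: smooth_derivable.
  have pwd (y : 'rV[R]_n) : derivable (pd i w) y 'e_i.
    by apply: smooth_derivable; exact: smooth_pd.
  by rewrite -[- w]scaleN1r (pdZ _ wd) (pdZ _ pwd) scaleN1r.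
have := harmonic_vanishing_le0 x n0 ns hn (vanishingN wv).
by rewrite -[(- w) x]/(- w x) oppr_le0.
Qed.

End Harmonic.

(** * Integrals over the unit segment *)

Section UnitSegment.
Context {R : realType}.
Implicit Types (f g F : R -> R).
Local Notation mu := (@lebesgue_measure R).

Definition segint f : R := \int[mu]_(t in `[0, 1]) f t.

Lemma segint_integrable f : continuous f -> mu.-integrable `[0, 1] (EFin \o f).
Proof.
move=> fc; apply: continuous_compact_integrable; first exact: segment_compact.
exact: continuous_subspaceT.
Qed.

Lemma segintD f g : continuous f -> continuous g -> segint (f + g) = segint f + segint g.
Proof. by move=> fc gc; apply: RintegralD => //; exact: segint_integrable. Qed.

Lemma segintZ (c : R) f : continuous f -> segint (c *: f) = c * segint f.
Proof. by move=> fc; apply: RintegralZl => //; exact: segint_integrable. Qed.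

Lemma segint_norm_le f (C : R) : continuous f -> (forall t, 0 <= t <= 1 -> `|f t| <= C) ->
  `|segint f| <= C.
Proof.
move=> fc fC; apply: (le_trans (le_normr_Rintegral _ (segint_integrable fc))) => //.
have nc : continuous (fun t => `|f t|).
  by move=> t; apply: (continuous_comp (f := f)); [exact: fc|exact: norm_continuous].
have cc : continuous (cst C : R -> R) by move=> t; exact: cvg_cst.
apply: (@le_trans _ _ (segint (cst C))).
  by apply: le_Rintegral (segint_integrable nc) (segint_integrable cc) _ => // t; rewrite /= in_itv/=; exact: fC.
rewrite /segint Rintegral_cst// [X in fine X](_ : _ = 1%E) ?mulr1//.
by have := @lebesgue_measure_itv R `[0, 1]; rewrite /= lte_fin ltr01 oppr0 adde0.
Qed.

Lemma segint_FTC f F : continuous f -> (forall t : R, is_derive t 1 F (f t)) ->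
  segint f = F 1 - F 0.
Proof.
move=> fc Fd; have Fd' (t : R) : derivable F t 1 by case: (Fd t).
have Fc : continuous F := is_derive_continuous Fd.
rewrite /segint /Rintegral (continuous_FTC2 (F := F))//.
- exact: continuous_subspaceT.
- split=> [t _|| ] //; apply: cvg_at_right_filter || apply: cvg_at_left_filter; exact: Fc.
- by move=> t _; rewrite derive1E; case: (Fd t).
Qed.

End UnitSegment.

(** * Averages over unit segments and the Liouville theorem *)

Section Polyharmonic.
Context {R : realType} {n : nat}.
Implicit Types (w f g : 'rV[R]_n -> R) (x y : 'rV[R]_n) (i j : 'I_n) (s : seq 'I_n).

Lemma continuous_bounded_ball f (rho : R) : continuous f ->
  exists2 C : R, 0 <= C & forall y, `|y| <= rho -> `|f y| <= C.
Proof.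
move=> fc; have nc : continuous (fun y => `|f y|).
  by move=> y; apply: (continuous_comp (f := f)); [exact: fc|exact: norm_continuous].
have [r0|r0] := lerP 0 rho; last first.
  by exists 0 => // y yr; have := le_lt_trans (normr_ge0 y) (le_lt_trans yr r0); rewrite ltxx.
have ne : [set y : 'rV[R]_n | `|y| <= rho] !=set0 by exists 0; rewrite /= normr0.
have cw : {within [set y : 'rV[R]_n | `|y| <= rho], continuous (fun y => `|f y|)}.
  exact: continuous_subspaceT.
have [c _ cmax] := EVT_max_rV ne (@compact_ball_norm _ _ rho) cw.
by exists `|f c| => // y yr; apply: cmax; rewrite inE.
Qed.

Definition segavg i w : 'rV[R]_n -> R := fun x => segint (fun t => w (x + t *: 'e_i)).

Lemma smooth_line_continuous w x i : smooth w -> continuous (fun t : R => w (x + t *: 'e_i)).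
Proof. by move=> ws; apply: is_derive_continuous => t; exact: is_derive_tempered_line. Qed.

Arguments smooth_line_continuous [w] x i.

Lemma norm_line_le x i (t : R) : `|t| <= 1 -> `|x + t *: 'e_i| <= `|x| + 1.
Proof.
move=> t1; rewrite (le_trans (ler_normD _ _))// lerD2l normrZ mulr_ile1//.
exact: norm_delta_le.
Qed.

Lemma is_derive_segavg i j w x : smooth w -> is_derive x 'e_j (segavg i w) (segavg i (pd j w) x).
Proof.
move=> ws; have ws1 := smooth_pd j ws; have ws2 := smooth_pd j ws1.
(* One unit of radius for the segment, one for the increment. *)
have [C C0 hC] := continuous_bounded_ball (`|x| + 1 + 1) (smooth_continuous ws2).
apply: (is_derive_quadratic (C := C)) => e e1.
have c1 := smooth_line_continuous (x + e *: 'e_j) i ws.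
have c2 := smooth_line_continuous x i ws; have c3 := smooth_line_continuous x i ws1.
have cZ (a : R) (f : R -> R) : continuous f -> continuous (a *: f).
  by move=> fc t; apply: (@cvgM _ _ (nbhs t) _ (cst a) f); [exact: cvg_cst|exact: fc].
have cD (f g : R -> R) : continuous f -> continuous g -> continuous (f + g).
  by move=> fc gc t; apply: cvgD; [exact: fc|exact: gc].
pose f1 t := w (x + e *: 'e_j + t *: 'e_i); pose f2 t := w (x + t *: 'e_i).
pose f3 t := pd j w (x + t *: 'e_i).
have -> : segavg i w (x + e *: 'e_j) - segavg i w x - e * segavg i (pd j w) x =
    segint (f1 + (-1) *: f2 + (- e) *: f3).
  rewrite (segintD (cD _ _ c1 (cZ (-1) _ c2)) (cZ (- e) _ c3)) (segintD c1 (cZ (-1) _ c2)).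
  by rewrite (segintZ _ c2) (segintZ _ c3) mulN1r mulNr.
apply: segint_norm_le.
  by apply: (cD _ _ (cD _ _ c1 (cZ _ _ c2)) (cZ _ _ c3)).
move=> t /andP[t0 t1].
have -> : (f1 + (-1) *: f2 + (- e) *: f3) t = w (x + t *: 'e_i + e *: 'e_j) - w (x + t *: 'e_i) - e * pd j w (x + t *: 'e_i).
  by rewrite !fctE -[-1 *: _]/(-1 * _) -[- e *: _]/(- e * _) mulN1r mulNr /f1 [x + _ + _]addrAC.
apply: smooth_taylor => // u ue; apply: hC.
rewrite (le_trans (norm_line_le _ _ _)) ?(le_trans ue)// lerD2r norm_line_le//.
by rewrite ger0_norm.
Qed.

Lemma pd_segavg i j w : smooth w -> pd j (segavg i w) = segavg i (pd j w).
Proof. by move=> ws; apply/funext => x; exact: pd_val (is_derive_segavg i j x ws). Qed.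

Lemma segavg_bounded i w x (C : R) : smooth w -> (forall y, `|y| <= `|x| + 1 -> `|w y| <= C) ->
  `|segavg i w x| <= C.
Proof.
move=> ws wC; apply: segint_norm_le; first exact: smooth_line_continuous.
by move=> t /andP[t0 t1]; apply: wC; rewrite norm_line_le// ger0_norm.
Qed.

Lemma smooth_segavg i w : smooth w -> smooth (segavg i w).
Proof.
move=> ws; have dv f y j : smooth f -> derivable (segavg i f) y 'e_j.
  by move=> fs; have [] := is_derive_segavg i j y fs.
have pE s : partials s (segavg i w) = segavg i (partials s w).
  elim: s => [//|j s IH] /=; rewrite IH -[LHS]/(pd j _) pd_segavg//.
  exact: smooth_partials.
move=> s; rewrite pE; have ss := smooth_partials s ws; split=> [x|j x]; last exact: dv.
have /choice[C hC] j : exists C : R, 0 <= C /\ forall y, `|y| <= `|x| + 1 + 1 -> `|pd j (partials s w) y| <= C.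
  have [C C0 hC] := continuous_bounded_ball (`|x| + 1 + 1) (smooth_continuous (smooth_pd j ss)).
  by exists C.
apply: (@bounded_partials_continuous _ _ _ _ (\sum_j C j) 1) => // [y j|y j yx]; first exact: dv.
rewrite -[X in `|X|]/(pd j (segavg i _) y) pd_segavg//.
apply: (@le_trans _ _ (C j)).
  apply: segavg_bounded; first exact: smooth_pd.
  move=> z zy; apply: (hC j).2; rewrite (le_trans zy)// lerD2r.
  by rewrite -[y](subrK x) addrC (le_trans (ler_normD _ _))// lerD2l.
by rewrite (bigD1 j)//= lerDl; apply: sumr_ge0 => k _; exact: (hC k).1.
Qed.

Definition shiftdiff i w : 'rV[R]_n -> R := fun x => w (x + 'e_i) - w x.

(** This is what removes derivatives: a unit difference of a vanishing function vanishes at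
    infinity, while nothing is known about its derivatives. *)
Lemma pd_segavg_self i w : smooth w -> pd i (segavg i w) = shiftdiff i w.
Proof.
move=> ws; rewrite pd_segavg//; apply/funext => x; rewrite /segavg.
have d (t : R) := is_derive_tempered_line x i t ws.
have c := smooth_line_continuous x i (smooth_pd i ws).
by rewrite (segint_FTC c d) scale1r scale0r addr0.
Qed.

Lemma vanishing_segavg i w : smooth w -> vanishing w -> vanishing (segavg i w).
Proof.
move=> ws wv e /wv[A hA]; exists (A + 1) => x xA.
apply: segint_norm_le; first exact: smooth_line_continuous.
move=> t /andP[t0 t1]; apply: hA.
have := norm_line_le (x + t *: 'e_i) i (t := - t); rewrite normrN ger0_norm// => /(_ t1).
by rewrite scaleNr addrK => h; lra.
Qed.

Lemma vanishing_shiftdiff i w : vanishing w -> vanishing (shiftdiff i w).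
Proof.
move=> wv e e0; have e20 : 0 < e / 2 by rewrite divr_gt0.
have [A hA] := wv _ e20; exists (A + 1) => x xA.
rewrite [e]splitr (le_trans (ler_normB _ _))// lerD ?hA//; last by rewrite (lt_trans _ xA)// ltrDl.
have := norm_line_le (x + 'e_i) i (t := -1); rewrite normrN normr1 => /(_ (lexx _)).
by rewrite scaleN1r addrK => h; lra.
Qed.

(* If the average vanishes then [w] is periodic in the direction [e_i]. *)
Lemma segavg_inj i w : smooth w -> vanishing w -> segavg i w = 0 -> w = 0.
Proof.
move=> ws wv S0; apply/funext => x.
have sd y : w (y + 'e_i) = w y.
  have := pd_segavg_self i ws; rewrite S0 => /(congr1 (fun f => f y)).
  by rewrite [LHS](congr1 (fun f => f y) (pd_cst 0 i)) => /esym/eqP; rewrite subr_eq0 => /eqP.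
have sN N : w (x + N%:R *: 'e_i) = w x.
  elim: N => [|N IH]; first by rewrite scale0r addr0.
  by rewrite -natr1 scalerDl scale1r addrA sd.
apply/eqP; rewrite -normr_le0; apply/ler_addgt0Pr => e /wv[A hA]; rewrite add0r.
pose N := Num.trunc (`|A| + `|x|).
have AN : `|A| + `|x| < N.+1%:R by rewrite truncnS_gt.
rewrite -(sN N.+1); apply: hA.
apply: (@lt_le_trans _ _ `|(x + N.+1%:R *: 'e_i) 0 i|); last exact: coord_le_norm.
rewrite !mxE !eqxx mulr1; have := ler_norm A; have := coord_le_norm x i.
rewrite ler_norml => /andP[h1 _] h2; have := ler_norm (x 0 i + N.+1%:R); lra.
Qed.

Definition segavgs2 s w := foldr (fun i f => segavg i (segavg i f)) w s.

Lemma smooth_segavgs2 s w : smooth w -> smooth (segavgs2 s w).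
Proof.
move=> ws; elim: s => [|i s IH]; first exact: ws.
exact: smooth_segavg (smooth_segavg i IH).
Qed.

Lemma vanishing_segavgs2 s w : smooth w -> vanishing w -> vanishing (segavgs2 s w).
Proof.
move=> ws wv; elim: s => //= i s IH; have ss := smooth_segavgs2 s ws.
exact: (vanishing_segavg i (smooth_segavg i ss) (vanishing_segavg i ss IH)).
Qed.

Lemma segavgs2_inj s w : smooth w -> vanishing w -> segavgs2 s w = 0 -> w = 0.
Proof.
move=> ws wv; elim: s => //= i s IH; have ss := smooth_segavgs2 s ws.
have sv := vanishing_segavgs2 s ws wv.
move=> H; apply: IH; apply: (segavg_inj ss sv).
exact: segavg_inj (smooth_segavg i ss) (vanishing_segavg i ss sv) H.
Qed.

Lemma pd_segavgs2 s j w : smooth w -> pd j (segavgs2 s w) = segavgs2 s (pd j w).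
Proof.
move=> ws; elim: s => //= i s <-; have ss := smooth_segavgs2 s ws.
by rewrite (pd_segavg _ _ (smooth_segavg i ss)) (pd_segavg _ _ ss).
Qed.

(** The two averages in direction i absorb the two derivatives; the averages in other directions
    commute with [pd i] and preserve vanishing. *)
Lemma vanishing_pd2_segavgs2 s i w : smooth w -> vanishing w -> i \in s ->
  vanishing (pd i (pd i (segavgs2 s w))).
Proof.
move=> ws wv; elim: s => //= j s IH; rewrite inE.
have ss := smooth_segavgs2 s ws; have sv := vanishing_segavgs2 s ws wv.
have s1 k := smooth_segavg k ss.
case: eqVneq => [->|ij] /= => [_|/IH H].
  have ds : smooth (shiftdiff j (segavgs2 s w)).
    by rewrite -(pd_segavg_self j ss); exact: smooth_pd (s1 j).
  rewrite (pd_segavg j j (s1 j)) (pd_segavg_self j ss) (pd_segavg_self j ds).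
  by do 2 apply: vanishing_shiftdiff.
have p1 := smooth_pd i ss; have p2 := smooth_pd i p1.
have -> : pd i (pd i (segavg j (segavg j (segavgs2 s w)))) =
    segavg j (segavg j (pd i (pd i (segavgs2 s w)))).
  rewrite (pd_segavg j i (s1 j)) (pd_segavg j i ss).
  by rewrite (pd_segavg j i (smooth_segavg j p1)) (pd_segavg j i p1).
exact: (vanishing_segavg j (smooth_segavg j p2) (vanishing_segavg j p2 H)).
Qed.

Lemma segavgD i f g : smooth f -> smooth g -> segavg i (f + g) = segavg i f + segavg i g.
Proof.
move=> fs gs; apply/funext => x; rewrite /segavg.
by rewrite -[RHS]segintD//; exact: smooth_line_continuous.
Qed.

Lemma segavg0 i : segavg i (0 : 'rV[R]_n -> R) = 0.
Proof.
apply/funext => x; have s0 : smooth (0 : 'rV[R]_n -> R) by exact: smooth0.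
have := segavgD i s0 s0; rewrite addr0 => /(congr1 (fun f => f x)).
by rewrite -[RHS]/(segavg i 0 x + segavg i 0 x) => /eqP; rewrite -subr_eq0 opprD addNKr oppr_eq0 => /eqP.
Qed.

Lemma segavgs2D s f g : smooth f -> smooth g ->
  segavgs2 s (f + g) = segavgs2 s f + segavgs2 s g.
Proof.
move=> fs gs; elim: s => //= i s ->.
have sf := smooth_segavgs2 s fs; have sg := smooth_segavgs2 s gs.
by rewrite (segavgD i sf sg) (segavgD i (smooth_segavg i sf) (smooth_segavg i sg)).
Qed.

Lemma segavgs20 s : segavgs2 s (0 : 'rV[R]_n -> R) = 0.
Proof. by elim: s => //= i s ->; rewrite !segavg0. Qed.

Lemma lap_segavgs2 s w : smooth w -> lap (segavgs2 s w) = segavgs2 s (lap w).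
Proof.
move=> ws; pose P (f g : 'rV[R]_n -> R) := smooth f /\ segavgs2 s f = g.
suff [] : P (lap w) (lap (segavgs2 s w)) by [].
apply: big_ind2 => [|f g f' g' [fs <-] [fs' <-]|i _].
- by split; [exact: smooth0|exact: segavgs20].
- by split; [exact: smoothD|exact: segavgs2D].
have s1 := smooth_pd i ws; split; first exact: smooth_pd.
by rewrite (pd_segavgs2 _ _ ws) (pd_segavgs2 _ _ s1).
Qed.

(* Averaging [w] twice over unit segments in every direction turns second derivatives into finite
   differences, so that the Laplacian of the average vanishes at infinity. *)
Lemma polyharmonic_vanishing M w : (0 < n)%N -> smooth w -> vanishing w ->
  iter M lap w = 0 -> w = 0.
Proof.
move=> n0; elim: M w => // M IH w ws wv H.
pose v := segavgs2 (enum 'I_n) w.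
have vs : smooth v by exact: smooth_segavgs2.
have lv : vanishing (lap v).
  apply: vanishing_sum => i; apply: (vanishing_pd2_segavgs2 ws wv).
  by rewrite mem_enum.
(* Injectivity of the averages reduces w = 0 to v = 0, the harmonic case reduces that to
   [lap v = 0], and the induction hypothesis for [lap v] closes the chain. *)
apply: (segavgs2_inj (s := enum 'I_n) ws wv).
apply: (harmonic_vanishing n0 vs _ (vanishing_segavgs2 _ ws wv)).
apply: (IH _ (smooth_lap vs) lv).
have E m f : smooth f -> smooth (iter m lap f) /\
    iter m lap (segavgs2 (enum 'I_n) f) = segavgs2 (enum 'I_n) (iter m lap f).
  move=> fs; elim: m => [|m [ms IHm]] /=; first by split; [exact: fs|].
  rewrite IHm; split; first exact: smooth_lap.
  exact: lap_segavgs2.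
by rewrite -iterSr (E _ _ ws).2 H segavgs20.
Qed.

End Polyharmonic.

(** * Symmetric tensors over a module with commuting derivations *)

Section TensorAlgebra.
Context {R : numFieldType} {n : nat} {V : lmodType R}.
Variable pa : 'I_n -> {linear V -> V}.
Hypothesis paC : forall i j v, pa i (pa j v) = pa j (pa i v).
Local Notation T p := {ffun p.-tuple 'I_n -> V}.

Definition tdel p (I : p.+1.-tuple 'I_n) (l : 'I_p.+1) : p.-tuple 'I_n := [tuple tnth I (lift l j) | j < p].

(* Unnormalized: on symmetric tensors of rank [p] this is [p + 1] times the inner derivative. *)
Definition tgrad p (U : T p) : T p.+1 :=
  [ffun I : p.+1.-tuple 'I_n => \sum_l pa (tnth I l) (U (tdel I l))].

Definition tdiv p (U : T p.+1) : T p := [ffun I : p.-tuple 'I_n => \sum_j pa j (U [tuple of rcons I j])].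

Definition vlap (v : V) : V := \sum_i pa i (pa i v).

Definition tlap p (U : T p) : T p := [ffun I => vlap (U I)].

(** Symmetry through [perm_eq] of index lists, so that symmetry arguments become comparisons of
    multisets of indices. *)
Definition tsym p (U : T p) : Prop := forall I J : p.-tuple 'I_n, perm_eq I J -> U I = U J.

Lemma perm_tdel p (I : p.+1.-tuple 'I_n) l : perm_eq (tnth I l :: tdel I l) I.
Proof.
have -> : tnth I l :: tdel I l = [seq tnth I j | j <- l :: [seq lift l j | j <- enum 'I_p]].
  by rewrite /= -map_comp.
rewrite -[X in perm_eq _ X]map_tnth_enum; apply: perm_map; apply: uniq_perm.
- rewrite /= map_inj_uniq ?enum_uniq ?andbT; last exact: lift_inj.
  by apply/mapP => -[j _ /eqP]; rewrite (negbTE (neq_lift _ _)).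
- exact: enum_uniq.
move=> j; rewrite mem_enum inE; apply/orP; case: (unliftP l j) => [k ->|->]; last by left.
by right; apply: map_f; rewrite mem_enum.
Qed.

Lemma vlapD u v : vlap (u + v) = vlap u + vlap v.
Proof. by rewrite /vlap -big_split; apply: eq_bigr => i _; rewrite !linearD. Qed.

Lemma vlapZ c v : vlap (c *: v) = c *: vlap v.
Proof. by rewrite /vlap scaler_sumr; apply: eq_bigr => i _; rewrite !linearZ. Qed.

Lemma tgradD p (U W : T p) : tgrad (U + W) = tgrad U + tgrad W.
Proof.
apply/ffunP => I; rewrite !ffunE -big_split; apply: eq_bigr => l _.
by rewrite ffunE linearD.
Qed.

Lemma tgradZ p c (U : T p) : tgrad (c *: U) = c *: tgrad U.
Proof.
apply/ffunP => I; rewrite !ffunE scaler_sumr; apply: eq_bigr => l _.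
by rewrite ffunE linearZ.
Qed.

Lemma tdivD p (U W : T p.+1) : tdiv (U + W) = tdiv U + tdiv W.
Proof.
apply/ffunP => I; rewrite !ffunE -big_split; apply: eq_bigr => l _.
by rewrite ffunE linearD.
Qed.

Lemma tdivZ p c (U : T p.+1) : tdiv (c *: U) = c *: tdiv U.
Proof.
apply/ffunP => I; rewrite !ffunE scaler_sumr; apply: eq_bigr => l _.
by rewrite ffunE linearZ.
Qed.

Lemma tlapD p (U W : T p) : tlap (U + W) = tlap U + tlap W.
Proof. by apply/ffunP => I; rewrite !ffunE vlapD. Qed.

Lemma tlapZ p c (U : T p) : tlap (c *: U) = c *: tlap U.
Proof. by apply/ffunP => I; rewrite !ffunE vlapZ. Qed.

Lemma tlap_grad p (U : T p) : tlap (tgrad U) = tgrad (tlap U).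
Proof.
apply/ffunP => I; rewrite !ffunE /vlap.
under [RHS]eq_bigr => l _ do rewrite ffunE /vlap linear_sum.
rewrite exchange_big; apply: eq_bigr => i _; rewrite !linear_sum; apply: eq_bigr => l _.
by rewrite (paC i) (paC i).
Qed.

Lemma tlap_div p (U : T p.+1) : tlap (tdiv U) = tdiv (tlap U).
Proof.
apply/ffunP => I; rewrite !ffunE /vlap.
under [RHS]eq_bigr => l _ do rewrite ffunE /vlap linear_sum.
rewrite exchange_big; apply: eq_bigr => i _; rewrite !linear_sum; apply: eq_bigr => l _.
by rewrite (paC i) (paC i).
Qed.

Lemma tsymD p (U W : T p) : tsym U -> tsym W -> tsym (U + W).
Proof. by move=> Us Ws I J IJ; rewrite !ffunE (Us _ _ IJ) (Ws _ _ IJ). Qed.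

Lemma tsymZ p c (U : T p) : tsym U -> tsym (c *: U).
Proof. by move=> Us I J IJ; rewrite !ffunE (Us _ _ IJ). Qed.

Lemma tsym_lap p (U : T p) : tsym U -> tsym (tlap U).
Proof. by move=> Us I J IJ; rewrite !ffunE (Us _ _ IJ). Qed.

Lemma tsym_div p (U : T p.+1) : tsym U -> tsym (tdiv U).
Proof.
move=> Us I J IJ; rewrite !ffunE; apply: eq_bigr => j _; congr (pa j _); apply: Us.
by rewrite /= perm_rcons perm_sym perm_rcons perm_cons perm_sym.
Qed.

Lemma tsym_grad p (U : T p) : tsym U -> tsym (tgrad U).
Proof.
move=> Us I J IJ; have /tuple_permP[s Is] := IJ.
rewrite !ffunE [RHS](reindex_inj (@perm_inj _ s)) /=.
have tI l : tnth I l = tnth J (s l).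
  have -> : I = [tuple tnth J (s i) | i < p.+1] by apply: val_inj.
  by rewrite tnth_mktuple.
apply: eq_bigr => l _; rewrite tI; congr (pa _ _); apply: Us.
rewrite -(perm_cons (tnth J (s l))) -{1}tI (perm_trans (perm_tdel I l))// perm_sym.
by rewrite (perm_trans (perm_tdel J (s l)))// perm_sym.
Qed.

(** Rank 0 has no divergence; the value 0 keeps [tdiv_grad] true there. *)
Definition tgraddiv p : T p -> T p := match p with 0 => fun=> 0 | p'.+1 => fun U => tgrad (tdiv U) end.

Lemma tgraddivS p (U : T p.+1) : tgraddiv U = tgrad (tdiv U).
Proof. by []. Qed.

Lemma tlap_graddiv p (U : T p) : tlap (tgraddiv U) = tgraddiv (tlap U).
Proof.
case: p U => [|p] U /=; last by rewrite tlap_grad tlap_div.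
by apply/ffunP => I; rewrite !ffunE /vlap big1// => i _; rewrite !linear0.
Qed.

Lemma tsym0 p : tsym (0 : T p).
Proof. by move=> I J _; rewrite !ffunE. Qed.

Lemma tsym_graddiv p (U : T p) : tsym U -> tsym (tgraddiv U).
Proof. by case: p U => [|p] U Us; [exact: tsym0|exact/tsym_grad/tsym_div]. Qed.

(** In [tgrad U] at [rcons J j] the differentiating index is either the appended j, which gives the
    Laplacian after summation over j, or an entry of J, which gives [tgraddiv]. *)
Lemma tdiv_grad p (U : T p) : tsym U -> tdiv (tgrad U) = tlap U + tgraddiv U.
Proof.
move=> Us; apply/ffunP => J; rewrite !ffunE.
have E j : tgrad U [tuple of rcons J j] =
    pa j (U J) + \sum_(l < p) pa (tnth J l) (U (tdel [tuple of rcons J j] (widen_ord (leqnSn p) l))).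
  have tmax : tnth [tuple of rcons J j] ord_max = j.
    by rewrite (tnth_nth j)/= nth_rcons size_tuple ltnn eqxx.
  rewrite ffunE big_ord_recr /= addrC; congr (_ + _).
    rewrite tmax; congr (pa _ _); apply: Us.
    rewrite -(perm_cons j) -{1}tmax (perm_trans (perm_tdel _ _))//=.
    by rewrite perm_rcons.
  apply: eq_bigr => l _; congr (pa _ _).
  by rewrite !(tnth_nth j)/= nth_rcons size_tuple ltn_ord.
under eq_bigr => j _ do rewrite E linearD.
rewrite big_split /=; congr (_ + _).
case: p U Us J E => [|p] U Us J E /=.
  by rewrite ffunE big1// => j _; rewrite big_ord0 linear0.
rewrite ffunE.
under [RHS]eq_bigr => l _ do rewrite ffunE linear_sum.
rewrite exchange_big; apply: eq_bigr => j _; rewrite linear_sum; apply: eq_bigr => l _.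
rewrite paC; congr (pa _ (pa _ _)); apply: Us.
have tl : tnth [tuple of rcons J j] (widen_ord (leqnSn p.+1) l) = tnth J l.
  by rewrite !(tnth_nth j)/= nth_rcons size_tuple ltn_ord.
rewrite -(perm_cons (tnth J l)) -{1}tl (perm_trans (perm_tdel _ _))//= perm_sym.
rewrite -rcons_cons perm_rcons perm_sym perm_rcons perm_cons perm_sym; exact: perm_tdel.
Qed.

Definition tlapn m p (U : T p) : T p := iter m (@tlap p) U.

Lemma tlapnD m p (U W : T p) : tlapn m (U + W) = tlapn m U + tlapn m W.
Proof. by elim: m => //= m ->; rewrite tlapD. Qed.

Lemma tlapnZ m p c (U : T p) : tlapn m (c *: U) = c *: tlapn m U.
Proof. by elim: m => //= m ->; rewrite tlapZ. Qed.

Lemma tlapn_grad m p (U : T p) : tlapn m (tgrad U) = tgrad (tlapn m U).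
Proof. by elim: m => //= m ->; rewrite tlap_grad. Qed.

Lemma tlapn_div m p (U : T p.+1) : tlapn m (tdiv U) = tdiv (tlapn m U).
Proof. by elim: m => //= m ->; rewrite tlap_div. Qed.

Lemma tlapn_graddiv m p (U : T p) : tlapn m (tgraddiv U) = tgraddiv (tlapn m U).
Proof. by elim: m => //= m ->; rewrite tlap_graddiv. Qed.

Lemma tlapn_lap m p (U : T p) : tlapn m (tlap U) = tlap (tlapn m U).
Proof. by rewrite /tlapn -iterSr. Qed.

Lemma tlapn_add m m' p (U : T p) : tlapn (m + m') U = tlapn m (tlapn m' U).
Proof. exact: iterD. Qed.

Lemma tsym_lapn m p (U : T p) : tsym U -> tsym (tlapn m U).
Proof. by move=> Us; elim: m => //= m; exact: tsym_lap. Qed.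

(** Rising factorial [c (c + 1) ... (c + p)], with p + 1 factors. *)
Fixpoint rfact p (c : R) : R := if p is p'.+1 then c * rfact p' (c + 1) else c.

Lemma rfact_gt0 p c : 0 < c -> 0 < rfact p c.
Proof. by elim: p c => //= p IH c c0; rewrite mulr_gt0// IH// addr_gt0. Qed.

(* The resolvent identity [(a D + c q)^-1 = (c q)^-1 (1 - a (D a + c q)^-1 D)] for [a = tgrad],
   [D = tdiv], [q = tlap], where [D a = a D + q], cleared of denominators. *)
Fixpoint tresolvent p : R -> T p -> T p := match p with
  | 0 => fun _ U => U
  | p'.+1 => fun c U => rfact p' (c + 1) *: tlapn p'.+1 U - tgrad (tresolvent (c + 1) (tdiv U))
  end.

Lemma tresolventS p c (U : T p.+1) : tresolvent c U =
  rfact p (c + 1) *: tlapn p.+1 U - tgrad (tresolvent (c + 1) (tdiv U)).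
Proof. by []. Qed.

Lemma tresolventZ p c a (U : T p) : tresolvent c (a *: U) = a *: tresolvent c U.
Proof.
elim: p c U => [//|p IH] c U; rewrite !tresolventS tdivZ IH tgradZ tlapnZ.
by rewrite scalerBr !scalerA mulrC.
Qed.

Lemma tresolvent_lap p c (U : T p) : tresolvent c (tlap U) = tlap (tresolvent c U).
Proof.
elim: p c U => [//|p IH] c U; rewrite !tresolventS -tlap_div IH -tlap_grad.
by rewrite -[- tgrad _]scaleN1r tlapD !tlapZ tlapn_lap scaleN1r.
Qed.

Lemma tresolvent_lapn m p c (U : T p) : tresolvent c (tlapn m U) = tlapn m (tresolvent c U).
Proof. by elim: m => //= m IH; rewrite tresolvent_lap IH. Qed.

Lemma tsym_resolvent p c (U : T p) : tsym U -> tsym (tresolvent c U).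
Proof.
elim: p c U => [//|p IH] c U Us; rewrite tresolventS.
apply: tsymD; first exact/tsymZ/tsym_lapn.
by rewrite -scaleN1r; apply/tsymZ/tsym_grad/IH/tsym_div.
Qed.

(** Since D a + c q = a D + (c + 1) q, the inner inverse called for at rank p + 1 and parameter c is
    the resolvent of rank p and parameter c + 1, given by the induction hypothesis. *)
Lemma tresolvent_right p c (U : T p) : tsym U ->
  tgraddiv (tresolvent c U) + c *: tlap (tresolvent c U) = rfact p c *: tlapn p.+1 U.
Proof.
elim: p c U => [|p IH] c U Us; first by rewrite /= add0r.
have Ds := tsym_div Us; have Bs := tsym_resolvent (c + 1) Ds.
have H : tdiv (tgrad (tresolvent (c + 1) (tdiv U))) =
    rfact p (c + 1) *: tlapn p.+1 (tdiv U) - c *: tlap (tresolvent (c + 1) (tdiv U)).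
  by rewrite tdiv_grad// -IH// scalerDl scale1r [c *: _ + _]addrC addrA addrK addrC.
set B := tresolvent (c + 1) (tdiv U) in H *.
rewrite tresolventS -/B.
have -> : tgraddiv (rfact p (c + 1) *: tlapn p.+1 U - tgrad B) = c *: tlap (tgrad B).
  rewrite tgraddivS -[- tgrad B]scaleN1r tdivD !tdivZ H -tlapn_div scaleN1r opprB.
  by rewrite addrCA subrr addr0 tgradZ tlap_grad.
rewrite -[- tgrad B]scaleN1r tlapD !tlapZ scalerDr !scalerA addrCA mulrN1 scaleNr subrr addr0.
by congr (_ *: _).
Qed.

(** Here D is moved through the operator first: D (a D + c q) = (a D + (c + 1) q) D, and the
    induction hypothesis applies to D U. *)
Lemma tresolvent_left p c (U : T p) : tsym U ->
  tresolvent c (tgraddiv U + c *: tlap U) = rfact p c *: tlapn p.+1 U.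
Proof.
elim: p c U => [|p IH] c U Us; first by rewrite /= add0r.
have Ds := tsym_div Us.
rewrite tresolventS.
have -> : tdiv (tgraddiv U + c *: tlap U) = tgraddiv (tdiv U) + (c + 1) *: tlap (tdiv U).
  by rewrite tgraddivS tdivD tdiv_grad// tdivZ -tlap_div scalerDl scale1r addrAC addrC [tlap _ + _]addrC.
rewrite IH// tlapnD tlapnZ tgradZ tlapn_div -tgraddivS tlapn_graddiv tlapn_lap.
by rewrite scalerDr addrAC subrr add0r scalerA mulrC.
Qed.

Fixpoint tgradn k p (U : T p) : T (k + p) := if k is k'.+1 then tgrad (tgradn k' U) else U.

Fixpoint tdivn k p : T (k + p) -> T p := if k is k'.+1 then fun U => tdivn (tdiv U) else id.

Lemma tsym_gradn k p (U : T p) : tsym U -> tsym (tgradn k U).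
Proof. by move=> Us; elim: k => //= k; exact: tsym_grad. Qed.

Lemma tsym_divn k p (U : T (k + p)) : tsym U -> tsym (tdivn U).
Proof. by elim: k U => //= k IH U Us; apply: IH; exact: tsym_div. Qed.

Lemma tgradnD k p (U W : T p) : tgradn k (U + W) = tgradn k U + tgradn k W.
Proof. by elim: k => //= k ->; rewrite tgradD. Qed.

Lemma tgradnZ k p c (U : T p) : tgradn k (c *: U) = c *: tgradn k U.
Proof. by elim: k => //= k ->; rewrite tgradZ. Qed.

Lemma tlap_gradn k p (U : T p) : tlap (tgradn k U) = tgradn k (tlap U).
Proof. by elim: k => //= k IH; rewrite tlap_grad IH. Qed.

(** Each passage of D through one gradient leaves a term q, so that (a D) a^k = a^k (a D + k q). *)
Lemma tgraddiv_gradn k p (U : T p) : tsym U ->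
  tgraddiv (tgradn k U) = tgradn k (tgraddiv U + k%:R *: tlap U).
Proof.
move=> Us; elim: k => [|k IH] /=; first by rewrite scale0r addr0.
rewrite tdiv_grad; last exact: tsym_gradn.
rewrite IH tlap_gradn -tgradnD -natr1 scalerDl scale1r addrCA [tlap _ + _]addrC.
by rewrite addrA.
Qed.

Lemma tdivn_gradnS k p (U : T p) : tsym U ->
  tdivn (tgradn k.+1 U) = tdivn (tgradn k (tgraddiv U + k.+1%:R *: tlap U)).
Proof.
move=> Us /=; rewrite tdiv_grad; last exact: tsym_gradn.
rewrite tgraddiv_gradn// tlap_gradn -tgradnD -natr1 scalerDl scale1r addrCA [tlap _ + _]addrC.
by rewrite addrA.
Qed.

Lemma tdivnD k p (U W : T (k + p)) : tdivn (U + W) = tdivn U + tdivn W.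
Proof. by elim: k U W => //= k IH U W; rewrite tdivD IH. Qed.

Lemma tdivnZ k p c (U : T (k + p)) : tdivn (c *: U) = c *: tdivn U.
Proof. by elim: k U => //= k IH U; rewrite tdivZ IH. Qed.

Lemma tdivn_lapn k p m (U : T (k + p)) : tdivn (tlapn m U) = tlapn m (tdivn U).
Proof. by elim: k U => //= k IH U; rewrite -IH tlapn_div. Qed.

Lemma tgradn_lapn k p m (U : T p) : tgradn k (tlapn m U) = tlapn m (tgradn k U).
Proof. by elim: k => //= k ->; rewrite tlapn_grad. Qed.

Fixpoint tinverse k p (U : T p) : T p :=
  if k is k'.+1 then tresolvent k'.+1%:R (tinverse k' U) else U.

Fixpoint tinverse_cst k p : R := if k is k'.+1 then rfact p k'.+1%:R * tinverse_cst k' p else 1.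

Lemma tinverse_cst_neq0 k p : tinverse_cst k p != 0.
Proof.
elim: k => [|k IH] /=; first exact: oner_neq0.
by rewrite mulf_neq0// gt_eqF// rfact_gt0.
Qed.

Lemma tsym_inverse k p (U : T p) : tsym U -> tsym (tinverse k U).
Proof. by move=> Us; elim: k => //= k; exact: tsym_resolvent. Qed.

(* [tdivn \o tgradn] is the product of the commuting operators [tgraddiv + j tlap], [1 <= j <= k],
   and [tinverse] inverts them one by one. *)
Lemma tdivn_gradn_inverse k p (U : T p) : tsym U ->
  tdivn (tgradn k (tinverse k U)) = tinverse_cst k p *: tlapn (k * p.+1) U.
Proof.
move=> Us; elim: k => [|k IH]; first by rewrite scale1r.
have As := tsym_inverse k Us.
rewrite tdivn_gradnS; last exact/tsym_resolvent.
rewrite tresolvent_right// tgradnZ tdivnZ tgradn_lapn tdivn_lapn IH.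
by rewrite tlapnZ scalerA -tlapn_add mulSn.
Qed.

Lemma tinverseZ k p c (U : T p) : tinverse k (c *: U) = c *: tinverse k U.
Proof. by elim: k => //= k ->; rewrite tresolventZ. Qed.

(** The right inverse produces a solution; this left inverse yields uniqueness. *)
Lemma tinverse_divn_gradn k p (U : T p) : tsym U ->
  tinverse k (tdivn (tgradn k U)) = tinverse_cst k p *: tlapn (k * p.+1) U.
Proof.
elim: k U => [|k IH] U Us; first by rewrite scale1r.
rewrite tdivn_gradnS// [LHS]/= IH; last first.
  by apply: tsymD; [exact: tsym_graddiv|apply: tsymZ; exact: tsym_lap].
rewrite tresolventZ tresolvent_lapn tresolvent_left// tlapnZ scalerA mulrC -tlapn_add addnC -mulSn.
by [].
Qed.

Section Relation.
(** Instantiated by the relation that the second function is the potential of the first. Potentials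
    are additive and commute with derivatives only on data of sufficient order, so they are carried
    through the tensor operators as a relation, not as a linear map of V. *)
Variable rel : V -> V -> Prop.
Hypothesis rel0 : rel 0 0.
Hypothesis relD : forall u u' v v', rel u u' -> rel v v' -> rel (u + v) (u' + v').
Hypothesis rel_pa : forall i u u', rel u u' -> rel (pa i u) (pa i u').

Lemma rel_sum m (F F' : 'I_m -> V) : (forall i, rel (F i) (F' i)) -> rel (\sum_i F i) (\sum_i F' i).
Proof. by move=> FF; apply: (big_ind2 rel) => // u u' v v'; exact: relD. Qed.

Lemma rel_gradn k p (U U' : T p) : (forall I, rel (U I) (U' I)) ->
  forall I, rel (tgradn k U I) (tgradn k U' I).
Proof.
move=> UU; elim: k => //= k IH I; rewrite !ffunE; apply: rel_sum => l; exact: rel_pa.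
Qed.

Lemma rel_divn k p (U U' : T (k + p)) : (forall I, rel (U I) (U' I)) ->
  forall I, rel (tdivn U I) (tdivn U' I).
Proof.
elim: k U U' => [//|k IH] U U' UU /=; apply: IH => I; rewrite !ffunE.
by apply: rel_sum => l; exact: rel_pa.
Qed.

End Relation.

Section Grading.
(** Instantiated by [sorder]: l counts derivatives, and the lemmas record the order of each tensor
    operator. *)
Variable P : nat -> V -> Prop.
Hypothesis P0 : forall l, P l 0.
Hypothesis PD : forall l u v, P l u -> P l v -> P l (u + v).
Hypothesis PZ : forall l c u, P l u -> P l (c *: u).
Hypothesis P_pa : forall l i u, P l u -> P l.+1 (pa i u).
Local Notation TP l U := (forall I, P l (U I)).

Lemma graded_sum l m (F : 'I_m -> V) : (forall i, P l (F i)) -> P l (\sum_i F i).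
Proof. by move=> FP; apply: big_ind => // u v; exact: PD. Qed.

Lemma gradedD l p (U W : T p) : TP l U -> TP l W -> TP l (U + W).
Proof. by move=> UP WP I; rewrite ffunE; exact: PD. Qed.

Lemma gradedZ l p c (U : T p) : TP l U -> TP l (c *: U).
Proof. by move=> UP I; rewrite ffunE; exact: PZ. Qed.

Lemma graded_grad l p (U : T p) : TP l U -> TP l.+1 (tgrad U).
Proof. by move=> UP I; rewrite ffunE; apply: graded_sum => i; exact: P_pa. Qed.

Lemma graded_div l p (U : T p.+1) : TP l U -> TP l.+1 (tdiv U).
Proof. by move=> UP I; rewrite ffunE; apply: graded_sum => i; exact: P_pa. Qed.

Lemma graded_gradn l k p (U : T p) : TP l U -> TP (k + l)%N (tgradn k U).
Proof. by move=> UP; elim: k => //= k IH; exact: graded_grad. Qed.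

Lemma graded_divn l k p (U : T (k + p)) : TP l U -> TP (k + l)%N (tdivn U).
Proof.
by elim: k l U => //= k IH l U UP; rewrite addSnnS; apply: IH; exact: graded_div.
Qed.

Lemma graded_lapn l m p (U : T p) : TP l U -> TP (m.*2 + l)%N (tlapn m U).
Proof.
move=> UP; elim: m => //= m IH I; rewrite ffunE doubleS; apply: graded_sum => i.
by do 2 apply: P_pa.
Qed.

Lemma graded_resolvent l c p (U : T p) : TP l U -> TP (p.*2 + l)%N (tresolvent c U).
Proof.
elim: p c l U => [//|p IH] c l U UP; rewrite tresolventS; apply: gradedD.
  by apply: gradedZ; exact: graded_lapn.
rewrite -scaleN1r; apply: gradedZ; rewrite doubleS addSn; apply: graded_grad.
by rewrite addSnnS; apply: IH; exact: graded_div.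
Qed.

Lemma graded_inverse l k p (U : T p) : TP l U -> TP ((k * p).*2 + l)%N (tinverse k U).
Proof.
move=> UP; elim: k => [//|k IH] /=; rewrite mulSn doubleD -addnA; exact: graded_resolvent.
Qed.

End Grading.

End TensorAlgebra.

(** * Decomposition of tensor fields *)

Section SmoothFunctions.
Context {R : realType} {n : nat}.

Definition smooth_pred : {pred 'rV[R]_n -> R} := [pred h | `[< smooth h >]].

Lemma smooth_submod_closed : submod_closed smooth_pred.
Proof.
split=> [|c f g /asboolP fs /asboolP gs]; apply/asboolP; first exact: smooth0.
by apply: smoothD gs; exact: smoothZ.
Qed.

HB.instance Definition _ := GRing.isSubmodClosed.Build R ('rV[R]_n -> R) smooth_pred smooth_submod_closed.

(** On the module of smooth functions the partial derivatives are linear and commute without side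
    conditions, as the tensor algebra requires. *)
Record smoothf := SmoothF { smoothf_val :> 'rV[R]_n -> R; _ : smoothf_val \in smooth_pred }.

HB.instance Definition _ := [isSub for smoothf_val].
HB.instance Definition _ := [Choice of smoothf by <:].
HB.instance Definition _ := [SubChoice_isSubLmodule of smoothf by <:].

Lemma smoothfP (h : smoothf) : smooth h.
Proof. by case: h => h /= /asboolP. Qed.

Definition mk_smoothf h (hs : smooth h) : smoothf := @SmoothF h (introT (asboolP (smooth h)) hs).

Definition pdf i (h : smoothf) : smoothf := mk_smoothf (smooth_pd i (smoothfP h)).

Lemma pdf_linear i : linear (pdf i).
Proof.
move=> c f g; apply: val_inj => /=.
have fs := smoothfP f; have gs := smoothfP g.
rewrite -[LHS]/(pd i (c *: (f : 'rV[R]_n -> R) + g)) pdD => [|x|x]; last 2 first.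
- by apply: smooth_derivable; exact: smoothZ.
- exact: smooth_derivable.
by rewrite pdZ// => x; exact: smooth_derivable.
Qed.

HB.instance Definition _ i := GRing.isLinear.Build R smoothf smoothf *:%R (pdf i) (pdf_linear i).

Lemma pdfC i j (h : smoothf) : pdf i (pdf j h) = pdf j (pdf i h).
Proof. by apply: val_inj; exact: pdC (smoothfP h). Qed.

End SmoothFunctions.
Arguments smoothf R n : clear implicits.

(** * Tensor fields as tensors of smooth functions *)

Section TensorFields.
Context {R : realType} {n : nat}.
Local Notation V := (smoothf R n).
Local Notation T p := {ffun p.-tuple 'I_n -> V}.

Definition pdl (i : 'I_n) : {linear V -> V} := @pdf R n i.

Lemma pdlC i j (h : V) : pdl i (pdl j h) = pdl j (pdl i h).
Proof. exact: pdfC. Qed.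

Definition field_of p (U : T p) : tfield R n p := fun x => [ffun I => U I x].

Lemma smoothf_sumE m (F : 'I_m -> V) x : (\sum_i F i : V) x = \sum_i F i x.
Proof. by apply: (big_morph (fun h : V => h x)). Qed.

Lemma pdlE i (h : V) : pdl i h = pd i h :> ('rV[R]_n -> R).
Proof. by []. Qed.

Lemma smoothf_pd i (h : V) x : 'D_('e_i) h x = pdl i h x.
Proof. by []. Qed.

Lemma smoothfZE (c : R) (h : V) x : (c *: h) x = c * h x.
Proof. by []. Qed.

Lemma val_vlap (h : V) : vlap pdl h = lap h :> ('rV[R]_n -> R).
Proof.
apply/funext => x; rewrite /vlap smoothf_sumE /lap fct_sumE.
by apply: eq_bigr.
Qed.

Lemma val_lapn m p (U : T p) I : tlapn pdl m U I = iter m lap (U I) :> ('rV[R]_n -> R).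
Proof. by elim: m => //= m IH; rewrite ffunE val_vlap IH. Qed.

Lemma symmetric_perm_eq m (t : tensor R n m) : symmetric_tensor t ->
  forall I J : m.-tuple 'I_n, perm_eq I J -> t I = t J.
Proof.
move=> ts I J /tuple_permP[s Is]; rewrite -(ts s J); congr (t _).
by apply: val_inj; exact: Is.
Qed.

Lemma perm_index_perm_eq m s (I : m.-tuple 'I_n) : perm_eq (perm_index s I) I.
Proof. by apply/tuple_permP; exists s. Qed.

Lemma smooth_sym_field_of p (U : T p) : tsym U -> smooth_sym (field_of U).
Proof.
move=> Us; split=> [x s I|I]; first by rewrite !ffunE; congr (smoothf_val _ x); apply: Us; exact: perm_index_perm_eq.
have -> : (fun x => field_of U x I) = U I by apply/funext => x; rewrite ffunE.
exact: smoothfP.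
Qed.

Lemma field_ofP p (u : tfield R n p) : smooth_sym u -> exists2 U : T p, tsym U & field_of U = u.
Proof.
move=> [usym us]; exists [ffun I => mk_smoothf (us I)].
  move=> I J IJ; rewrite !ffunE; apply: val_inj; apply/funext => x /=.
  exact: symmetric_perm_eq (usym x) _ _ IJ.
by apply/funext => x; apply/ffunP => I; rewrite !ffunE.
Qed.

Lemma field_of_inj p (U W : T p) : field_of U = field_of W -> U = W.
Proof.
move=> e; apply/ffunP => I; apply: val_inj; apply/funext => x.
by have := congr1 (fun u : tfield R n p => u x I) e; rewrite !ffunE.
Qed.

Lemma field_ofD p (U W : T p) x : field_of (U + W) x = field_of U x + field_of W x.
Proof. by apply/ffunP => I; rewrite !ffunE. Qed.

Lemma field_of0 p x : field_of (0 : T p) x = 0.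
Proof. by apply/ffunP => I; rewrite !ffunE. Qed.

(** Composition with a transposition shows that the sum is independent of j. Summed over all j it is
    (p + 1)! times the sum of F, and division by p + 1 gives the claim. *)
Lemma sum_perm_fiber p (F : 'I_p.+1 -> R) (j : 'I_p.+1) :
  \sum_(s : 'S_p.+1) F (s j) = (p`!)%:R * \sum_l F l.
Proof.
have H k : \sum_(s : 'S_p.+1) F (s k) = \sum_(s : 'S_p.+1) F (s j).
  rewrite [RHS](reindex_inj (mulgI (tperm j k))) /=.
  by apply: eq_bigr => s _; rewrite permM tpermL.
have k0 : (p.+1)%:R != 0 :> R by rewrite pnatr_eq0.
apply: (mulfI k0); rewrite mulrA -natrM -factS.
transitivity (\sum_(k < p.+1) \sum_(s : 'S_p.+1) F (s k)).
  by rewrite (eq_bigr _ (fun k _ => H k)) sumr_const card_ord mulr_natl.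
rewrite exchange_big /=.
under eq_bigr => s _ do rewrite -(reindex_inj (@perm_inj _ s) (P := xpredT)) /=.
by rewrite sumr_const card_Sn mulr_natl.
Qed.

(** By symmetry of U the term of a permutation depends only on the index it puts last, where the
    derivative acts; each index occurs p! times, and p! / (p + 1)! remains. *)
Lemma inner_d_field_of p (U : T p) : tsym U ->
  inner_d (field_of U) = field_of (p.+1%:R^-1 *: tgrad pdl U).
Proof.
move=> Us; apply/funext => x; apply/ffunP => I; rewrite /inner_d /symmetrize !ffunE smoothfZE smoothf_sumE.
pose F l := pdl (tnth I l) (U (tdel I l)) x.
have E (s : 'S_p.+1) : [ffun I0 : p.+1.-tuple 'I_n => 'D_('e_(tnth I0 ord_max))
    (fun y => field_of U y [tuple tnth I0 (widen_ord (leqnSn p) j) | j < p]) x] (perm_index s I) = F (s ord_max).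
  rewrite ffunE /F; set I' := perm_index s I.
  have -> : (fun y => field_of U y [tuple tnth I' (widen_ord (leqnSn p) j) | j < p]) = U (tdel I (s ord_max)).
    apply/funext => y; rewrite ffunE; congr (smoothf_val _ y); apply: Us.
    have -> : [tuple tnth I' (widen_ord (leqnSn p) j) | j < p] = tdel I' ord_max.
      apply/eq_from_tnth => j; rewrite !tnth_mktuple; congr (tnth I _); congr (s _).
      by apply: val_inj; rewrite /= /bump leqNgt ltn_ord.
    have tm : tnth I' ord_max = tnth I (s ord_max) by rewrite tnth_mktuple.
    rewrite -(perm_cons (tnth I (s ord_max))) -{1}tm (perm_trans (perm_tdel I' ord_max))//.
    rewrite (perm_trans (perm_index_perm_eq s I))// perm_sym; exact: perm_tdel.
  by rewrite smoothf_pd tnth_mktuple.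
rewrite (eq_bigr _ (fun s _ => E s)) sum_perm_fiber factS natrM invfM mulrA -[_^-1 * _^-1 * _]mulrA.
by rewrite mulVf ?mulr1// pnatr_eq0 -lt0n fact_gt0.
Qed.

Lemma divergence_field_of p (U : T p.+1) : divergence (field_of U) = field_of (tdiv pdl U).
Proof.
apply/funext => x; apply/ffunP => I; rewrite !ffunE smoothf_sumE; apply: eq_bigr => j _.
have -> : (fun y => field_of U y [tuple of rcons I j]) = U [tuple of rcons I j].
  by apply/funext => y; rewrite ffunE.
by [].
Qed.

(** Equal to [p! / (k + p)!]. *)
Fixpoint iter_d_cst k p : R := if k is k'.+1 then ((k' + p).+1%:R)^-1 * iter_d_cst k' p else 1.

Lemma iter_d_cst_neq0 k p : iter_d_cst k p != 0.
Proof. by elim: k => [|k IH] /=; [exact: oner_neq0|rewrite mulf_neq0// invr_eq0 pnatr_eq0]. Qed.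

Lemma iter_d_field_of k p (U : T p) : tsym U ->
  iter_d k (field_of U) = field_of (iter_d_cst k p *: tgradn pdl k U).
Proof.
move=> Us; elim: k => [|k IH] /=; first by rewrite scale1r.
have gs : tsym (tgradn pdl k U) by exact: tsym_gradn.
rewrite IH inner_d_field_of; last exact: tsymZ.
by rewrite tgradZ scalerA.
Qed.

Lemma iter_div_field_of k p (U : T (k + p)) : iter_div (field_of U) = field_of (tdivn pdl U).
Proof. by elim: k U => //= k IH U; rewrite divergence_field_of IH. Qed.

Lemma sqrt_sum_sqr_le (I : finType) (a : I -> R) : Num.sqrt (\sum_i a i ^+ 2) <= \sum_i `|a i|.
Proof.
have s0 : 0 <= \sum_i `|a i| by apply: sumr_ge0.
rewrite -(ler_pXn2r (n := 2))// ?nnegrE ?sqrtr_ge0// sqr_sqrtr; last first.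
  by apply: sumr_ge0 => i _; exact: sqr_ge0.
rewrite expr2 mulr_suml; apply: ler_sum => i _.
rewrite -[a i ^+ 2]real_normK ?num_real// expr2 ler_wpM2l// (bigD1 i)//= lerDl.
exact: sumr_ge0.
Qed.

Lemma tnorm_le_sum p (t : tensor R n p) : tnorm t <= \sum_I `|t I|.
Proof. exact: sqrt_sum_sqr_le. Qed.

Lemma le_tnorm p (t : tensor R n p) I : `|t I| <= tnorm t.
Proof.
rewrite /tnorm -sqrtr_sqr ler_wsqrtr// (bigD1 I)//= lerDl.
by apply: sumr_ge0 => J _; exact: sqr_ge0.
Qed.

Lemma enorm_le (x : 'rV[R]_n) : enorm x <= n%:R * `|x|.
Proof. exact: le_trans (sqrt_sum_sqr_le _) (sum_coord_le x). Qed.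

Lemma norm_le_enorm (x : 'rV[R]_n) : `|x| <= enorm x.
Proof.
apply: norm_rV_le => [|i]; first exact: sqrtr_ge0.
rewrite /enorm -sqrtr_sqr ler_wsqrtr// (bigD1 i)//= lerDl.
by apply: sumr_ge0 => j _; exact: sqr_ge0.
Qed.

Definition decays q (h : 'rV[R]_n -> R) := exists C : R, forall x, (1 + `|x|) ^+ q * `|h x| <= C.

Lemma decaysD q f g : decays q f -> decays q g -> decays q (f + g).
Proof.
move=> [C hC] [D hD]; exists (C + D) => x; rewrite (le_trans _ (lerD (hC x) (hD x)))//.
by rewrite -mulrDr ler_wpM2l ?ler_normD// exprn_ge0// addr_ge0.
Qed.

Lemma decaysZ q (c : R) f : decays q f -> decays q (c *: f).
Proof.
move=> [C hC]; exists (`|c| * C) => x; rewrite -[(c *: f) x]/(c * f x) normrM mulrCA.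
by rewrite ler_wpM2l.
Qed.

Lemma schwartz_decays q f : schwartz f -> decays q f.
Proof.
elim: q f => [|q IH] f fS.
  by have [C _ hC] := schwartz_bounded fS; exists C => x; rewrite expr0 mul1r.
have [C hC] := IH _ fS.
have /choice[D hD] j := IH _ (schwartz_xmul j fS).
exists (C + \sum_j D j) => x; rewrite exprSr -mulrA mulrDl mul1r mulrDr lerD//.
have p : 0 <= (1 + `|x|) ^+ q by rewrite exprn_ge0// addr_ge0.
apply: (@le_trans _ _ (\sum_j (1 + `|x|) ^+ q * `|xmul j f x|)); last exact: ler_sum.
rewrite -mulr_sumr ler_wpM2l//.
under eq_bigr => j _ do rewrite normrM.
rewrite -mulr_suml ler_wpM2r//; apply: norm_rV_le => [|i]; first exact: sumr_ge0.
by rewrite (bigD1 i)//= lerDl; exact: sumr_ge0.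
Qed.

Lemma tfield_decay p (u : tfield R n p) q : (forall I, decays q (fun x => u x I)) ->
  exists2 C : R, 0 <= C & forall x, (1 + enorm x) ^+ q * tnorm (u x) <= C.
Proof.
move=> /choice[C hC].
have C0 I : 0 <= C I by apply: le_trans (hC I 0); rewrite mulr_ge0// exprn_ge0// addr_ge0.
(* [1 + enorm x <= (n + 1) (1 + |x|)] converts the sup norm into the Euclidean one. *)
exists (n.+1%:R ^+ q * \sum_I C I) => [|x]; first by rewrite mulr_ge0 ?exprn_ge0// sumr_ge0.
have e0 : 0 <= enorm x by exact: sqrtr_ge0.
apply: (@le_trans _ _ ((n.+1%:R * (1 + `|x|)) ^+ q * \sum_I `|u x I|)).
  apply: ler_pM; rewrite ?exprn_ge0 ?addr_ge0 ?sqrtr_ge0 ?tnorm_le_sum//.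
  rewrite lerXn2r ?nnegrE ?addr_ge0 ?mulr_ge0 ?addr_ge0// -natr1 mulrDl mul1r.
  by rewrite mulrDr mulr1 addrA [leRHS]addrAC -addrA; have := enorm_le x; have := ler0n R n; have := normr_ge0 x; lra.
rewrite exprMn -mulrA ler_wpM2l ?exprn_ge0// mulr_sumr; exact: ler_sum.
Qed.

Lemma exprz_decay (a b C : R) q (z : int) : 1 <= a -> a ^+ q * b <= C -> - q%:Z <= z ->
  b <= `|C| * a ^ z.
Proof.
move=> a1 abC qz; have a0 : 0 < a by exact: lt_le_trans a1.
have aq : 0 < a ^+ q by rewrite exprn_gt0.
apply: (@le_trans _ _ (`|C| * a ^ (- q%:Z))).
  by rewrite -invr_expz ler_pdivlMr ?exprn_gt0// mulrC (le_trans abC)// ler_norm.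
by rewrite ler_wpM2l// ler_weXz2l.
Qed.

Lemma vanishes_of_decay p (u : tfield R n p) q : (0 < q)%N ->
  (forall I, decays q (fun x => u x I)) -> vanishes_at_infty u.
Proof.
move=> q0 /tfield_decay[C C0 hC]; apply/cvgrPdist_le => e e0.
exists (C / e) => // x /= xC; rewrite sub0r normrN ger0_norm ?sqrtr_ge0//.
have en0 : 0 <= enorm x by exact: sqrtr_ge0.
have a1 : 1 <= 1 + enorm x by rewrite lerDl.
have a0 : 0 < 1 + enorm x by exact: lt_le_trans a1.
have : (1 + enorm x) * tnorm (u x) <= C.
  rewrite (le_trans _ (hC x))// ler_wpM2r ?sqrtr_ge0//.
  by rewrite -[leLHS]expr1 ler_weXn2l.
rewrite -ler_pdivlMl// => /le_trans; apply.
rewrite ler_pdivrMl// -ler_pdivrMr//; apply: (le_trans (ltW xC)).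
by rewrite lerDr.
Qed.

Lemma vanishing_component p (u : tfield R n p) I : vanishes_at_infty u -> vanishing (fun x => u x I).
Proof.
move=> uv e e0; have /cvgrPdist_le/(_ _ e0)[A _ hA] := uv; exists A => x xA.
have := hA x (lt_le_trans xA (norm_le_enorm x)); rewrite /= sub0r normrN ger0_norm ?sqrtr_ge0//.
by apply: le_trans; exact: le_tnorm.
Qed.

End TensorFields.

(** * Existence, uniqueness and decay of the decomposition *)

Section Decomposition.
Context {R : realType} {n : nat}.
Local Notation V := (smoothf R n).
Local Notation T p := {ffun p.-tuple 'I_n -> V}.

Lemma potential_solution k p (F : T (k + p)) : (1 <= k)%N -> (k <= n - 1)%N -> tsym F ->
  (forall I, schwartz (F I)) ->
  exists U : T p, [/\ tsym U, forall l I, decays (n - k + l) (tgradn (@pdl R n) l U I)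
    & tdivn (@pdl R n) (tgradn (@pdl R n) k U) = tdivn (@pdl R n) F].
Proof.
move=> k1 kn Fs FS; pose P l (h : V) := sorder l (h : 'rV[R]_n -> R).
have P0 l : P l 0 by exact: sorder0.
have PD l u v : P l u -> P l v -> P l (u + v) by exact: sorderD.
have PZ l c u : P l u -> P l (c *: u) by exact: sorderZ.
have Ppa l i u : P l u -> P l.+1 (pdl i u) by exact: sorder_pd.
pose G := tdivn (@pdl R n) F; have Gs : tsym G by exact: tsym_divn.
have Gk : forall I, P (k + 0)%N (G I) by exact: (graded_divn P0 PD Ppa).
pose H := tinverse (@pdl R n) k G; have Hs : tsym H by exact: tsym_inverse.
(* Order 2 p from each of the k resolvents, and k from the iterated divergence. *)
pose lH := ((k * p).*2 + (k + 0))%N.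
have Hl : forall I, P lH (H I) by exact: (graded_inverse P0 PD PZ Ppa).
have [s ks] : exists s, (k * p.+1 = s.+1)%N.
  by exists (k * p.+1).-1; rewrite prednK// muln_gt0 k1.
pose e := s.*2.+1.
(* With M = k (p + 1) = s + 1 one has e + 2 = 2 M + 1 and lH = 2 M - k, so this is the condition k
   <= n - 1. *)
have nl : (e.+2 <= n + lH)%N by move: ks; rewrite /lH /e mulnS; move: (k * p)%N => w; lia.
pose U := [ffun I => mk_smoothf (smooth_pot (Hl I) nl)] : T p.
have Us : tsym U.
  move=> I J IJ; rewrite !ffunE; apply: val_inj => /=; congr (pot e (smoothf_val _)).
  exact: Hs.
pose rel (u u' : V) := P lH u /\ u' = pot e u :> ('rV[R]_n -> R).
have rel0 : rel 0 0.
  split=> //; apply/funext => x; have := potZ 0 x (P0 lH : sorder lH (0 : V)) nl.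
  by rewrite scale0r mul0r.
have relD u u' v v' : rel u u' -> rel v v' -> rel (u + v) (u' + v').
  move=> [uP eu] [vP ev]; split; first exact: PD.
  apply/funext => x; rewrite -[LHS]/(u' x + v' x) eu ev; apply: esym.
  exact: (potD x uP vP nl).
have relpa i u u' : rel u u' -> rel (pdl i u) (pdl i u').
  move=> [uP eu]; split; first exact/sorderW/sorder_pd.
  by rewrite !pdlE eu; exact: pd_pot uP nl.
have relHU I : rel (H I) (U I) by split=> //; rewrite ffunE.
have relg l I : rel (tgradn (@pdl R n) l H I) (tgradn (@pdl R n) l U I).
  exact: (rel_gradn rel0 relD relpa relHU).
have [c c0 hc] := @pot_iter_lap R n s.
have n2 : (2 <= n)%N by lia.
pose K : R := tinverse_cst k p; have K0 : K != 0 by exact: tinverse_cst_neq0.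
exists ((K * c)^-1 *: U); split.
- exact: tsymZ.
- move=> l I; rewrite tgradnZ ffunE; apply: (@decaysZ _ _ _ _ (tgradn (@pdl R n) l U I)).
  rewrite (relg l I).2.
  have Hll : P (l + lH)%N (tgradn (@pdl R n) l H I) by exact: (graded_gradn P0 PD Ppa).
  (* [pot_bound] gains one power over q, so q is one less than the wanted exponent n - k + l. *)
  have nq : (n + (l + lH) = e + (n - k + l).-1.+2)%N.
    by move: ks; rewrite /lH /e mulnS; move: (k * p)%N => w; lia.
  have [C C0 hC] := pot_bound Hll nq; exists C => x.
  by have := hC x; rewrite prednK//; lia.
rewrite tgradnZ tdivnZ; apply/ffunP => I; apply: val_inj; apply/funext => x.
rewrite ffunE -[LHS]/((K * c)^-1 * tdivn (@pdl R n) (tgradn (@pdl R n) k U) I x).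
(* The operator D^k a^k passes under the potential and meets H, giving K q^M G; the potential of q^M
   G is c G, and the normalization [(K * c)^-1] cancels both constants. *)
rewrite (rel_divn rel0 relD relpa (fun J => relg k J) I).2.
rewrite (tdivn_gradn_inverse (@pdlC R n) k Gs) ffunE ks -/K.
have Gl : sorder (s.+1).*2 (iter s.+1 lap (G I : 'rV[R]_n -> R)).
  have G0 := sorder_schwartz (Gk I : sorder _ _).
  by elim: s.+1 => [//|m IH]; exact: sorder_lap IH.
have Gl' : sorder (s.+1).*2 (tlapn (@pdl R n) s.+1 G I) by rewrite val_lapn.
have nG : (e.+2 <= n + (s.+1).*2)%N by rewrite /e; lia.
rewrite -[pot e _ x]/(pot e (K *: (tlapn (@pdl R n) s.+1 G I : 'rV[R]_n -> R)) x).
rewrite (potZ K x Gl' nG) val_lapn (hc _ x (sorder_schwartz (Gk I : sorder _ _)) n2).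
by rewrite [X in _ * X]mulrA mulKf// mulf_neq0.
Qed.

Lemma tensor_uniqueness k p (U : T p) : (0 < n)%N -> tsym U ->
  tdivn (@pdl R n) (tgradn (@pdl R n) k U) = 0 -> (forall I, vanishing (U I)) -> U = 0.
Proof.
move=> n0 Us U0 Uv; have := tinverse_divn_gradn (@pdlC R n) k Us.
have inv0 : tinverse (@pdl R n) k (0 : T p) = 0.
  by have := tinverseZ (@pdl R n) k 0 (0 : T p); rewrite !scale0r.
rewrite U0 inv0 => /esym/eqP; rewrite scaler_eq0 (negbTE (tinverse_cst_neq0 k p)) /= => /eqP L0.
apply/ffunP => I; apply: val_inj; rewrite ffunE.
apply: (@polyharmonic_vanishing R n (k * p.+1) (U I) n0 (smoothfP _) (Uv I)).
by rewrite -val_lapn L0 ffunE.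
Qed.

(** The rank m is related to k + p by an arbitrary equality, so that case analysis on it turns both
    casts into identities. *)
Lemma decomposition_core k p m (e : (k + p = m)%N) (f : tfield R n m) :
  (1 <= k)%N -> (k <= n - 1)%N -> schwartz_sym f ->
  exists (g : tfield R n m) (v : tfield R n p),
    [/\ [/\ smooth_sym g /\ smooth_sym v,
        forall x, f x = g x + cast_tfield e (iter_d k v) x,
        forall x, iter_div (cast_tfield (esym e) g) x = 0,
        vanishes_at_infty g & vanishes_at_infty v],
      forall (g' : tfield R n m) (v' : tfield R n p),
        [/\ smooth_sym g' /\ smooth_sym v',
        forall x, f x = g' x + cast_tfield e (iter_d k v') x,
        forall x, iter_div (cast_tfield (esym e) g') x = 0,
        vanishes_at_infty g' & vanishes_at_infty v'] -> g' = g /\ v' = v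
    & (forall I, decays n (fun x => g x I)) /\
      (forall l I, decays (n - k + l) (fun x => iter_d l v x I))].
Proof.
case: m / e f => f k1 kn [fsym fS].
have fs : smooth_sym f by split=> // I; exact: (fS I).1.
have [F Fsym Ff] := field_ofP fs.
have FS I : schwartz (F I).
  by move: (fS I); rewrite -Ff; congr schwartz; apply/funext => x; rewrite ffunE.
have [U [Us Ud UF]] := potential_solution k1 kn Fsym FS.
(* The factor between d^k and the unnormalized iterated gradient; the potential of the statement is
   U divided by it. *)
pose a := (iter_d_cst k p : R); have a0 : a != 0 by exact: iter_d_cst_neq0.
have dk (W : T p) : tsym W -> iter_d k (field_of (a^-1 *: W)) = field_of (tgradn (@pdl R n) k W).
  by move=> Ws; rewrite iter_d_field_of ?tgradnZ ?scalerA ?divff ?scale1r//; exact: tsymZ.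
have gs : tsym (tgradn (@pdl R n) k U) by exact: tsym_gradn.
pose g := field_of (F - tgradn (@pdl R n) k U); pose v := field_of (a^-1 *: U).
have Gs : tsym (F - tgradn (@pdl R n) k U) by apply: tsymD => //; rewrite -scaleN1r; exact: tsymZ.
have vs : tsym (a^-1 *: U) by exact: tsymZ.
have divB (A B : T (k + p)) : tdivn (@pdl R n) (A - B) = tdivn (@pdl R n) A - tdivn (@pdl R n) B.
  by rewrite tdivnD -scaleN1r tdivnZ scaleN1r.
have vd l I : decays (n - k + l) (fun x => iter_d l v x I).
  rewrite /v iter_d_field_of// tgradnZ scalerA.
  have -> : (fun x => field_of ((iter_d_cst l p / a) *: tgradn (@pdl R n) l U) x I) =
     (iter_d_cst l p / a) *: (tgradn (@pdl R n) l U I : 'rV[R]_n -> R).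
    by apply/funext => x; rewrite !ffunE.
  exact/decaysZ/Ud.
have gd I : decays n (fun x => g x I).
  have -> : (fun x => g x I) = (F I : 'rV[R]_n -> R) + (-1) *: (tgradn (@pdl R n) k U I : 'rV[R]_n -> R).
    by apply/funext => x; rewrite !ffunE scaleN1r.
  apply: decaysD; first exact: schwartz_decays.
  by apply: decaysZ; have := Ud k I; rewrite subnK//; lia.
exists g, v; split; last by split.
- split.
  + by split; exact: smooth_sym_field_of.
  + by move=> x; rewrite /cast_tfield /= /v dk// -Ff -field_ofD subrK.
  + by move=> x; rewrite /cast_tfield /= iter_div_field_of divB UF subrr field_of0.
  + by apply: (vanishes_of_decay _ gd); lia.
  + by apply: (@vanishes_of_decay _ _ _ _ (n - k)) => [|I]; [lia|have := vd 0%N I; rewrite addn0].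
move=> g' v' [[g's v's] fgv dg gv vv].
have [G' G's Gg'] := field_ofP g's; have [W0 W0s Wv'] := field_ofP v's.
pose W := a *: W0; have Ws : tsym W by exact: tsymZ.
have vW : v' = field_of (a^-1 *: W) by rewrite -Wv' /W scalerA mulVf ?scale1r.
have FG : F = G' + tgradn (@pdl R n) k W.
  apply: field_of_inj; apply/funext => x; rewrite field_ofD Ff Gg' -dk// -vW.
  exact: fgv.
have dG' : tdivn (@pdl R n) G' = 0.
  apply: field_of_inj; apply/funext => x; rewrite field_of0 -iter_div_field_of Gg'.
  exact: dg.
have van (Z : T p) : vanishes_at_infty (field_of (a^-1 *: Z)) -> forall I, vanishing (Z I).
  move=> Zv I e e0; have ea : 0 < e / `|a| by rewrite divr_gt0// normr_gt0.
  have [A hA] := vanishing_component I Zv ea; exists A => x /hA.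
  rewrite !ffunE smoothfZE normrM normfV mulrC ler_pM2r//.
  by rewrite invr_gt0 normr_gt0.
(* D^k a^k W = D^k F because D^k G' = 0, and U solves the same equation; the difference vanishes at
   infinity. *)
have WU : W - U = 0.
  apply: (@tensor_uniqueness k); first by lia.
  - by apply: tsymD => //; rewrite -scaleN1r; exact: tsymZ.
  - have gradB (A B : T p) : tgradn (@pdl R n) k (A - B) = tgradn (@pdl R n) k A - tgradn (@pdl R n) k B.
      by rewrite tgradnD -[- B]scaleN1r tgradnZ scaleN1r.
    by rewrite gradB divB UF FG tdivnD dG' add0r subrr.
  have Uv : vanishes_at_infty v.
    by apply: (@vanishes_of_decay _ _ _ _ (n - k)) => [|I]; [lia|have := vd 0%N I; rewrite addn0].
  move=> I.
  have -> : (W - U) I = (W I : 'rV[R]_n -> R) - (U I : 'rV[R]_n -> R) :> ('rV[R]_n -> R).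
    by rewrite !ffunE.
  apply: vanishingD; first by apply: van; rewrite -vW.
  by apply: vanishingN; exact: van.
have eWU : W = U by apply/eqP; rewrite -subr_eq0 WU.
split; last by rewrite vW eWU.
by rewrite -Gg' /g FG eWU addrK.
Qed.

End Decomposition.

Theorem theorem3p4 (R : realType) (n m k : nat) (hk : (1 <= k)%N)
    (hkn : (k <= n - 1)%N) (hkm : (k <= m)%N)
    (f : tfield R n m) (hf : schwartz_sym f) :
  exists (g : tfield R n m) (v : tfield R n (m - k)),
    [/\ decomposition hkm f g v,
        forall (g' : tfield R n m) (v' : tfield R n (m - k)),
          decomposition hkm f g' v' -> g' = g /\ v' = v
      & exists C : R, forall x : 'rV[R]_n,
          tnorm (g x) <= C * (1 + enorm x) ^ (1 - n%:Z) /\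
          forall l : nat, (l <= k)%N ->
            tnorm (iter_d l v x)
              <= C * (1 + enorm x) ^ (k%:Z + 1 - l%:Z - n%:Z)].
Proof.
have [g [v [dec uniq [gd vd]]]] := decomposition_core (subnKC hkm) hk hkn hf.
exists g, v; split=> //.
have [C C0 hC] := tfield_decay gd.
have /choice[D hD] (l : nat) : exists D : R, forall x, (1 + enorm x) ^+ (n - k + l) * tnorm (iter_d l v x) <= D.
  by have [D _ hD] := tfield_decay (vd l); exists D.
have S0 : 0 <= \sum_(l < k.+1) `|D l| by apply: sumr_ge0.
(* A single constant for g and for all l up to k. *)
exists (`|C| + \sum_(l < k.+1) `|D l|) => x.
have a1 : 1 <= 1 + enorm x by rewrite lerDl sqrtr_ge0.
have p z : 0 <= (1 + enorm x) ^ z by rewrite exprz_ge0// (le_trans _ a1).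
split=> [|l lk].
  apply: (le_trans (exprz_decay a1 (hC x) (z := 1 - n%:Z) _)); first by lia.
  by rewrite ler_wpM2r// lerDl.
apply: (le_trans (exprz_decay a1 (hD l x) (z := k%:Z + 1 - l%:Z - n%:Z) _)); first by lia.
rewrite ler_wpM2r//; have lk' : (l < k.+1)%N by [].
rewrite (bigD1 (Ordinal lk'))//= addrCA lerDl addr_ge0//; exact: sumr_ge0.
Qed.
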